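(* Let $f\in IV\cup III\cup II_a\cup II_b\cup II_c$. (1) Suppose $f$ has real coefficients. The group $\mathrm{Aut}_h(W)^{f,c}$ of holomorphic automorphisms of $W$ commuting with $f$ and with the standard conjugation $c$ is: - $\mathrm{GL}(2,\mathbb{R})$ if $f\in IV$; - $\{(z,w)\mapsto(az+bw^r,dw)\mid a\in\mathbb{R}^*,\ d\in\mathbb{R}^*,\ b\in\mathbb{R}\}$ if $f\in III$; - $\{(z,w)\mapsto(a^rz+bw^r,aw)\mid a\in\mathbb{R}^*,\ b\in\mathbb{R}\}$ if $f\in II_a$; - $\{(z,w)\mapsto(az+bw,aw)\mid a\in\mathbb{R}^*,\ b\in\mathbb{R}\}$ if $f\in II_b$; - $\{(z,w)\mapsto(az,dw)\mid a\in\mathbb{R}^*,\ d\in\mathbb{R}^*\}$ if $f\in II_c$. (2) Suppose $f\in II'_c$. Then the group of holomorphic automorphisms of $W$ commuting with $f$ and $c'$ is $\mathrm{Aut}_h(W)^{f,c'}=\{(z,w)\mapsto(az,\bar a w)\mid a\in\mathbb{C}^*\}$. (3) In each case the cyclic group $\langle f\rangle$ is a central subgroup of $\mathrm{Aut}_h(W)^{f,c}$, respectively $\mathrm{Aut}_h(W)^{f,c'}$, and the automorphism group $\mathrm{Aut}_h(H_f,s_f)$ is identified with the quotient $\mathrm{Aut}_h(W)^{f,c}/\langle f\rangle$, respectively $\mathrm{Aut}_h(W)^{f,c'}/\langle f\rangle$.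
   Context: $W=\mathbb{C}^2\setminus\{0\}$; $\mathrm{Aut}_h(W)$ is its group of biholomorphisms; $\langle f\rangle$ is the cyclic group generated by $f$; $H_f=W/\langle f\rangle$. Classes of contractions of $W$: - $IV$: $f(z,w)=(\alpha z,\alpha w)$, $0<|\alpha|<1$; - $III$: $f(z,w)=(\delta^r z,\delta w)$, $r\in\mathbb{N}$, $r\ge 2$, $0<|\delta|<1$; - $II_a$: $f(z,w)=(\delta^r z+w^r,\delta w)$, $r\in\mathbb{N}$, $r\ge2$, $0<|\delta|<1$; - $II_b$: $f(z,w)=(\alpha z+w,\alpha w)$, $0<|\alpha|<1$; - $II_c$: $f(z,w)=(\alpha z,\delta w)$, $0<|\alpha|<1$, $0<|\delta|<1$, $\alpha\ne\delta^r$ for all $r\in\mathbb{N}$; - $II'_c\subset II_c$: $f(z,w)=(\alpha z,\bar\alpha w)$, $0<|\alpha|<1$, $\alpha\notin\mathbb{R}$. In (1), $r$ in the cases $III$, $II_a$ is the exponent in the definition of $f$. $c(z,w)=(\bar z,\bar w)$ and $c'(z,w)=(\bar w,\bar z)$ on $W$. The standard Real structure $s_f$ (an anti-holomorphic involution of $H_f$) is induced by $c$ if $f$ has real coefficients and by $c'$ if $f\in II'_c$. $\mathrm{Aut}_h(H_f,s_f)$ is the group of biholomorphisms of $H_f$ commuting with $s_f$.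
   Formalization: In (1), case II_c, the condition δ≠α^r for all r∈ℕ is added: as stated the claim fails, e.g. for f=(αz,α²w), 0<α<1, the map (z,w)↦(z,w+z²) commutes with f and c but is not diagonal. *)

(* Defs.v *)
From HB Require Import structures.
From mathcomp Require Import all_boot all_order all_algebra.
From mathcomp Require Import generic_quotient complex.
From mathcomp Require Import all_classical all_reals all_analysis.

Set Implicit Arguments.
Unset Strict Implicit.
Unset Printing Implicit Defensive.

Import Order.TTheory GRing.Theory Num.Theory numFieldNormedType.Exports.

Local Open Scope quotient_scope.
Local Open Scope complex_scope.
Local Open Scope classical_set_scope.
Local Open Scope ring_scope.

Section TransformationGroups.
Variable T : Type.
Implicit Types G N X Y : set (T -> T).

Definition is_group G :=
  [/\ G id,
      forall g h, G g -> G h -> G (g \o h)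
    & forall g, G g -> exists h, [/\ G h, cancel g h & cancel h g]].

Definition central_subgroup N G :=
  [/\ is_group G, is_group N, N `<=` G
    & forall n g, N n -> G g -> n \o g = g \o n].

Definition cyclic_group (f : T -> T) : set (T -> T) :=
  [set g | exists n, g = iter n f \/ (cancel g (iter n f) /\ cancel (iter n f) g)].

Definition left_coset N (g : T -> T) : set (T -> T) := [set g \o n | n in N].

Definition quotient_group G N : set (set (T -> T)) := [set left_coset N g | g in G].

Definition compset X Y : set (T -> T) := [set g \o h | g in X & h in Y].

End TransformationGroups.

Section HolomorphicMaps.
Variable R : realType.

(* The regular module R[i]^o is what makes differentiability complex linear. *)
Definition C2 : normedModType R[i] := (R[i]^o * R[i]^o)%type.

(* A topological space with a set of charts, i.e. pairs of a domain and a map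
   to C^2 (junk outside of the domain). *)
Record charted_space := ChartedSpace {
  carrier :> topologicalType;
  charts : set (set carrier * (carrier -> C2))
}.

(* The transition l o phi o k^-1 is differentiable over R[i] on k(dom k); the
   default value of the partial inverse is irrelevant when charts are injective
   with open image. *)
Definition holomorphic (X Y : charted_space) (phi : X -> Y) : Prop :=
  continuous phi /\
  forall k l, charts k -> charts l ->
  forall x : X, k.1 x -> l.1 (phi x) ->
    differentiable (l.2 \o phi \o 'pinv_(fun=> x) k.1 k.2) (k.2 x).

Definition Aut_h (X : charted_space) : set (X -> X) :=
  [set g | holomorphic g /\
    exists h, [/\ holomorphic h, cancel g h & cancel h g]].

End HolomorphicMaps.
Arguments Aut_h {R} X.

Section PuncturedPlane.
Variable R : realType.

Definition punctured : set (C2 R) := [set p | p != 0].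

Definition W : charted_space R :=
  @ChartedSpace R (set_type punctured) [set ([set: set_type punctured], val)].

Implicit Types (f g : W -> W) (r : nat).

Definition given_by g (F : R[i] -> R[i] -> R[i] * R[i]) : Prop :=
  forall p : W, val (g p) = F (val p).1 (val p).2.

Lemma conj_neq0 (p : W) : (((val p).1^*, (val p).2^*) : C2 R) \in punctured.
Proof.
rewrite inE /punctured /=; apply/eqP => -[/eqP h1 /eqP h2].
have := set_valP p; rewrite /punctured /= => /eqP; apply.
move: h1 h2; rewrite !conjc_eq0 => /eqP h1 /eqP h2.
by rewrite (surjective_pairing (val p)) h1 h2.
Qed.

Lemma conj'_neq0 (p : W) : (((val p).2^*, (val p).1^*) : C2 R) \in punctured.
Proof.
rewrite inE /punctured /=; apply/eqP => -[/eqP h1 /eqP h2].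
have := set_valP p; rewrite /punctured /= => /eqP; apply.
move: h1 h2; rewrite !conjc_eq0 => /eqP h1 /eqP h2.
by rewrite (surjective_pairing (val p)) h1 h2.
Qed.

Definition c (p : W) : W := exist (fun q => q \in punctured) _ (conj_neq0 p).

Definition c' (p : W) : W := exist (fun q => q \in punctured) _ (conj'_neq0 p).

Definition IV f := exists alpha : R[i],
  0 < `|alpha| < 1 /\ given_by f (fun z w => (alpha * z, alpha * w)).

Definition III r f := (2 <= r)%N /\ exists delta : R[i],
  0 < `|delta| < 1 /\ given_by f (fun z w => (delta ^+ r * z, delta * w)).

Definition IIa r f := (2 <= r)%N /\ exists delta : R[i],
  0 < `|delta| < 1 /\
  given_by f (fun z w => (delta ^+ r * z + w ^+ r, delta * w)).

Definition IIb f := exists alpha : R[i],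
  0 < `|alpha| < 1 /\ given_by f (fun z w => (alpha * z + w, alpha * w)).

(* The condition is not symmetric: delta = alpha ^+ r with r >= 2 is allowed,
   and then (z, w) |-> (z, w + z ^+ r) commutes with f, so that the centralizer
   of f is diagonal only under the additional condition delta != alpha ^+ r. *)
Definition IIc (alpha delta : R[i]) f :=
  [/\ 0 < `|alpha| < 1, 0 < `|delta| < 1,
      forall r, alpha != delta ^+ r
    & given_by f (fun z w => (alpha * z, delta * w))].

Definition IIc' f := exists alpha : R[i],
  [/\ 0 < `|alpha| < 1, alpha \isn't Num.real
    & given_by f (fun z w => (alpha * z, alpha^* * w))].

Definition real_poly_eval (P : {poly {poly R}}) (z w : R[i]) : R[i] :=
  (map_poly (map_poly (real_complex R)) P).[z%:P].[w].

Definition real_coefficients f := exists P Q : {poly {poly R}},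
  given_by f (fun z w => (real_poly_eval P z w, real_poly_eval Q z w)).

Definition Aut_h_W (f s : W -> W) : set (W -> W) :=
  [set g | [/\ Aut_h W g, g \o f = f \o g & g \o s = s \o g]].

End PuncturedPlane.

Section HopfSurface.
Variable R : realType.
Local Notation W := (W R).
Variable f : W -> W.

(* For bijective f this is the orbit relation of the cyclic group generated by
   f (lemma orbit_relP); in this form it is an equivalence for every f. *)
Definition orbit_rel (p q : W) : bool :=
  `[< exists m n, iter m f p = iter n f q >].

Lemma orbit_rel_equiv : equiv_class_of orbit_rel.
Proof.
split=> [p|p q|q p r].
- by apply/asboolP; exists 0%N, 0%N.
- by apply/asboolP/asboolP => -[m [n e]]; exists n, m.
- move=> /asboolP[m [n e]] /asboolP[k [l e']].
  apply/asboolP; exists (k + m)%N, (n + l)%N.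
  by rewrite iterD e -iterD addnC iterD e' -iterD.
Qed.

Canonical orbit_equiv := EquivRelPack orbit_rel_equiv.

Lemma orbit_relP (p q : W) : bijective f ->
  orbit_rel p q <-> exists2 g, cyclic_group f g & g p = q.
Proof.
move=> [h fK hK].
have iK n : cancel (iter n f) (iter n h).
  by elim: n => // n IHn x; rewrite iterSr /= fK IHn.
have iK' n : cancel (iter n h) (iter n f).
  by elim: n => // n IHn x; rewrite iterSr /= hK IHn.
split=> [/asboolP[m [n e]]|[g [n [->|[gK Kg]]] <-]].
- have [mn|nm] := leqP n m.
    exists (iter (m - n) f); first by exists (m - n)%N; left.
    by apply: (can_inj (iK n)); rewrite -iterD subnKC.
  exists (iter (n - m) h); first by exists (n - m)%N; right.
  apply: (can_inj (iK (n - m)%N)); rewrite iK'; apply: (can_inj (iK m)).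
  by rewrite -iterD subnKC // ltnW.
- by apply/asboolP; exists n, 0%N.
- by apply/asboolP; exists 0%N, n; rewrite gK.
Qed.

Definition hopf_space : topologicalType :=
  quotient_topology {eq_quot orbit_equiv}.

Definition hopf_pi (p : W) : hopf_space := \pi_({eq_quot orbit_equiv}) p.

(* The charts of the quotient are the local inverses of the projection. A
   contraction f acts freely and properly discontinuously, so they cover the
   quotient and their transition maps are locally iterates of f or f^-1. *)
Definition hopf : charted_space R :=
  @ChartedSpace R hopf_space
    [set k | exists s : hopf_space -> W,
      [/\ open k.1, open (s @` k.1), forall x, k.1 x -> hopf_pi (s x) = x
        & k.2 = val \o s]].

(* Characterized by induced_pi when h commutes with f. *)
Definition induced (h : W -> W) (x : hopf) : hopf :=
  hopf_pi (h (repr (x : {eq_quot orbit_equiv}))).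

Lemma induced_pi (h : W -> W) (p : W) :
  h \o f = f \o h -> induced h (hopf_pi p) = hopf_pi (h p).
Proof.
move=> hf.
have: orbit_rel (repr (hopf_pi p : {eq_quot orbit_equiv})) p.
  by apply/(@eqmodP _ orbit_equiv); rewrite reprK.
rewrite /induced; set q := repr _; move=> /asboolP[m [n e]].
apply/(@eqmodP _ orbit_equiv)/asboolP; exists m, n.
have hi k x : h (iter k f x) = iter k f (h x).
  by elim: k => //= k <-; exact: (congr1 (@^~ _) hf).
by rewrite -!hi e.
Qed.

Definition Aut_h_hopf (s : hopf -> hopf) : set (hopf -> hopf) :=
  [set phi | Aut_h hopf phi /\ phi \o s = s \o phi].

(* The isomorphism is the one sending the class of g to the map induced by g
   on the quotient surface. *)
Definition Aut_hopf_identified (s : W -> W) : Prop :=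
  let G := Aut_h_W f s in
  let N := cyclic_group f in
  exists Phi : set (W -> W) -> (hopf -> hopf),
  [/\ set_bij (quotient_group G N) (Aut_h_hopf (induced s)) Phi,
      forall X Y, quotient_group G N X -> quotient_group G N Y ->
        Phi (compset X Y) = Phi X \o Phi Y
    & forall g, G g -> forall p, Phi (left_coset N g) (hopf_pi p) = hopf_pi (g p)].

End HopfSurface.

(* Main.v *)
Require Import Defs.
From HB Require Import structures.
From mathcomp Require Import all_boot all_order all_algebra.
From mathcomp Require Import generic_quotient complex.
From mathcomp Require Import all_classical all_reals all_analysis.
From mathcomp Require Import ring lra zify.

(* All the contractions have the form f(z, w) = (mu z + kap w^r, de w), and shrink the weighted
   size rho(z, w) = e |z| + |w|^r by a factor lam < 1, while the inverse of f expands it by at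
   most some L. A map g commuting with f is bounded on the annulus 1 / L <= rho <= 1, so
   rho(g p) grows at most polynomially in rho(p). By Liouville's theorem on
   the lines z = a and w = b with a, b nonzero, g is polynomial in each variable separately,
   hence polynomial, and comparing coefficients in g f = f g gives the lists of centralizers.

   Since rho strictly decreases along the orbits, <f> acts freely and properly
   discontinuously. Continuous maps from C^2 minus 0 to the Hopf surface lift to W: they lift
   on each of two star-shaped open sets, the complements of two opposite rays, and the lifts
   agree on the connected intersection after a deck transformation. Hence an automorphism of
   the surface lifts to an automorphism g of W with g f g^-1 = f or f^-1. In the second case
   g would tend to 0 at infinity, against Liouville's theorem. If the automorphism commutes
   with the Real structure induced by s, then g s = n s g for some n in <f>; as s^2 = 1
   and n commutes with g and s, n^2 = 1, hence n = 1. *)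

Set Implicit Arguments.
Unset Strict Implicit.
Unset Printing Implicit Defensive.

Import Order.TTheory GRing.Theory Num.Theory numFieldNormedType.Exports.
Import ComplexField.Normc.

Local Open Scope complex_scope.
Local Open Scope classical_set_scope.
Local Open Scope ring_scope.

Local Arguments normc : simpl never.

(** * Complex analysis in one variable *)

Section ComplexNorm.
Variable R : realType.
Local Notation C := R[i].
Implicit Types (z : C) (x y : R).

(** The map g lives off the origin only. The lines z = a and w = b with a, b nonzero avoid the
    origin, so g need not be extended across it; the price is that polynomiality comes in each
    variable separately. The degree in z is bounded uniformly in w, and Lagrange interpolation in z
    then gives one polynomial in two variables. Growth is polynomial because the number of steps
    into the annulus is logarithmic in rho(p), while each step back costs a factor L.

    For kap = 0 the monomials are eigenvectors of composition with f, so only resonant ones occur in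
    g. For kap nonzero f mixes the powers of z, and only the coefficient of the top power satisfies
    an eigenvalue equation; this bounds the degree in z before anything else is compared.

    That g f g^-1 is f or f^-1 holds because g and its inverse both conjugate f into <f>, which is
    infinite cyclic; n^2 = 1 forces n = 1 because <f> is torsion-free.

    In Liouville's theorem squares replace circles, and 2 pi i is never computed: the integral of 1
    / z takes its place and only has to be nonzero. *)

Lemma normcR z : `|z| = (normc z)%:C. Proof. by []. Qed.

Lemma normc_ge0 z : 0 <= normc z.
Proof. by rewrite -lecR -normcR normr_ge0. Qed.

Lemma normcD z z' : normc (z + z') <= normc z + normc z'.
Proof. exact: le_normcD. Qed.

Lemma normcN z : normc (- z) = normc z.
Proof. exact: normcN. Qed.

Lemma normcB z z' : normc (z - z') <= normc z + normc z'.
Proof. by rewrite -(normcN z'); exact: normcD. Qed.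

Lemma normc_distrC z z' : normc (z - z') = normc (z' - z).
Proof. by rewrite -normcN opprB. Qed.

Lemma normc_lerB z z' : normc z - normc z' <= normc (z - z').
Proof. by rewrite lerBlDr -{1}(subrK z' z); exact: normcD. Qed.

Lemma normcX z n : normc (z ^+ n) = normc z ^+ n.
Proof. by elim: n => [|n IH]; rewrite ?normc1// !exprS normcM IH. Qed.

Lemma normc_eq0 z : (normc z == 0) = (z == 0).
Proof. by rewrite -(inj_eq (@complexI R)) -normcR normr_eq0. Qed.

Lemma normc_gt0 z : (0 < normc z) = (z != 0).
Proof. by rewrite lt0r normc_ge0 andbT normc_eq0. Qed.

Lemma normc_real x : normc x%:C = `|x|.
Proof. by rewrite /normc/real_complex_def expr0n addr0 sqrtr_sqr. Qed.

Lemma normc_i : normc ('i%C : C) = 1.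
Proof. by rewrite /normc expr0n add0r expr1n sqrtr1. Qed.

Lemma normc_geRe z : `|complex.Re z| <= normc z.
Proof. by rewrite -lecR -normcR; exact: normc_ge_Re. Qed.

Lemma normc_geIm z : `|complex.Im z| <= normc z.
Proof. by rewrite -[normc z]mul1r -normc_i -normcM mulrC -normrN -ReiNIm normc_geRe. Qed.

Lemma normc_leD x y : normc (x +i* y) <= `|x| + `|y|.
Proof.
have -> : x +i* y = x%:C + 'i%C * y%:C by rewrite [LHS]complexE.
by apply: le_trans (normcD _ _) _; rewrite normcM normc_i mul1r !normc_real.
Qed.

End ComplexNorm.

Section ComplexContinuity.
Variable R : realType.
Local Notation C := R[i].
Local Notation Co := (R[i]^o : normedModType R[i]).

(** The norm of [R[i]^o] has complex values. A positive complex radius is real, so neighbourhoods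
    can be described by real radii, in which all later estimates are made. *)
Lemma near_normcP (z : Co) (P : Co -> Prop) :
  (\forall t \near z, P t) <-> exists2 d : R, 0 < d & forall t, normc (t - z) < d -> P t.
Proof.
split.
  move=> /nbhs_ballP[e /= e0 eP].
  have eE : e = (complex.Re e)%:C by rewrite RRe_real // gtr0_real.
  exists (complex.Re e); first by rewrite -ltcR -eE.
  move=> t ht; apply: eP; rewrite -ball_normE /ball_/= normcR eE ltcR.
  by rewrite normc_distrC.
move=> [d d0 dP]; apply/nbhs_ballP; exists d%:C; first by rewrite /= ltcR.
move=> t; rewrite -ball_normE /ball_/= normcR ltcR normc_distrC; exact: dP.
Qed.

Lemma continuous_normcP (T : topologicalType) (f : T -> Co) (t : T) :
  {for t, continuous f} <->
  forall e : R, 0 < e -> \forall s \near t, normc (f s - f t) < e.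
Proof.
split=> [cf e e0|cf].
  have /cf : nbhs (f t : Co) [set z | normc (z - f t) < e].
    by apply/near_normcP; exists e.
  by [].
move=> A /= /near_normcP[d d0 dA]; have := cf d d0.
by apply: filterS => s; exact: dA.
Qed.

Lemma continuous_normrP (T : topologicalType) (f : T -> R) (t : T) :
  {for t, continuous f} <->
  forall e : R, 0 < e -> \forall s \near t, `|f s - f t| < e.
Proof.
by split=> [/cvgrPdistC_lt //|cf]; apply/cvgrPdistC_lt.
Qed.

Lemma Re_continuous : continuous (@complex.Re R : Co -> R).
Proof.
move=> z; apply/continuous_normrP => e e0; apply/near_normcP; exists e => // t.
by apply: le_lt_trans; rewrite -raddfB; exact: normc_geRe.
Qed.

Lemma Im_continuous : continuous (@complex.Im R : Co -> R).
Proof.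
move=> z; apply/continuous_normrP => e e0; apply/near_normcP; exists e => // t.
by apply: le_lt_trans; rewrite -raddfB; exact: normc_geIm.
Qed.

Lemma hline_continuous (y : R) : continuous (fun x => x +i* y : Co).
Proof.
move=> x; apply/continuous_normcP => e e0.
near=> s.
have -> : (s +i* y : C) - x +i* y = (s - x)%:C 
  by apply/eqP; rewrite eq_complex /= subrr !eqxx.
rewrite normc_real; near: s.
by apply/nbhs_normP; exists e => //= t; rewrite /ball_/= distrC.
Unshelve. all: by end_near. Qed.

Lemma vline_continuous (x : R) : continuous (fun y => x +i* y : Co).
Proof.
move=> y; apply/continuous_normcP => e e0.
near=> s.
have -> : (x +i* s : C) - x +i* y = 0 +i* (s - y) 
  by apply/eqP; rewrite eq_complex /= subrr !eqxx.
apply: le_lt_trans (normc_leD _ _) _; rewrite normr0 add0r; near: s.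
by apply/nbhs_normP; exists e => //= t; rewrite /ball_/= distrC.
Unshelve. all: by end_near. Qed.

Lemma normc_continuous : continuous (@normc R : Co -> R).
Proof.
move=> z; apply/continuous_normrP => e e0; apply/near_normcP; exists e => // t.
apply: le_lt_trans; rewrite ler_norml normc_lerB andbT lerNl opprB.
by rewrite normc_distrC normc_lerB.
Qed.

Definition cdiff (f : C -> C) z := differentiable (f : Co -> Co) z.

Lemma cdiff_continuous f z : cdiff f z -> {for z, continuous (f : Co -> Co)}.
Proof. by move=> /differentiable_continuous. Qed.

(** A linear map of C over C is multiplication by its value at 1, which is taken as the
    derivative. *)
Lemma cdiff_eps f z : cdiff f z -> exists D : C, forall e : R, 0 < e ->
  exists2 d : R, 0 < d & forall t, normc (t - z) < d ->
    normc (f t - (f z + D * (t - z))) <= e * normc (t - z).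
Proof.
move=> df; exists ('d (f : Co -> Co) z (1 : Co)) => e e0.
have [_] := (diff_locallyxP (z : Co) (f : Co -> Co)).1 df.
set o := 'o_ _ _ => dfE.
have o_small : \forall h \near (0 : Co), `|o h| <= e%:C * `|h|.
  by have := littleoP o; apply; rewrite ltcR.
move/near_normcP : o_small => [d d0 od]; exists d => // t tz.
have -> : f t - (f z + 'd (f : Co -> Co) z (1 : Co) * (t - z)) = o (t - z).
  have := dfE (t - z); rewrite subrK => ->.
  have -> : 'd (f : Co -> Co) z (t - z) = 'd (f : Co -> Co) z (1 : Co) * (t - z).
    have -> : t - z = (t - z) *: (1 : Co) by rewrite /GRing.scale/= mulr1.
    by rewrite linearZ /= /GRing.scale/= mulr1 mulrC.
  by rewrite [_ + o _]addrC addrK.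
by have := od (t - z); rewrite subr0 => /(_ tz); rewrite !normcR -rmorphM lecR.
Qed.

End ComplexContinuity.

(** * Integrals of complex functions over real intervals *)

Section ComplexIntegral.
Variable R : realType.
Local Notation C := R[i].
Local Notation Co := (R[i]^o : normedModType R[i]).
Local Notation mu := (@lebesgue_measure R).
Implicit Types (phi psi : R -> C) (a b : R).

Definition contc phi a b := forall t, a <= t <= b -> {for t, continuous (phi : R -> Co)}.

Definition cint phi a b : C :=
  (\int[mu]_(t in `[a, b]) complex.Re (phi t)) +i*
  (\int[mu]_(t in `[a, b]) complex.Im (phi t)).

Lemma continuous_itv_integrable (f : R -> R) a b :
  (forall t, a <= t <= b -> {for t, continuous f}) ->
  mu.-integrable `[a, b] (EFin \o f).
Proof.
move=> cf; apply: continuous_compact_integrable; first exact: segment_compact.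
apply: continuous_in_subspaceT => t; rewrite inE/= in_itv/=; exact: cf.
Qed.

Lemma contc_Re phi a b : contc phi a b -> forall t, a <= t <= b ->
  {for t, continuous (fun s => complex.Re (phi s))}.
Proof.
by move=> cphi t /cphi ct; apply: continuous_comp ct _; exact: Re_continuous.
Qed.

Lemma contc_Im phi a b : contc phi a b -> forall t, a <= t <= b ->
  {for t, continuous (fun s => complex.Im (phi s))}.
Proof.
by move=> cphi t /cphi ct; apply: continuous_comp ct _; exact: Im_continuous.
Qed.

Lemma contcZ k phi a b : contc phi a b -> contc (fun t => k * phi t) a b.
Proof.
by move=> cphi t tab; apply: (@continuousM C R (cst k)); [exact: cst_continuous|exact: cphi].
Qed.

Lemma contcB phi psi a b : contc phi a b -> contc psi a b ->
  contc (fun t => phi t - psi t) a b.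
Proof.
by move=> cphi cpsi t tab; apply: continuousB; [exact: cphi|exact: cpsi].
Qed.

Lemma eq_cint phi psi a b : (forall t, a <= t <= b -> phi t = psi t) ->
  cint phi a b = cint psi a b.
Proof.
move=> e; congr (_ +i* _); apply: eq_Rintegral => t;
  by rewrite inE/= in_itv/= => /e ->.
Qed.

Lemma cintD phi psi a b : contc phi a b -> contc psi a b ->
  cint (fun t => phi t + psi t) a b = cint phi a b + cint psi a b.
Proof.
move=> cphi cpsi; rewrite /cint; simpc.
have rT := continuous_itv_integrable (contc_Re cphi).
have iT := continuous_itv_integrable (contc_Im cphi).
have rT' := continuous_itv_integrable (contc_Re cpsi).
have iT' := continuous_itv_integrable (contc_Im cpsi).
rewrite -RintegralD//= -?RintegralD//=.
by congr (_ +i* _); apply: eq_Rintegral => t _; rewrite raddfD.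
Qed.

Lemma cintZ k phi a b : contc phi a b ->
  cint (fun t => k * phi t) a b = k * cint phi a b.
Proof.
move=> cphi; rewrite /cint.
have rT := continuous_itv_integrable (contc_Re cphi).
have iT := continuous_itv_integrable (contc_Im cphi).
have cst_cont (c : R) : forall t, a <= t <= b -> {for t, continuous (cst c : R -> R)}.
  by move=> *; exact: cst_continuous.
have ZT (c : R) (f : R -> R) : (forall t, a <= t <= b -> {for t, continuous f}) ->
    mu.-integrable `[a, b] (EFin \o (fun t => c * f t)).
  move=> cf; apply: continuous_itv_integrable => t tab.
  by apply: (@continuousM R R (cst c)); [exact: cst_continuous|exact: cf].
case: k => k1 k2; simpc.
rewrite -!RintegralZl//= -RintegralB//=; [|apply: ZT; exact: contc_Re cphi|
  apply: ZT; exact: contc_Im cphi].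
rewrite -RintegralD//=; [|apply: ZT; exact: contc_Im cphi|
  apply: ZT; exact: contc_Re cphi].
by congr (_ +i* _); apply: eq_Rintegral => t _; case: (phi t).
Qed.

Lemma cintB phi psi a b : contc phi a b -> contc psi a b ->
  cint (fun t => phi t - psi t) a b = cint phi a b - cint psi a b.
Proof.
move=> cphi cpsi; rewrite -mulN1r -(cintZ (-1) cpsi).
rewrite -(cintD cphi (contcZ (k := -1) cpsi)).
by apply: eq_cint => t _; rewrite mulN1r.
Qed.

Lemma cint_cst k a b : a <= b -> cint (fun=> k) a b = k * (b - a)%:C.
Proof.
move=> ab; rewrite /cint !Rintegral_cst//= lebesgue_measure_itv/= lte_fin.
by case: k => k1 k2; case: ltgtP ab => // [_|->] _; rewrite /= ?subrr; simpc.
Qed.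

Lemma cint_split phi a b c : a <= b -> b <= c -> contc phi a c ->
  cint phi a c = cint phi a b + cint phi b c.
Proof.
move=> ab bc cphi; rewrite /cint; simpc.
have split_real (f : R -> R) : (forall t, a <= t <= c -> {for t, continuous f}) ->
    \int[mu]_(t in `[a, c]) f t =
    \int[mu]_(t in `[a, b]) f t + \int[mu]_(t in `[b, c]) f t.
  move=> cf; have fT := continuous_itv_integrable cf.
  rewrite -[X in _ = _ + X]Rintegral_itv_obnd_cbnd.
    by rewrite -(@Rintegral_itvB _ _ (BLeft a) (BRight c) b) ?bnd_simp// addrC subrK.
  apply: (integrableS _ _ _ (fT)) => //=.
  by move=> t /=; rewrite !in_itv/= => /andP[bt ->]; rewrite (le_trans ab (ltW bt)).
congr (_ +i* _); apply: split_real; [exact: contc_Re cphi|exact: contc_Im cphi].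
Qed.

Lemma normc_cint_le phi a b M : a <= b -> contc phi a b ->
  (forall t, a <= t <= b -> normc (phi t) <= M) ->
  normc (cint phi a b) <= 2 * M * (b - a).
Proof.
move=> ab cphi phiM.
have M_int : mu.-integrable `[a, b] (EFin \o (cst M : R -> R)).
  by apply: continuous_itv_integrable => *; exact: cst_continuous.
have bnd (f : R -> R) : (forall t, a <= t <= b -> {for t, continuous f}) ->
    (forall t, a <= t <= b -> `|f t| <= M) ->
    `|\int[mu]_(t in `[a, b]) f t| <= M * (b - a).
  move=> cf fM; have fT := continuous_itv_integrable cf.
  apply: le_trans (le_normr_Rintegral _ fT) _ => //.
  have -> : M * (b - a) = \int[mu]_(t in `[a, b]) (cst M t).
    rewrite Rintegral_cst//= lebesgue_measure_itv/= lte_fin.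
    by case: ltP => // ba; rewrite (@le_anti _ _ a b) ?ab ?ba ?subrr.
  apply: le_Rintegral => //=.
    apply: continuous_itv_integrable => t /cf ct.
    by apply: continuous_comp ct _; exact: norm_continuous.

apply: le_trans (normc_leD _ _) _; rewrite -mulrA mulr_natl mulr2n.
apply: lerD; apply: bnd.
- exact: contc_Re cphi.
- by move=> t /phiM; apply: le_trans; exact: normc_geRe.
- exact: contc_Im cphi.
- by move=> t /phiM; apply: le_trans; exact: normc_geIm.
Qed.

End ComplexIntegral.

(** * Cauchy's theorem for rectangles *)

Section Goursat.
Variable R : realType.
Local Notation C := R[i].
Local Notation Co := (R[i]^o : normedModType R[i]).
Implicit Types (h k : C -> C) (x y : R).

(** The integral of h(z) dz counterclockwise along the boundary, with opposite sides paired under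
    one integral sign. *)
Definition rect h x0 x1 y0 y1 : C :=
  cint (fun x => h (x +i* y0) - h (x +i* y1)) x0 x1 +
  'i%C * cint (fun y => h (x1 +i* y) - h (x0 +i* y)) y0 y1.

Definition inrect x0 x1 y0 y1 (z : C) :=
  x0 <= complex.Re z <= x1 /\ y0 <= complex.Im z <= y1.

Definition onrect x0 x1 y0 y1 (z : C) := inrect x0 x1 y0 y1 z /\
  (complex.Re z \in [:: x0; x1] \/ complex.Im z \in [:: y0; y1]).

(** Continuity is asked at boundary points only, since the kernels to be integrated have a pole
    inside. *)
Definition rcont h x0 x1 y0 y1 := forall z, onrect x0 x1 y0 y1 z ->
  {for z, continuous (h : Co -> Co)}.

Local Arguments rect : simpl never.

Section Fixed.
Variables (x0 x1 y0 y1 : R).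
Hypotheses (x01 : x0 <= x1) (y01 : y0 <= y1).
Local Notation rectb h := (rect h x0 x1 y0 y1).
Local Notation rcontb h := (rcont h x0 x1 y0 y1).

Lemma rcont_h h y : rcontb h -> y \in [:: y0; y1] -> contc (fun x => h (x +i* y)) x0 x1.
Proof.
move=> ch yy t tx; apply: (continuous_comp (@hline_continuous R y t)).
apply: ch; split; last by right.
split => //=; move: yy; rewrite !inE => /orP[] /eqP ->; by rewrite lexx ?y01.
Qed.

Lemma rcont_v h x : rcontb h -> x \in [:: x0; x1] -> contc (fun y => h (x +i* y)) y0 y1.
Proof.
move=> ch xx t ty; apply: (continuous_comp (@vline_continuous R x t)).
apply: ch; split; last by left.
split => //=; move: xx; rewrite !inE => /orP[] /eqP ->; by rewrite lexx ?x01.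
Qed.

Lemma rcontD h k : rcontb h -> rcontb k -> rcontb (fun z => h z + k z).
Proof. by move=> ch ck z zr; apply: continuousD; [exact: ch|exact: ck]. Qed.

Lemma rcontZ c h : rcontb h -> rcontb (fun z => c * h z).
Proof.
by move=> ch z zr; apply: (@continuousM C Co (cst c)); [exact: cst_continuous|exact: ch].
Qed.

Lemma rectD h k : rcontb h -> rcontb k ->
  rectb (fun z => h z + k z) = rectb h + rectb k.
Proof.
move=> ch ck; rewrite /rect addrACA -mulrDr -!cintD.
- congr (_ + 'i%C * _); apply: eq_cint => t _; by rewrite opprD addrACA.
- by apply: contcB; apply: rcont_v; rewrite // !inE eqxx ?orbT.
- by apply: contcB; apply: rcont_v; rewrite // !inE eqxx ?orbT.
- by apply: contcB; apply: rcont_h; rewrite // !inE eqxx ?orbT.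
- by apply: contcB; apply: rcont_h; rewrite // !inE eqxx ?orbT.
Qed.

Lemma rectZ c h : rcontb h -> rectb (fun z => c * h z) = c * rectb h.
Proof.
move=> ch; have cH : contc (fun x => h (x +i* y0) - h (x +i* y1)) x0 x1.
  by apply: contcB; apply: rcont_h; rewrite // !inE eqxx ?orbT.
have cV : contc (fun y => h (x1 +i* y) - h (x0 +i* y)) y0 y1.
  by apply: contcB; apply: rcont_v; rewrite // !inE eqxx ?orbT.
rewrite /rect mulrDr mulrCA -(cintZ c cH) -(cintZ c cV).
by congr (_ + 'i%C * _); apply: eq_cint => t _; rewrite mulrBr.
Qed.

Lemma eq_rect h k : (forall z, onrect x0 x1 y0 y1 z -> h z = k z) -> rectb h = rectb k.
Proof.
move=> hk; rewrite /rect; congr (_ + 'i%C * _); apply: eq_cint => t tI;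
  congr (_ - _); apply: hk; rewrite /onrect /inrect /= ?tI ?lexx ?x01 ?y01 !inE ?eqxx ?orbT;
  by split => //; auto.
Qed.

(** The difference of the values on opposite sides is constant, and the two resulting products
    cancel. Goursat's argument may therefore subtract the affine part of a function freely. *)
Lemma rect_affine a b : rectb (fun z => a + b * z) = 0.
Proof.
rewrite /rect.
rewrite (@eq_cint _ _ (fun=> b * ('i%C * (y0 - y1)%:C))); last first.
  move=> t _; rewrite opprD addrACA subrr add0r -mulrBr; congr (_ * _).
  by apply/eqP; rewrite eq_complex /=; apply/andP; split; apply/eqP; ring.
rewrite (@eq_cint _ _ (fun=> b * (x1 - x0)%:C) y0); last first.
  move=> t _; rewrite opprD addrACA subrr add0r -mulrBr; congr (_ * _).
  by apply/eqP; rewrite eq_complex /=; apply/andP; split; apply/eqP; ring.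
rewrite !cint_cst// -(opprB y1 y0) rmorphN; ring.
Qed.

(** The 4 is the 2 of [normc_cint_le] times the two sides in each integrand. *)
Lemma normc_rect_le h M : rcontb h ->
  (forall z, onrect x0 x1 y0 y1 z -> normc (h z) <= M) ->
  normc (rectb h) <= 4 * M * ((x1 - x0) + (y1 - y0)).
Proof.
move=> ch hM; apply: le_trans (normcD _ _) _; rewrite normcM normc_i mul1r.
have E : 2 * (M + M) = 4 * M by ring.
rewrite mulrDr -E; apply: lerD; apply: normc_cint_le => //.
- by apply: contcB; apply: rcont_h; rewrite // !inE eqxx ?orbT.
- move=> t tI; apply: le_trans (normcB _ _) _; apply: lerD; apply: hM;
  by rewrite /onrect /inrect /= tI !lexx y01 !inE !eqxx ?orbT; split; auto.
- by apply: contcB; apply: rcont_v; rewrite // !inE eqxx ?orbT.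
- move=> t tI; apply: le_trans (normcB _ _) _; apply: lerD; apply: hM;
  by rewrite /onrect /inrect /= tI !lexx x01 !inE !eqxx ?orbT; split; auto.
Qed.

End Fixed.

Lemma rect_hsplit h x0 x1 x2 y0 y1 : x0 <= x1 -> x1 <= x2 -> y0 <= y1 ->
  rcont h x0 x1 y0 y1 -> rcont h x1 x2 y0 y1 ->
  rect h x0 x2 y0 y1 = rect h x0 x1 y0 y1 + rect h x1 x2 y0 y1.
Proof.
move=> x01 x12 y01 c1 c2.
have i1 (a b : R) : a \in [:: a; b] by rewrite inE eqxx.
have i2 (a b : R) : b \in [:: a; b] by rewrite !inE eqxx orbT.
rewrite /rect (cint_split x01 x12); last first.
  move=> t /andP[t0 t2]; have [tx1|tx1] := leP t x1.
    by apply: (contcB (rcont_h y01 c1 (i1 _ _)) (rcont_h y01 c1 (i2 _ _))); rewrite t0.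
  by apply: (contcB (rcont_h y01 c2 (i1 _ _)) (rcont_h y01 c2 (i2 _ _)));
    rewrite (ltW tx1).
rewrite [RHS]addrACA -mulrDr; congr (_ + 'i%C * _).
have c10 := rcont_v x01 c1 (i1 _ _); have c11 := rcont_v x01 c1 (i2 _ _).
have c22 := rcont_v x12 c2 (i2 _ _).
rewrite !cintB//; ring.
Qed.

Lemma rect_vsplit h x0 x1 y0 y1 y2 : x0 <= x1 -> y0 <= y1 -> y1 <= y2 ->
  rcont h x0 x1 y0 y1 -> rcont h x0 x1 y1 y2 ->
  rect h x0 x1 y0 y2 = rect h x0 x1 y0 y1 + rect h x0 x1 y1 y2.
Proof.
move=> x01 y01 y12 c1 c2.
have i1 (a b : R) : a \in [:: a; b] by rewrite inE eqxx.
have i2 (a b : R) : b \in [:: a; b] by rewrite !inE eqxx orbT.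
rewrite /rect (cint_split y01 y12); last first.
  move=> t /andP[t0 t2]; have [tx1|tx1] := leP t y1.
    by apply: (contcB (rcont_v x01 c1 (i2 _ _)) (rcont_v x01 c1 (i1 _ _))); rewrite t0.
  by apply: (contcB (rcont_v x01 c2 (i2 _ _)) (rcont_v x01 c2 (i1 _ _)));
    rewrite (ltW tx1).
rewrite [RHS]addrACA -mulrDr; congr (_ + 'i%C * _).
have c10 := rcont_h y01 c1 (i1 _ _); have c11 := rcont_h y01 c1 (i2 _ _).
have c22 := rcont_h y12 c2 (i2 _ _).
rewrite !cintB//; ring.
Qed.

Lemma rcont_cdiff h x0 x1 y0 y1 : (forall z, inrect x0 x1 y0 y1 z -> cdiff h z) ->
  rcont h x0 x1 y0 y1.
Proof. by move=> dh z [zr _]; apply: cdiff_continuous; exact: dh. Qed.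

Lemma rect_quarter h x0 x1 x2 y0 y1 y2 :
  x0 <= x1 -> x1 <= x2 -> y0 <= y1 -> y1 <= y2 ->
  (forall z, inrect x0 x2 y0 y2 z -> cdiff h z) ->
  rect h x0 x2 y0 y2 = (rect h x0 x1 y0 y1 + rect h x0 x1 y1 y2) +
                       (rect h x1 x2 y0 y1 + rect h x1 x2 y1 y2).
Proof.
move=> x01 x12 y01 y12 dh.
have sub (a b c d : R) : x0 <= a -> b <= x2 -> y0 <= c -> d <= y2 -> rcont h a b c d.
  move=> *; apply: rcont_cdiff => z [/andP[za zb] /andP[zc zd]]; apply: dh.
  split; apply/andP; split.
  - exact: le_trans za.
  - exact: le_trans zb _.
  - exact: le_trans zc.
  - exact: le_trans zd _.
rewrite (@rect_hsplit _ x0 x1)//; last 3 first.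
- exact: le_trans y12.
- exact: sub.
- exact: sub.
by congr (_ + _); apply: rect_vsplit => //; apply: sub; rewrite ?lexx.
Qed.

(** Subtracting the first-order expansion at [p] leaves the integral unchanged and an integrand of
    size at most e / 4 * (u + v) on the boundary; the quarter absorbs the factor of
    [normc_rect_le]. *)
Lemma rect_small h p : cdiff h p -> forall e, 0 < e -> exists2 d : R, 0 < d &
  forall a b u v, 0 <= u -> 0 <= v -> u + v < d ->
  inrect a (a + u) b (b + v) p -> rcont h a (a + u) b (b + v) ->
  normc (rect h a (a + u) b (b + v)) <= e * (u + v) ^+ 2.
Proof.
move=> /cdiff_eps[D hD] e e0.
have [d d0 {}hD] := hD (e / 4) (divr_gt0 e0 (ltr0Sn _ 3)).
exists d => // a b u v u0 v0 uvd [/andP[pa pa'] /andP[pb pb']] ch.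
have au : a <= a + u by rewrite lerDl.
have bv : b <= b + v by rewrite lerDl.
pose k z := (h p - D * p) + D * z.
have ck : rcont k a (a + u) b (b + v).
  move=> z _; apply: continuousD; first exact: cst_continuous.
  by apply: (@continuousM C Co (cst D)); [exact: cst_continuous|move=> ?].
have cNk : rcont (fun z => -1 * k z) a (a + u) b (b + v) by exact: rcontZ.
have -> : rect h a (a + u) b (b + v) =
    rect (fun z => h z + -1 * k z) a (a + u) b (b + v).
  by rewrite rectD// rectZ// /k rect_affine// mulr0 addr0.
have -> : e * (u + v) ^+ 2 = 4 * (e / 4 * (u + v)) * ((a + u - a) + (b + v - b)).
  by field.
apply: (normc_rect_le au bv (rcontD ch cNk)).
move=> z [[/andP[za za'] /andP[zb zb']] _].
have zp : normc (z - p) <= u + v.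
  case: z p za za' zb zb' pa pa' pb pb' {hD k ck cNk} => z1 z2 [p1 p2] /= *.
  apply: le_trans (normc_leD (z1 - p1) (z2 - p2)) _.
  by apply: lerD; rewrite ler_norml; lra.
have -> : h z + -1 * k z = h z - (h p + D * (z - p)) by rewrite /k; ring.
apply: le_trans (hD _ _) _; first exact: le_lt_trans uvd.
by rewrite ler_wpM2l// divr_ge0// ltW.
Qed.

Lemma half_pow_small (s d : R) : 0 < d -> exists n, s / 2 ^+ n < d.
Proof.
move=> d0; have [n hn] : exists n, s / d < n%:R.
  exists (Num.bound `|s / d|); apply: le_lt_trans (ler_norm _) _.
  by apply: archi_boundP; exact: normr_ge0.
exists n; rewrite ltr_pdivrMr ?exprn_gt0//.
rewrite -ltr_pdivrMl// mulrC; apply: lt_trans hn _.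
by rewrite -natrX ltr_nat ltn_expl.
Qed.

(** Pigeonhole: four quarters all below e (u + v)^2 would sum to less than e (2 u + 2 v)^2. Sides
    are written as [u + u] so that the quarters fit without division. *)
Lemma rect_bisect h a b u v e : 0 <= u -> 0 <= v ->
  (forall z, inrect a (a + (u + u)) b (b + (v + v)) z -> cdiff h z) ->
  e * ((u + u) + (v + v)) ^+ 2 <= normc (rect h a (a + (u + u)) b (b + (v + v))) ->
  exists c : R * R, [/\ a <= c.1, c.1 + u <= a + (u + u), b <= c.2,
    c.2 + v <= b + (v + v) &
    e * (u + v) ^+ 2 <= normc (rect h c.1 (c.1 + u) c.2 (c.2 + v))].
Proof.
move=> u0 v0 dh Ie; apply: contrapT => /forallNP none.
have au : a <= a + u by rewrite lerDl.
have bv : b <= b + v by rewrite lerDl.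
have small (a' b' : R) : a' \in [:: a; a + u] -> b' \in [:: b; b + v] ->
    normc (rect h a' (a' + u) b' (b' + v)) < e * (u + v) ^+ 2.
  move=> a'a b'b; rewrite ltNge; apply/negP => ge; apply: (none (a', b')).
  have [la la'] : a <= a' /\ a' + u <= a + (u + u).
    by move: a'a; rewrite !inE addrA lerD2r => /orP[] /eqP ->; rewrite ?lexx.
  have [lb lb'] : b <= b' /\ b' + v <= b + (v + v).
    by move: b'b; rewrite !inE addrA lerD2r => /orP[] /eqP ->; rewrite ?lexx.
  by [].
have i1 (p q : R) : p \in [:: p; q] by rewrite inE eqxx.
have i2 (p q : R) : q \in [:: p; q] by rewrite !inE eqxx orbT.
have s11 := small _ _ (i1 _ _) (i1 _ _); have s12 := small _ _ (i1 _ _) (i2 _ _).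
have s21 := small _ _ (i2 _ _) (i1 _ _); have s22 := small _ _ (i2 _ _) (i2 _ _).
move: Ie; rewrite leNgt => /negP; apply.
rewrite !addrA in dh *.
rewrite (@rect_quarter h a (a + u) (a + u + u) b (b + v) (b + v + v)) ?lerDl//.
apply: le_lt_trans (normcD _ _) _.
apply: le_lt_trans (lerD (normcD _ _) (normcD _ _)) _.
have -> : e * (u + u + v + v) ^+ 2 =
  (e * (u + v) ^+ 2 + e * (u + v) ^+ 2) + (e * (u + v) ^+ 2 + e * (u + v) ^+ 2) by ring.
by rewrite !ltrD.
Qed.

Lemma nested_itv_point (f w : nat -> R) : (forall n, 0 <= w n) ->
  (forall n, f n <= f n.+1 /\ f n.+1 + w n.+1 <= f n + w n) ->
  exists p, forall n, f n <= p <= f n + w n.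
Proof.
move=> w0 fS.
have mono m n : (m <= n)%N -> f m <= f n.
  elim: n => [|n IH]; first by rewrite leqn0 => /eqP ->.
  by rewrite leq_eqVlt => /orP[/eqP ->//|/IH/le_trans]; apply; case: (fS n).
have anti m n : (m <= n)%N -> f n + w n <= f m + w m.
  elim: n => [|n IH]; first by rewrite leqn0 => /eqP ->.
  by rewrite leq_eqVlt => /orP[/eqP ->//|/IH]; apply: le_trans; case: (fS n).
have ub n : ubound (range f) (f n + w n).
  move=> _ [m _ <-]; have [/mono fmn|/ltnW nm] := leqP m n.
    by apply: le_trans fmn _; rewrite lerDl.
  by apply: le_trans (anti _ _ nm); rewrite lerDl.
have hs : has_sup (range f) by split; [exists (f 0%N), 0%N|exists (f 0%N + w 0%N)].
exists (sup (range f)) => n; apply/andP; split.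
  by apply: sup_upper_bound => //; exists n.
by apply: ge_sup; [exists (f 0%N), 0%N|exact: ub].
Qed.

Lemma goursat h x0 x1 y0 y1 : x0 <= x1 -> y0 <= y1 ->
  (forall z, inrect x0 x1 y0 y1 z -> cdiff h z) -> rect h x0 x1 y0 y1 = 0.
Proof.
move=> x01 y01 dh; apply/eqP; rewrite -normc_eq0 -[_ == 0]negbK.
apply/negP => I0.
have half_lt (t : R) : 0 < t -> ~~ (t <= t / 2) by move=> t0; rewrite -ltNge; lra.
pose u n : R := (x1 - x0) / 2 ^+ n; pose v n : R := (y1 - y0) / 2 ^+ n.
have u0 n : 0 <= u n by rewrite divr_ge0 ?subr_ge0// exprn_ge0.
have v0 n : 0 <= v n by rewrite divr_ge0 ?subr_ge0// exprn_ge0.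
have uS n : u n = u n.+1 + u n.+1 by rewrite /u exprS; field; rewrite expf_neq0.
have vS n : v n = v n.+1 + v n.+1 by rewrite /v exprS; field; rewrite expf_neq0.
pose I n (c : R * R) := rect h c.1 (c.1 + u n) c.2 (c.2 + v n).
pose s := (x1 - x0) + (y1 - y0).
(* If both sides had length 0, the boundary would be a single point and the trivial estimate would
   already make the integral vanish. *)
have s0 : 0 < s.
  rewrite lt_neqAle addr_ge0 ?subr_ge0// andbT eq_sym.
  apply: contra I0 => /eqP s0.
  rewrite eq_le normc_ge0 andbT -(mulr0 (4 * normc (h (x0 +i* y0)))) -s0.
  apply: normc_rect_le => //; first exact: rcont_cdiff.
  have [/eqP xx /eqP yy] : x1 - x0 == 0 /\ y1 - y0 == 0.
    by move/eqP: s0; rewrite paddr_eq0 ?subr_ge0// => /andP[].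
  move=> z [[zx zy] _]; suff -> : z = x0 +i* y0 by [].
  by case: z zx zy => /= a b; move=> /andP[? ?] /andP[? ?]; congr (_ +i* _); lra.
(* Scaled so that the whole rectangle satisfies the invariant [ok] with equality. *)
pose e := normc (rect h x0 x1 y0 y1) / s ^+ 2.
have e0 : 0 < e by rewrite divr_gt0 ?exprn_gt0// lt0r I0 normc_ge0.
pose ok n c := [/\ e * (u n + v n) ^+ 2 <= normc (I n c),
  x0 <= c.1, c.1 + u n <= x1, y0 <= c.2 & c.2 + v n <= y1].
have ok0 : ok 0%N (x0, y0).
  rewrite /ok /I /u /v /= expr0 !divr1 !subrKC !lexx; split => //.
  by rewrite /e divfK// expf_neq0// gt_eqF.
have ok_in n c z : ok n c -> inrect c.1 (c.1 + u n) c.2 (c.2 + v n) z -> cdiff h z.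
  move=> [_ ? ? ? ?] [/andP[? ?] /andP[? ?]]; apply: dh.
  by split; apply/andP; split; do ?[exact: le_trans|apply: le_trans; eassumption].
have next n c : ok n c -> exists c', [/\ ok n.+1 c', c.1 <= c'.1,
   c'.1 + u n.+1 <= c.1 + u n, c.2 <= c'.2 & c'.2 + v n.+1 <= c.2 + v n].
  move=> okc; have [Ie xa ax yb yb'] := okc.
  move: Ie; rewrite /I (uS n) (vS n) => /rect_bisect[//|//| |c' [h1 h2 h3 h4 h5]].
    by move=> z; rewrite -uS -vS; exact: ok_in.
  exists c'; split => //; split => //.
  - exact: le_trans h1.
  - by apply: le_trans h2 _; rewrite -(uS n).
  - exact: le_trans h3.
  - by apply: le_trans h4 _; rewrite -(vS n).
(* Dependent choice of nested quarters; the default value of [xget] never occurs, because [next]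
   always provides a quarter. *)
pose c := fix c n : R * R := if n is n.+1 then
    xget (0, 0) [set c' | [/\ ok n.+1 c', (c n).1 <= c'.1,
      c'.1 + u n.+1 <= (c n).1 + u n, (c n).2 <= c'.2 & c'.2 + v n.+1 <= (c n).2 + v n]]
  else (x0, y0).
have okc n : ok n (c n) by elim: n => // n /next/(xgetPex (0, 0))[].
have stepc n : [/\ (c n).1 <= (c n.+1).1, (c n.+1).1 + u n.+1 <= (c n).1 + u n,
   (c n).2 <= (c n.+1).2 & (c n.+1).2 + v n.+1 <= (c n).2 + v n].
  by have /next/(xgetPex (0, 0))[] := okc n.
have [p1 hp1] := @nested_itv_point (fun n => (c n).1) u u0 (fun n => let: And4 a b _ _ := stepc n in conj a b).
have [p2 hp2] := @nested_itv_point (fun n => (c n).2) v v0 (fun n => let: And4 _ _ a b := stepc n in conj a b).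
have inp n : inrect (c n).1 ((c n).1 + u n) (c n).2 ((c n).2 + v n) (p1 +i* p2) by [].
have dp : cdiff h (p1 +i* p2).
  by apply: dh; have := inp 0%N; rewrite /u /v/= expr0 !divr1 !subrKC.
(* At the common point of the quarters, differentiability bounds small integrals with e / 2, while
   [ok] bounds them below with e. *)
have [d d0 hd] := rect_small dp (divr_gt0 e0 (ltr0Sn _ 1)).
have [n hn] := half_pow_small s d0.
have uv : u n + v n = s / 2 ^+ n by rewrite /s mulrDl.
have uv0 : 0 < u n + v n by rewrite uv divr_gt0// exprn_gt0.
have [oI o1 o2 o3 o4] := okc n.
have := hd _ _ _ _ (u0 n) (v0 n) _ (inp n).
rewrite {1}uv => /(_ hn (rcont_cdiff (fun z => @ok_in n (c n) z (okc n)))).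
have ew : 0 < e * (u n + v n) ^+ 2 by rewrite mulr_gt0// exprn_gt0.
move/(le_trans oI); rewrite [X in _ <= X]mulrAC; apply/negP; exact: half_lt.
Qed.

Lemma rcont_punctured h a x0 x1 y0 y1 :
  x0 < complex.Re a < x1 -> y0 < complex.Im a < y1 ->
  (forall z, inrect x0 x1 y0 y1 z -> z != a -> cdiff h z) -> rcont h x0 x1 y0 y1.
Proof.
move=> /andP[xa ax] /andP[ya ay] dh z [zr zb]; apply: cdiff_continuous; apply: dh => //.
apply/negP => /eqP za; move: zb; rewrite za !inE.
by rewrite (gt_eqF xa) (lt_eqF ax) (gt_eqF ya) (lt_eqF ay) /=; case.
Qed.

(** The region between the two rectangles is cut into a left, a right, a lower and an upper
    rectangle. None of them contains [a], so [goursat] makes their integrals vanish. *)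
Lemma rect_shrink h a x0 u0 u1 x1 y0 v0 v1 y1 :
  x0 <= u0 -> u0 < complex.Re a < u1 -> u1 <= x1 ->
  y0 <= v0 -> v0 < complex.Im a < v1 -> v1 <= y1 ->
  (forall z, inrect x0 x1 y0 y1 z -> z != a -> cdiff h z) ->
  rect h x0 x1 y0 y1 = rect h u0 u1 v0 v1.
Proof.
move=> xu /andP[ua au] ux yv /andP[va av] vy dh.
have xa := le_lt_trans xu ua; have ax := lt_le_trans au ux.
have ya := le_lt_trans yv va; have ay := lt_le_trans av vy.
have dsub p q s t : x0 <= p -> q <= x1 -> y0 <= s -> t <= y1 ->
    [|| q < complex.Re a, complex.Re a < p, t < complex.Im a | complex.Im a < s] ->
    forall z, inrect p q s t z -> cdiff h z.
  move=> xp qx ys ty out z [/andP[pz zq] /andP[sz zt]]; apply: dh.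
    split; apply/andP; split; [exact: le_trans pz|exact: le_trans qx|
      exact: le_trans sz|exact: le_trans ty].
  apply/negP => /eqP zE; rewrite zE in pz zq sz zt.
  by move: out; rewrite !ltNge pz zq sz zt.
have cpunct p q s t : x0 <= p -> q <= x1 -> y0 <= s -> t <= y1 ->
    p < complex.Re a < q -> s < complex.Im a < t -> rcont h p q s t.
  move=> xp qx ys ty pa sa; apply: (rcont_punctured pa sa).
  move=> z [/andP[pz zq] /andP[sz zt]]; apply: dh.
  by split; apply/andP; split; [exact: le_trans pz|exact: le_trans qx|
      exact: le_trans sz|exact: le_trans ty].
have uu := ltW (lt_trans ua au); have vv := ltW (lt_trans va av).
have ux0 := le_trans uu ux; have vy0 := le_trans vv vy; have yy := le_trans yv vy0.
have xu1 := le_trans xu uu; have yv1 := le_trans yv vv.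
have s1 : forall z, inrect x0 u0 y0 y1 z -> cdiff h z by apply: dsub; rewrite ?ua.
have s2 : forall z, inrect u1 x1 y0 y1 z -> cdiff h z by apply: dsub; rewrite ?au ?orbT.
have s3 : forall z, inrect u0 u1 y0 v0 z -> cdiff h z by apply: dsub; rewrite ?va ?orbT.
have s4 : forall z, inrect u0 u1 v1 y1 z -> cdiff h z by apply: dsub; rewrite ?av ?orbT.
have c1 := rcont_cdiff s1; have c2 := rcont_cdiff s2.
have c3 := rcont_cdiff s3; have c4 := rcont_cdiff s4.
have k1 : rcont h u0 x1 y0 y1 by apply: cpunct; rewrite ?ua ?ax ?ya ?ay.
have k2 : rcont h u0 u1 y0 y1 by apply: cpunct; rewrite ?ua ?au ?ya ?ay.
have k3 : rcont h u0 u1 v0 y1 by apply: cpunct; rewrite ?ua ?au ?va ?ay.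
have k4 : rcont h u0 u1 v0 v1 by apply: cpunct; rewrite ?ua ?au ?va ?av.
rewrite (rect_hsplit xu ux0 yy c1 k1) (goursat xu yy s1) add0r.
rewrite (rect_hsplit uu ux yy k2 c2) (goursat ux yy s2) addr0.
rewrite (rect_vsplit uu yv vy0 c3 k3) (goursat uu yv s3) add0r.
by rewrite (rect_vsplit uu vv vy k4 c4) (goursat uu vy s4) addr0.
Qed.

(** By [rect_shrink] the integral equals that over a square of half-side t about [a], which is at
    most 16 M t for every small t. *)
Lemma rect_bounded_singularity h a x0 x1 y0 y1 M d : 0 < d ->
  x0 < complex.Re a < x1 -> y0 < complex.Im a < y1 ->
  (forall z, inrect x0 x1 y0 y1 z -> z != a -> cdiff h z) ->
  (forall z, z != a -> normc (z - a) < d -> normc (h z) <= M) ->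
  rect h x0 x1 y0 y1 = 0.
Proof.
move=> d0 /andP[xa ax] /andP[ya ay] dh hM.
have M0 : 0 <= M.
  apply: le_trans (normc_ge0 (h (a + (d / 2)%:C))) (hM _ _ _).
    rewrite -subr_eq0 addrC addKr -normc_eq0 normc_real normr_eq0 gt_eqF//.
    by rewrite divr_gt0.
  by rewrite addrC addKr normc_real gtr0_norm ?divr_gt0// ltr_pdivrMr// ltr_pMr// ltr1n.
(* For t up to m the square about [a] stays inside the rectangle, and its boundary is at distance at
   most 2 t <= d / 2 from [a]. *)
pose m := Num.min (Num.min (complex.Re a - x0) (x1 - complex.Re a))
  (Num.min (Num.min (complex.Im a - y0) (y1 - complex.Im a)) (d / 4)).
have m0 : 0 < m by rewrite /m !lt_min !subr_gt0 xa ax ya ay divr_gt0.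
have main t : 0 < t -> t <= m -> normc (rect h x0 x1 y0 y1) <= 16 * M * t.
  move=> t0; rewrite /m !le_min => /andP[/andP[t1 t2] /andP[/andP[t3 t4] t5]].
  have ra : complex.Re a - t < complex.Re a < complex.Re a + t.
    by rewrite ltrBlDr ltrDl t0.
  have ia : complex.Im a - t < complex.Im a < complex.Im a + t.
    by rewrite ltrBlDr ltrDl t0.
  have e1 : x0 <= complex.Re a - t by rewrite lerBrDr -lerBrDl.
  have e2 : complex.Re a + t <= x1 by rewrite -lerBrDl.
  have e3 : y0 <= complex.Im a - t by rewrite lerBrDr -lerBrDl.
  have e4 : complex.Im a + t <= y1 by rewrite -lerBrDl.
  rewrite (rect_shrink e1 ra e2 e3 ia e4 dh).
  have -> : 16 * M * t = 4 * M * ((complex.Re a + t - (complex.Re a - t)) +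
    (complex.Im a + t - (complex.Im a - t))) by ring.
  have /andP[/ltW ra1 /ltW ra2] := ra; have /andP[/ltW ia1 /ltW ia2] := ia.
  have c' : rcont h (complex.Re a - t) (complex.Re a + t) (complex.Im a - t) (complex.Im a + t).
    apply: (rcont_punctured ra ia) => z [/andP[z1 z2] /andP[z3 z4]]; apply: dh.
    by split; apply/andP; split; [exact: le_trans z1|exact: le_trans e2|
      exact: le_trans z3|exact: le_trans e4].
  apply: normc_rect_le => //; [exact: le_trans ra2|exact: le_trans ia2|].
  move=> z [[/andP[z1 z2] /andP[z3 z4]] zb]; apply: hM.
    apply/negP => /eqP za; move: zb ra ia; rewrite za !inE.
    by move=> zb /andP[/gt_eqF r1 /lt_eqF r2] /andP[/gt_eqF i1 /lt_eqF i2];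
      move: zb; rewrite r1 r2 i1 i2; case.
  have -> : z - a = (complex.Re z - complex.Re a) +i* (complex.Im z - complex.Im a).
    by case: (z) (a) => ? ? [? ?].
  apply: le_lt_trans (normc_leD _ _) _.
  have b1 : `|complex.Re z - complex.Re a| <= t by rewrite ler_distl z1 z2.
  have b2 : `|complex.Im z - complex.Im a| <= t by rewrite ler_distl z3 z4.
  apply: le_lt_trans (lerD b1 b2) _; apply: le_lt_trans (lerD t5 t5) _.
  by move: d0; clear; lra.
apply/eqP; rewrite -normc_eq0 eq_le normc_ge0 andbT.
apply/ler_addgt0Pr => e e0; rewrite add0r.
pose t := Num.min m (e / (16 * M + 1)).
have D0 : 0 < 16 * M + 1 by rewrite ltr_wpDl// mulr_ge0.
have t0 : 0 < t by rewrite lt_min m0 divr_gt0.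
apply: le_trans (main t t0 _) _; first by rewrite ge_min lexx.
apply: (@le_trans _ _ ((16 * M + 1) * t)).
  by rewrite [X in _ <= X]mulrDl lerDl mul1r ltW.
by rewrite mulrC -ler_pdivlMr// /t ge_min lexx orbT.
Qed.

End Goursat.

(** * Liouville's theorem for functions of polynomial growth *)

Section Liouville.
Variable R : realType.
Local Notation C := R[i].
Local Notation Co := (R[i]^o : normedModType R[i]).

Definition square (h : C -> C) (r : R) := rect h (- r) r (- r) r.

Lemma square_normc_le (r : R) (z : C) : 0 <= r -> onrect (- r) r (- r) r z ->
  r <= normc z <= r + r.
Proof.
move=> r0 [[zr zi] zb]; apply/andP; split.
  case: zb; rewrite !inE => /orP[] /eqP zE.
  - by apply: le_trans (normc_geRe _); rewrite zE normrN ger0_norm.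
  - by apply: le_trans (normc_geRe _); rewrite zE ger0_norm.
  - by apply: le_trans (normc_geIm _); rewrite zE normrN ger0_norm.
  - by apply: le_trans (normc_geIm _); rewrite zE ger0_norm.
case: z zr zi {zb} => a b /= ar br; apply: le_trans (normc_leD _ _) _.
by apply: lerD; rewrite ler_norml.
Qed.

Lemma cdiff_id (z : C) : cdiff id z.
Proof. by apply/derivable1_diffP; exact: derivable_id. Qed.

Lemma cdiffB_inv (a z : C) : z != a -> cdiff (fun z => (z - a)^-1) z.
Proof.
move=> za; apply: (@differentiableV C Co (fun z : Co => z - a : Co)).
  by apply: differentiableB; [exact: cdiff_id|exact: differentiable_cst].
by rewrite subr_eq0.
Qed.

Lemma cdiffM (f g : C -> C) z : cdiff f z -> cdiff g z -> cdiff (fun z => f z * g z) z.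
Proof. by move=> df dg; apply: (@differentiableM C Co). Qed.

Lemma cdiffX_inv n (z : C) : z != 0 -> cdiff (fun z => (z ^+ n)^-1) z.
Proof.
move=> z0; apply: (@differentiableV C Co (fun z : Co => z ^+ n : Co)).
  by apply/derivable1_diffP; exact: exprn_derivable.
by rewrite expf_neq0.
Qed.

Lemma cdiffM_expV (F : C -> C) n (z : C) : cdiff F z -> z != 0 ->
  cdiff (fun z => F z * (z ^+ n)^-1) z.
Proof. by move=> dF z0; apply: cdiffM dF _; exact: cdiffX_inv. Qed.

(** The two sides differ by the integral of (F z - F a) / (z - a), which is bounded near [a] by
    differentiability. This is Cauchy's formula with the integral of the kernel left unevaluated. *)
Lemma square_entire_quotient (F : C -> C) (a : C) (r : R) :
  (forall z, cdiff F z) -> normc a < r ->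
  square (fun z => F z * (z - a)^-1) r = F a * square (fun z => (z - a)^-1) r.
Proof.
move=> dF ar; have r0 : 0 < r by apply: le_lt_trans ar; exact: normc_ge0.
have ra : - r < complex.Re a < r.
  by rewrite -ltr_norml; apply: le_lt_trans ar; exact: normc_geRe.
have ia : - r < complex.Im a < r.
  by rewrite -ltr_norml; apply: le_lt_trans ar; exact: normc_geIm.
have rr : - r <= r by rewrite ge0_cp // ltW.
have cI : rcont (fun z => (z - a)^-1) (- r) r (- r) r.
  by apply: (rcont_punctured ra ia) => z _ /cdiffB_inv.
have cF : rcont (fun z => F z * (z - a)^-1) (- r) r (- r) r.
  by apply: (rcont_punctured ra ia) => z _ /cdiffB_inv; exact: cdiffM.
pose G z := F z * (z - a)^-1 + - F a * (z - a)^-1.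
have dG z : z != a -> cdiff G z.
  move=> za; apply: differentiableD.
    exact/cdiffM/cdiffB_inv.
  by apply: (@cdiffM (cst (- F a)) (fun z => (z - a)^-1)); [exact: differentiable_cst|exact: cdiffB_inv].
suff : square G r = 0.
  rewrite /square /G (rectD rr rr cF (rcontZ (c := - F a) cI)) (rectZ rr rr _ cI).
  by rewrite mulNr => /eqP; rewrite subr_eq0 => /eqP.
have [D hD] := cdiff_eps (dF a).
have [d d0 {}hD] := hD 1 ltr01.
apply: (rect_bounded_singularity (M := normc D + 1) d0 ra ia).
  by move=> z _; exact: dG.
move=> z za zd.
have z0 : 0 < normc (z - a) by rewrite normc_gt0 subr_eq0.
rewrite -(ler_pM2r z0) -normcM /G mulrDl -!mulrA mulVf ?subr_eq0// !mulr1.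
rewrite -[_ + _](subrK (D * (z - a))) mulrDl mul1r addrC.
apply: le_trans (normcD _ _) _; apply: lerD; first by rewrite normcM.
have -> : F z + - F a - D * (z - a) = F z - (F a + D * (z - a)) by ring.
by have := hD z zd; rewrite mul1r.
Qed.

Lemma square_const (h : C -> C) (r s : R) : 0 < r -> r <= s ->
  (forall z, z != 0 -> cdiff h z) -> square h s = square h r.
Proof.
move=> r0 rs dh; apply: (@rect_shrink _ _ 0) => //=; rewrite ?oppr_lt0 ?lerN2 ?r0//.
by move=> z _; exact: dh.
Qed.

Lemma square_le (h : C -> C) (r M : R) : 0 < r -> rcont h (- r) r (- r) r ->
  (forall z, r <= normc z <= r + r -> normc (h z) <= M) ->
  normc (square h r) <= 16 * M * r.
Proof.
move=> r0 ch hM; have rr : - r <= r by rewrite ge0_cp // ltW.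
have -> : 16 * M * r = 4 * M * ((r - - r) + (r - - r)) by ring.
apply: normc_rect_le => // z zr; apply: hM; apply: square_normc_le zr; exact: ltW.
Qed.

(** The value is 2 pi i, but it suffices that opposite sides combine to i times 2 / (1 + t^2), which
    is at least 1 on [-1, 1] apart from the factor i. *)
Lemma square_inv_neq0 : square (fun z => z^-1) 1 != 0.
Proof.
pose g (t : R) : R := 2 / (1 + t ^+ 2).
have t21 (t : R) : 0 < 1 + t ^+ 2 by rewrite ltr_pwDl// sqr_ge0.
have cg (t : R) : {for t, continuous g}.
  apply: continuousM; first exact: cst_continuous.
  apply: continuousV; first by rewrite gt_eqF.
  apply: continuousD; first exact: cst_continuous.
  exact: exprn_continuous.
pose phi (t : R) : C := 0 +i* g t.
have -> : square (fun z => z^-1) 1 = cint phi (-1) 1 + cint phi (-1) 1.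
  rewrite /square /rect; congr (_ + _).
    apply: eq_cint => t _; rewrite /phi /g.
    apply/eqP; rewrite eq_complex /=; apply/andP; split; apply/eqP; field;
     by rewrite ?sqrrN ?expr1n ?(addrC _ 1) ?gt_eqF.
  have cp : contc (fun t => (g t)%:C) (-1) 1.
    move=> t _; apply/continuous_normcP => e e0.
    have := (continuous_normrP g t).1 (@cg t) e e0.
    by apply: filterS => s; rewrite -rmorphB normc_real.
  have -> : phi = (fun t => 'i%C * (g t)%:C).
    apply/funext => t; apply/eqP; rewrite eq_complex /=.
    by apply/andP; split; apply/eqP; ring.
  rewrite cintZ//; congr (_ * _); apply: eq_cint => t _.
  apply/eqP; rewrite eq_complex /g /=; apply/andP; split; apply/eqP; field;
     by rewrite ?sqrrN ?expr1n ?(addrC _ 1) ?gt_eqF.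
have int_g : 0 < \int[@lebesgue_measure R]_(t in `[-1, 1]) g t.
  apply: (@lt_le_trans _ _ (\int[@lebesgue_measure R]_(t in `[-1, 1]) (cst 1 t))).
    rewrite Rintegral_cst//= lebesgue_measure_itv/= lte_fin.
    have -> : (-1 : R) < 1 by rewrite (@lt_trans _ _ 0) ?ltrN10 ?ltr01.
    by rewrite mul1r /= opprK addr_gt0.
  apply: le_Rintegral => //=.
  - by apply: continuous_itv_integrable => *; exact: cst_continuous.
  - exact: continuous_itv_integrable.
  move=> t; rewrite in_itv/= => /andP[t1 t2].
  rewrite ler_pdivlMr// mul1r -[2]/(1 + 1) lerD2l -real_normK ?num_real//.
  by rewrite expr_le1// ler_norml t1.
by apply/eqP => /(congr1 (@complex.Im R))/eqP; rewrite raddfD /= gt_eqF// addr_gt0.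
Qed.

(** The finite geometric expansion of 1 / (z - a) in powers of a / z, with its exact remainder; on
    the boundary z differs from 0 and from [a]. *)
Lemma square_kernel_expansion (F : C -> C) (a : C) (r : R) n :
  (forall z, cdiff F z) -> normc a < r -> 0 < r ->
  square (fun z => F z * (z - a)^-1) r =
  \sum_(i < n) a ^+ i * square (fun z => F z * (z ^+ i.+1)^-1) r +
  a ^+ n * square (fun z => F z * (z ^+ n)^-1 * (z - a)^-1) r.
Proof.
move=> dF ar r0.
have rr : - r <= r by rewrite ge0_cp // ltW.
have bnd z : onrect (- r) r (- r) r z -> z != 0 /\ z != a.
  move=> /(square_normc_le (ltW r0))/andP[rz _]; split.
    by rewrite -normc_gt0 (lt_le_trans r0).
  by apply: contraTneq ar => <-; rewrite -leNgt.
have c1 i : rcont (fun z => F z * (z ^+ i)^-1) (- r) r (- r) r.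
  by move=> z /bnd[z0 _]; apply: cdiff_continuous; apply: (cdiffM_expV i (dF z)).
have c2 i : rcont (fun z => F z * (z ^+ i)^-1 * (z - a)^-1) (- r) r (- r) r.
  move=> z /bnd[z0 za]; apply: cdiff_continuous; apply: cdiffM; last exact: cdiffB_inv.
  by apply: (cdiffM_expV i (dF z)).
elim: n => [|n ->].
  rewrite big_ord0 add0r expr0 mul1r; apply: (eq_rect rr rr) => z _.
  by rewrite expr0 invr1 mulr1.
rewrite big_ord_recr /= -addrA; congr (_ + _).
rewrite exprSr -mulrA -mulrDr; congr (_ * _).
rewrite /square -(rectZ rr rr a (c2 n.+1)) -(rectD rr rr (c1 n.+1) (rcontZ (c := a) (c2 n.+1))).
apply: (eq_rect rr rr) => z /bnd[z0 za]; rewrite exprSr; field.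
by rewrite subr_eq0 za z0 expf_neq0.
Qed.

(* Cauchy's formula on a large square: expanding the kernel 1 / (z - a) in powers
   of a, the remainder is O(1 / r), so that F coincides with its Taylor polynomial. *)
Theorem liouville_poly (F : C -> C) k (M : R) : (forall z, cdiff F z) ->
  (forall z, normc (F z) <= M * (1 + normc z) ^+ k) ->
  exists2 p : {poly C}, (size p <= k.+1)%N & forall z, F z = p.[z].
Proof.
move=> dF FM.
pose K i := square (fun z => F z * (z ^+ i.+1)^-1) 1.
pose w := square (fun z => z^-1) 1.
have w0 : w != 0 by exact: square_inv_neq0.
have M0 : 0 <= M.
  by have := FM 0; rewrite normc0 addr0 expr1n mulr1; apply: le_trans; exact: normc_ge0.
(* With w in the place of 2 pi i, these are the Taylor coefficients of [F] at 0 as given by Cauchy's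
   formula. *)
exists (\poly_(i < k.+1) (K i / w)); first exact: size_poly.
move=> a; rewrite horner_poly.
apply: (mulIf w0); rewrite mulr_suml.
(* The summands bound, after multiplication by r, the remainder of order k + 1 for [F] and that of
   order 1 for the constant 1. Here 32 is the 16 of [square_le] times the 2 from |z - a| >= r / 2,
   and 3^k comes from 1 + |z| <= 3 r. *)
pose L := 32 * (M * 3 ^+ k) * normc a ^+ k.+1 + normc (F a) * (32 * normc a).
have key r : 1 <= r -> 2 * normc a + 1 <= r ->
    normc (F a * w - \sum_(i < k.+1) K i / w * a ^+ i * w) * r <= L.
  move=> r1 ra.
  have r0 : 0 < r by apply: lt_le_trans r1.
  have a0 := normc_ge0 a.
  have ar : normc a < r by move: r0 a0 ra; clear; lra.
  have r2 : 0 < r / 2 by rewrite divr_gt0.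
  have dist z : r <= normc z -> normc (z - a)^-1 <= 2 / r.
    move=> rz; rewrite normcV -[X in _ <= X]invrK invf_div.
    have h : r / 2 <= normc (z - a).
      apply: le_trans (normc_lerB _ _); move: rz ra; clear; lra.
    by rewrite lef_pV2 ?posrE//; exact: lt_le_trans h.
  have bnd z : onrect (- r) r (- r) r z -> z != 0 /\ z != a.
    move=> /(square_normc_le (ltW r0))/andP[rz _]; split.
      by rewrite -normc_gt0 (lt_le_trans r0).
    by apply: contraTneq ar => <-; rewrite -leNgt.
  have SK i : square (fun z => F z * (z ^+ i.+1)^-1) r = K i.
    by apply: (square_const ltr01 r1) => z; exact: cdiffM_expV (dF z).
  have E := square_entire_quotient dF ar.
  rewrite (square_kernel_expansion k.+1 dF ar r0) in E.
  (* Expanding for the constant 1 compares the integral of 1 / (z - a) with that of 1 / z. *)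
  have E1 := @square_kernel_expansion (fun=> 1) a r 1 (fun z => differentiable_cst _ _) ar r0.
  have S1 : square (fun z => 1 * (z - a)^-1) r = square (fun z => (z - a)^-1) r.
    by congr square; apply/funext => z; rewrite mul1r.
  have W : square (fun z => 1 * (z ^+ 1)^-1) r = w.
    have d1 (z : C) : z != 0 -> cdiff (fun z => z^-1) z.
      by move/(@cdiffX_inv 1); under eq_fun do rewrite expr1.
    rewrite /w -(square_const ltr01 r1 d1).
    by congr square; apply/funext => z; rewrite mul1r expr1.
  rewrite S1 big_ord1 expr0 mul1r W in E1.
  rewrite E1 in E.
  have sumE : \sum_(i < k.+1) K i / w * a ^+ i * w =
      \sum_(i < k.+1) a ^+ i * square (fun z => F z * (z ^+ i.+1)^-1) r.
    by apply: eq_bigr => i _; rewrite SK; field.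
  rewrite sumE; move: E.
  set T1 := square (fun z => F z * (z ^+ k.+1)^-1 * (z - a)^-1) r.
  set T2 := square _ r; set S := \sum_(i < _) _ => E.
  have -> : F a * w - S = a ^+ k.+1 * T1 - F a * (a * T2).
    have -> : S = F a * (w + a ^+ 1 * T2) - a ^+ k.+1 * T1 by rewrite -E addrK.
    by rewrite expr1; ring.
  have invX i z : r <= normc z -> normc (z ^+ i)^-1 <= (r ^+ i)^-1.
    move=> rz; rewrite normcV normcX lef_pV2 ?posrE ?exprn_gt0//; last exact: lt_le_trans rz.
    by apply: lerXn2r rz; rewrite nnegrE ?(ltW r0) ?normc_ge0.
  have T1r : normc T1 * r <= 32 * (M * 3 ^+ k).
    have -> : 32 * (M * 3 ^+ k) =
        16 * (M * (3 * r) ^+ k * (r ^+ k.+1)^-1 * (2 / r)) * r * r.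
      by rewrite exprMn exprS; field; rewrite ?expf_neq0// gt_eqF.
    apply: (ler_wpM2r (ltW r0)); apply: (square_le r0).
      move=> z /bnd[z0 za]; apply: cdiff_continuous; apply: cdiffM; last exact: cdiffB_inv.
      exact: (cdiffM_expV k.+1 (dF z)).
    move=> z /andP[rz zr]; rewrite !normcM.
    apply: ler_pM; rewrite ?mulr_ge0 ?normc_ge0//; last exact: dist.
    apply: ler_pM; rewrite ?normc_ge0//; last exact: invX.
    apply: le_trans (FM z) _; rewrite ler_wpM2l//.
    apply: lerXn2r; rewrite ?nnegrE ?addr_ge0 ?normc_ge0 ?mulr_ge0 ?(ltW r0)//.
    by move: r1 zr; clear; lra.
  have T2r : normc T2 * r <= 32.
    have -> : 32 = 16 * (1 * (r ^+ 1)^-1 * (2 / r)) * r * r :> R.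
      by field; rewrite gt_eqF.
    apply: (ler_wpM2r (ltW r0)); apply: (square_le r0).
      move=> z /bnd[z0 za]; apply: cdiff_continuous; apply: cdiffM; last exact: cdiffB_inv.
      by apply: (@cdiffM_expV (fun=> 1) 1) z0; exact: differentiable_cst.
    move=> z /andP[rz zr]; rewrite !normcM normc1.
    apply: ler_pM; rewrite ?mulr_ge0 ?normc_ge0//; last exact: dist.
    by rewrite !mul1r invX.
  apply: le_trans (ler_wpM2r (ltW r0) (normcB _ _)) _.
  rewrite mulrDl !normcM normcX -!mulrA /L; apply: lerD.
    by rewrite mulrC ler_wpM2r// exprn_ge0.
  by rewrite ler_wpM2l ?normc_ge0// mulrC ler_wpM2r.
apply/eqP; rewrite -subr_eq0 -normc_eq0; set X := _ - _ in key *.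
apply/negPn/negP => X0.
have {}X0 : 0 < normc X by rewrite lt0r X0 normc_ge0.
have a0 := normc_ge0 a; have L0 : 0 <= `|L| / normc X by rewrite divr_ge0// ltW.
have := key (2 * normc a + 1 + `|L| / normc X).
rewrite lerDl L0 => /(_ _ isT).
have -> : 1 <= 2 * normc a + 1 + `|L| / normc X.
  by rewrite -addrA addrCA lerDl addr_ge0// mulr_ge0.
move=> /(_ isT); rewrite mulrDr [_ * (_ / _)]mulrC divfK ?gt_eqF//.
rewrite mulrDr mulr1 => /(le_trans)/(_ (ler_norm L)).
rewrite gerDr leNgt ltr_wpDl// mulr_ge0 ?mulr_ge0 ?normc_ge0//.
Qed.

End Liouville.

(** * Holomorphic maps commuting with a contraction *)

Lemma commutingE (T : Type) (g h : T -> T) p : g \o h = h \o g -> g (h p) = h (g p).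
Proof. by move=> gh; rewrite -[LHS]/((g \o h) p) gh. Qed.

Lemma iterK (T : Type) (u v : T -> T) n : cancel u v -> cancel (iter n u) (iter n v).
Proof. by move=> uK; elim: n => // n IH p; rewrite iterSr /= uK IH. Qed.

Lemma iter_iter (T : Type) (u : T -> T) m n : iter m (iter n u) = iter (n * m) u.
Proof. by apply/funext => p; rewrite mulnC iterM. Qed.

Lemma semiconj_iter (S T : Type) (h : S -> T) (u : S -> S) (v : T -> T) m :
  h \o u = v \o h -> h \o iter m u = iter m v \o h.
Proof.
move=> huv; apply/funext => p /=; elim: m => //= m <-.
exact: (congr1 (@^~ (iter m u p)) huv).
Qed.

Lemma semiconj_inv (S T : Type) (h : S -> T) (u u' : S -> S) (v v' : T -> T) :
  cancel u' u -> cancel v v' -> h \o u = v \o h -> h \o u' = v' \o h.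
Proof.
move=> uK vK huv; apply/funext => p /=.
rewrite -{2}(uK p) -[h (u _)]/((h \o u) (u' p)) huv /=; exact/esym/vK.
Qed.

Section NearDiff.
Variables (K : numFieldType) (V U : normedModType K).

Lemma near_eq_differentiable (f g : V -> U) (x : V) :
  (\forall y \near x, f y = g y) -> differentiable f x -> differentiable g x.
Proof.
move=> fg df; have fgx : f x = g x by exact: nbhs_singleton fg.
have gE : g \o shift x = cst (g x) + 'd f x +o_ 0 id.
  apply/eqaddoP => e e0.
  have /eqaddoP/(_ e e0) := diff_locally df.
  have : \forall h \near 0, f (h + x) = g (h + x).
    by move: fg; rewrite (near_shift 0 x) subr0.
  apply: filterS2 => h fgh.
  by rewrite -[(g \o _ - _) h]/(g (h + x) - (g x + 'd f x h)) -fgh -fgx.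
have dgE := diff_unique (diff_continuous df) gE.
by apply/diff_locallyP; rewrite dgE; split => //; exact: diff_continuous.
Qed.
End NearDiff.

(** * The punctured plane, triangular maps and the weighted size *)

Section PuncturedPlane.
Variable R : realType.
Local Notation C := R[i].
Local Notation Co := (R[i]^o : normedModType R[i]).
Local Notation W := (W R).
Local Notation C2 := (C2 R).
Implicit Types (p q : W) (g h : W -> W).

Lemma val_neq0 p : val p != 0 :> C2.
Proof. exact: set_valP p. Qed.

Lemma W1_proof : ((1, 0) : C2) \in @punctured R.
Proof. by rewrite inE /punctured /= -pair_eqE /= /pair_eq /= oner_eq0. Qed.

Definition W1 : W := exist (fun x : C2 => x \in @punctured R) _ W1_proof.

Definition toW (x : C2) : W := insubd W1 x.

Lemma toWK x : x != 0 -> val (toW x) = x.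
Proof. by move=> x0; apply: insubdK; exact: mem_set. Qed.

Lemma valWK p : toW (val p) = p.
Proof. exact: valKd. Qed.

Lemma W_inj p q : val p = val q -> p = q.
Proof. exact: val_inj. Qed.

Lemma pair_neq0 (x : C2) : (x != 0) = (x.1 != 0) || (x.2 != 0).
Proof. by case: x => a b; rewrite -negb_and. Qed.

Lemma near_neq0 (x : C2) : x != 0 -> \forall y \near x, y != 0.
Proof.
by move=> x0; apply: (@cvgr_neq0 _ _ _ (nbhs x) _ id x).
Qed.

Lemma val_continuous : continuous (val : W -> C2).
Proof. exact: initial_continuous. Qed.

Lemma continuous_toW (T : topologicalType) (g : T -> W) (t : T) :
  {for t, continuous (val \o g : T -> C2)} -> {for t, continuous g}.
Proof.
move=> cg A [B [[D oD <-] Dg] DA]; apply: filterS DA _; apply: cg.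
by apply: open_nbhs_nbhs; split.
Qed.

Lemma toW_continuous (x : C2) : x != 0 -> {for x, continuous toW}.
Proof.
move=> x0; apply: continuous_toW => A; rewrite /= toWK// => xA.
apply: (@filterS _ (nbhs x) _ (A `&` [set y | y != 0])).
  by move=> y /= [Ay y0]; rewrite toWK.
by apply: filterI => //; exact: near_neq0.
Qed.

Definition ext g : C2 -> C2 := val \o g \o toW.

(** The only chart of [W] is [val], whose partial inverse agrees with [toW] off the origin. The
    value of [ext g] at the origin is junk, but differentiability elsewhere does not see it. *)
Lemma holomorphicP g : @holomorphic R (Defs.W R) (Defs.W R) g <->
  forall p, differentiable (ext g) (val p).
Proof.
have pinvE (x : W) (y : C2) : y != 0 -> 'pinv_(fun=> x) [set: W] val y = toW y.
  move=> y0; rewrite -{1}(toWK y0).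
  by rewrite pinvKV ?inE// => a b _ _; exact: W_inj.
have extE (x : W) : \forall y \near (val x : C2),
    (val \o g \o 'pinv_(fun=> x) [set: W] val) y = ext g y.
  apply: filterS (near_neq0 (val_neq0 x)) => y y0 /=.
  by rewrite pinvE.
split=> [[cg dg] p|dg].
  apply: near_eq_differentiable (extE p) _.
  by apply: (dg ([set: W], val) ([set: W], val)).
split.
  move=> p; apply: continuous_toW.
  have -> : (val \o g : W -> C2) = ext g \o val.
    by apply/funext => q /=; rewrite /ext /= valWK.
  apply: continuous_comp; first exact: val_continuous.
  exact: differentiable_continuous.
move=> k l -> -> x _ _ /=.
apply: near_eq_differentiable (dg x).
by apply: filterS (extE x) => y ->.
Qed.

Lemma holomorphic_W_continuous g : @holomorphic R (Defs.W R) (Defs.W R) g -> continuous g.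
Proof. by case. Qed.

Lemma ext_comp g h : ext (g \o h) = ext g \o ext h.
Proof. by apply/funext => x; rewrite /ext /= valWK. Qed.

Lemma holomorphic_W_comp g h : @holomorphic R (Defs.W R) (Defs.W R) g ->
  @holomorphic R (Defs.W R) (Defs.W R) h -> @holomorphic R (Defs.W R) (Defs.W R) (g \o h).
Proof.
move=> /holomorphicP dg /holomorphicP dh; apply/holomorphicP => p.
rewrite ext_comp; apply: differentiable_comp; first exact: dh.
by rewrite /ext /= valWK; exact: dg.
Qed.

Lemma holomorphic_W_id : @holomorphic R (Defs.W R) (Defs.W R) id.
Proof.
apply/holomorphicP => p; apply: (@near_eq_differentiable _ _ _ id).
  by apply: filterS (near_neq0 (val_neq0 p)) => x x0; rewrite /ext /= toWK.
by apply: (@linear_differentiable _ C2 C2 idfun) => ?.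
Qed.

Lemma given_by_holomorphic g (F : C -> C -> C * C) : given_by g F ->
  (forall p, differentiable (fun x : C2 => F x.1 x.2 : C2) (val p)) ->
  @holomorphic R (Defs.W R) (Defs.W R) g.
Proof.
move=> gF dF; apply/holomorphicP => p; apply: near_eq_differentiable (dF p).
apply: filterS (near_neq0 (val_neq0 p)) => x x0.
by rewrite /ext /= gF toWK.
Qed.

Lemma differentiable_fst (x : C2) : differentiable (fst : C2 -> Co) x.
Proof. by apply: (@linear_differentiable _ C2 Co fst) => y; exact: cvg_fst. Qed.

Lemma differentiable_snd (x : C2) : differentiable (snd : C2 -> Co) x.
Proof. by apply: (@linear_differentiable _ C2 Co snd) => y; exact: cvg_snd. Qed.

(** The common shape of all the contractions, of their inverses, and of every centralizer element in
    the lists except those of GL(2, R). *)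
Definition lowerF (a b : C) (r : nat) (d : C) (z w : C) : C * C :=
  (a * z + b * w ^+ r, d * w).

Definition lower a b r d : W -> W := fun p => toW (lowerF a b r d (val p).1 (val p).2).

Lemma lowerE a b r d : a != 0 -> d != 0 -> (0 < r)%N -> given_by (lower a b r d) (lowerF a b r d).
Proof.
move=> a0 d0 r0 p; rewrite toWK// pair_neq0 /= mulf_eq0 negb_or d0 /=.
have := val_neq0 p; rewrite pair_neq0.
have [->/=|_] := eqVneq (val p).2 0; last by rewrite !orbT.
by rewrite !orbF expr0n (gtn_eqF r0) mulr0 addr0 => p0; rewrite mulf_neq0.
Qed.

Lemma lower_differentiable a b r d (x : C2) :
  differentiable (fun y : C2 => lowerF a b r d y.1 y.2 : C2) x.
Proof.
have dX (n : nat) : differentiable (fun y : C2 => y.2 ^+ n : Co) x.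
  apply: (@differentiable_comp _ C2 Co Co snd (fun t => t ^+ n)).
    exact: differentiable_snd.
  by apply/derivable1_diffP; exact: exprn_derivable.
have dM (k : C) (u : C2 -> Co) : differentiable u x -> differentiable (fun y => k * u y : Co) x.
  by move=> du; apply: (@differentiableM _ C2 (cst k)) => //; exact: differentiable_cst.
apply: (@differentiable_pair _ C2 Co Co (fun y => a * y.1 + b * y.2 ^+ r) (fun y => d * y.2)).
  by apply: differentiableD; apply: dM => //; exact: differentiable_fst.
by apply: dM; exact: differentiable_snd.
Qed.

Lemma lower_holomorphic g a b r d : given_by g (lowerF a b r d) ->
  @holomorphic R (Defs.W R) (Defs.W R) g.
Proof. by move/given_by_holomorphic; apply => p; exact: lower_differentiable. Qed.

Definition lower_inv (a b : C) (r : nat) (d : C) : W -> W :=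
  lower a^-1 (- (b / (a * d ^+ r))) r d^-1.

Lemma lower_inv_given a b r d : a != 0 -> d != 0 -> (0 < r)%N ->
  given_by (lower_inv a b r d) (fun z w => (a^-1 * z - b / (a * d ^+ r) * w ^+ r, d^-1 * w)).
Proof.
by move=> a0 d0 r0 p; rewrite lowerE ?invr_eq0// /lowerF mulNr.
Qed.

Lemma lowerK g a b r d : a != 0 -> d != 0 -> (0 < r)%N -> given_by g (lowerF a b r d) ->
  cancel g (lower_inv a b r d) /\ cancel (lower_inv a b r d) g.
Proof.
move=> a0 d0 r0 gE; split => p; apply: W_inj; rewrite ?(lower_inv_given _ a0 d0 r0) ?gE /lowerF;
  rewrite ?(lower_inv_given _ a0 d0 r0) ?gE /lowerF /= [RHS]surjective_pairing;
  congr (_, _); rewrite ?exprMn ?exprVn; field; by rewrite ?a0 ?d0 ?expf_neq0.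
Qed.

Lemma lower_Aut g a b r d : a != 0 -> d != 0 -> (0 < r)%N -> given_by g (lowerF a b r d) ->
  Aut_h (Defs.W R) g.
Proof.
move=> a0 d0 r0 gE; split; first exact: lower_holomorphic gE.
have [gK Kg] := lowerK a0 d0 r0 gE.
exists (lower_inv a b r d); split => //.
by apply: lower_holomorphic; apply: lowerE; rewrite ?invr_eq0.
Qed.

(* For small e > 0 a contraction (z, w) |-> (a z + b w^r, d w) multiplies this weighted
   size of (z, w) by at most some lam < 1. *)
Definition rho (e : R) (r : nat) (x : C2) : R := e * normc x.1 + normc x.2 ^+ r.

Lemma rho_continuous e r : continuous (rho e r).
Proof.
move=> x; have n1 : {for x, continuous (fun y : C2 => normc y.1)}.
  by apply: (@continuous_comp _ _ _ (fst : C2 -> Co)); [exact: cvg_fst|exact: normc_continuous].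
have n2 : {for x, continuous (fun y : C2 => normc y.2)}.
  by apply: (@continuous_comp _ _ _ (snd : C2 -> Co)); [exact: cvg_snd|exact: normc_continuous].
apply: (@continuousD _ R^o C2 (fun y => e * normc y.1) (fun y => normc y.2 ^+ r)).
  by apply: (@continuousM _ C2 (cst e)) => //; exact: cst_continuous.
by apply: (@continuous_comp C2 R R _ (fun t => t ^+ r) x n2); exact: exprn_continuous.
Qed.

Lemma rho_gt0 e r (x : C2) : 0 < e -> (0 < r)%N -> x != 0 -> 0 < rho e r x.
Proof.
move=> e0 r0; rewrite pair_neq0 => /orP[x1|x2].
  by apply: ltr_pwDl; rewrite ?mulr_gt0 ?normc_gt0// exprn_ge0// normc_ge0.
by apply: ltr_wpDl; rewrite ?mulr_ge0 ?normc_ge0 ?ltW// exprn_gt0// normc_gt0.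
Qed.

Lemma lower_rho_contracts (f : W -> W) a b r d :
  0 < normc a < 1 -> 0 < normc d < 1 -> (0 < r)%N -> given_by f (lowerF a b r d) ->
  exists e lam L : R, [/\ 0 < e, 0 < lam < 1, 1 < L,
    forall p, rho e r (val (f p)) <= lam * rho e r (val p) &
    forall p, rho e r (val (lower_inv a b r d p)) <= L * rho e r (val p)].
Proof.
move=> /andP[a0 a1] /andP[d0 d1] r0 fE.
have a_neq0 : a != 0 by rewrite -normc_gt0.
have d_neq0 : d != 0 by rewrite -normc_gt0.
pose s := normc d ^+ r.
have s0 : 0 < s by rewrite exprn_gt0.
have s1 : s < 1 by rewrite exprn_ilt1 ?normc_ge0// -lt0n.
pose k := normc b; have k0 : 0 <= k := normc_ge0 b.
have k1 : 0 < 2 * (k + 1) by rewrite mulr_gt0// ltr_wpDl.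
(* Chosen so that e k <= (1 - s) / 2: the term b w^r then raises the factor of |w|^r only from s to
   at most (1 + s) / 2. The 1 added to k allows b = 0. *)
pose e := (1 - s) / (2 * (k + 1)).
have e0 : 0 < e by rewrite divr_gt0 ?subr_gt0.
have ek : e * k <= (1 - s) / 2.
  rewrite /e mulrAC ler_pdivrMr// -mulrA; apply: ler_wpM2l; first by rewrite subr_ge0 ltW.
  by rewrite mulrA mulVf// mul1r lerDl.
pose lam := Num.max (normc a) ((1 + s) / 2).
(* The entries bound the coefficients of e |z| and of |w|^r for the inverse map; the first alone
   exceeds 1. *)
pose L := Num.max (normc a)^-1 (e * (k / (normc a * s)) + s^-1).
have nw (w : C) : 0 <= normc w ^+ r by rewrite exprn_ge0 ?normc_ge0.
have nz (z : C) : 0 <= e * normc z by rewrite mulr_ge0 ?normc_ge0 ?ltW.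
have aux (m x y t u : R) : x <= m -> y <= m -> 0 <= t -> 0 <= u -> x * t + y * u <= m * (t + u).
  by move=> xm ym t0 u0; rewrite mulrDr; apply: lerD; exact: ler_wpM2r.
exists e, lam, L; split => //.
- rewrite lt_max a0 /= gt_max a1 /=; move: s1; clear; lra.
- by rewrite lt_max invf_gt1 ?a1.
- move=> p; rewrite fE /lowerF /rho /=; set z := (val p).1; set w := (val p).2.
  apply: (@le_trans _ _ (normc a * (e * normc z) + (e * k + s) * normc w ^+ r)).
    rewrite normcM exprMn -/s mulrDl addrA lerD2r.
    rewrite [X in _ <= X + _]mulrCA -mulrA -mulrDr; apply: ler_wpM2l; first exact: ltW.
    by apply: le_trans (normcD _ _) _; rewrite !normcM normcX.
  apply: aux => //; first by rewrite le_max lexx.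
  rewrite le_max; apply/orP; right; move: ek; clear; lra.
- move=> p; rewrite (lower_inv_given _ a_neq0 d_neq0 r0) /rho /=.
  set z := (val p).1; set w := (val p).2.
  apply: (@le_trans _ _ ((normc a)^-1 * (e * normc z) +
      (e * (k / (normc a * s)) + s^-1) * normc w ^+ r)).
    rewrite normcM normcV exprMn exprVn -/s mulrDl addrA lerD2r.
    have -> : (normc a)^-1 * (e * normc z) + e * (k / (normc a * s)) * normc w ^+ r =
        e * ((normc a)^-1 * normc z + k / (normc a * s) * normc w ^+ r) by ring.
    apply: ler_wpM2l; first exact: ltW.
    by apply: le_trans (normcB _ _) _; rewrite !normcM !normcV !normcM !normcX.
  by apply: aux => //; rewrite le_max lexx ?orbT.
Qed.

Lemma C2_box_compact (t : R) : compact [set x : C2 |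
  [/\ `|complex.Re x.1| <= t, `|complex.Im x.1| <= t,
      `|complex.Re x.2| <= t & `|complex.Im x.2| <= t]].
Proof.
pose I := `[- t, t]%classic : set R.
have cI : compact I by exact: segment_compact.
have cII : compact (I `*` I) by exact: compact_setX.
pose J := (fun x : R * R => x.1 +i* x.2 : Co) @` (I `*` I).
have cJ : compact J.
  apply: continuous_compact => //; apply: continuous_subspaceT => x.
  apply/continuous_normcP => d d0.
  have d2 : 0 < d / 2 by rewrite divr_gt0.
  have h1 := (continuous_normrP _ _).1 (@cvg_fst R R (nbhs x.1) (nbhs x.2) _) (d / 2) d2.
  have h2 := (continuous_normrP _ _).1 (@cvg_snd R R (nbhs x.1) (nbhs x.2) _) (d / 2) d2.
  apply: filterS2 (h1 _) (h2 _) => y y1 y2.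
  apply: le_lt_trans (normc_leD (y.1 - x.1) (y.2 - x.2)) _.
  by rewrite [d]splitr; apply: ltrD.
have : compact (J `*` J) by exact: compact_setX.
congr compact; apply/seteqP; split.
  move=> x [[[a b] /= [aI bI] <-] [[a' b'] /= [aI' bI'] <-]] /=.
  by move: aI bI aI' bI'; rewrite /I /= !in_itv /= -!ler_norml.
move=> [[a b] [a' b']] /= [ha hb ha' hb'].
by split; [exists (a, b)|exists (a', b')] => //=; split; rewrite /I /= in_itv /= -ler_norml.
Qed.

End PuncturedPlane.

(** * Growth of holomorphic maps commuting with a contraction *)

Section Growth.
Variable R : realType.
Local Notation C := R[i].
Local Notation Co := (R[i]^o : normedModType R[i]).
Local Notation W := (W R).
Local Notation C2 := (C2 R).
Variables (f finv : W -> W) (e : R) (r : nat) (lam L : R).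
Hypotheses (e0 : 0 < e) (r0 : (0 < r)%N) (lam01 : 0 < lam < 1) (L1 : 1 < L).
Hypotheses (fK : cancel f finv) (Kf : cancel finv f).
Local Notation rhoW p := (rho e r (val (p : W))).
Hypotheses (flam : forall p, rhoW (f p) <= lam * rhoW p)
           (fL : forall p, rhoW (finv p) <= L * rhoW p).

Lemma rhoW_gt0 p : 0 < rhoW p. Proof. by apply: rho_gt0 => //; exact: val_neq0. Qed.

Lemma rho_snd_le (x : C2) : normc x.2 <= 1 + rho e r x.
Proof.
apply: (@le_trans _ _ (1 + normc x.2 ^+ r)); last first.
  by rewrite /rho addrA lerD2r lerDl mulr_ge0 ?normc_ge0// ltW.
have [x1|x1] := leP (normc x.2) 1.
  by apply: le_trans x1 _; rewrite lerDl exprn_ge0 ?normc_ge0.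
by apply: (@le_trans _ _ (normc x.2 ^+ r)); [exact: ler_eXnr (ltW x1)|rewrite lerDr].
Qed.

Lemma rho_fst_le (x : C2) : normc x.1 <= e^-1 * rho e r x.
Proof. by rewrite ler_pdivlMl// /rho lerDl exprn_ge0// normc_ge0. Qed.

(** The annulus is compact in C^2, being closed in a box, and avoids the origin, where [rho]
    vanishes. *)
Lemma annulus_bound (g : W -> W) (s t : R) : 0 < s -> continuous g ->
  exists2 M, 0 <= M & forall p, s <= rhoW p <= t -> rhoW (g p) <= M.
Proof.
move=> s0 cg.
pose K := [set x : C2 | s <= rho e r x <= t].
have cK : compact K.
  pose b := e^-1 * t + (1 + t).
  have KE : K = [set x : C2 | [/\ `|complex.Re x.1| <= b, `|complex.Im x.1| <= b,
      `|complex.Re x.2| <= b & `|complex.Im x.2| <= b]] `&` (rho e r @^-1` `[s, t]).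
    apply/seteqP; split => x /=; rewrite in_itv/=; last by case.
    move=> /andP[sx xt]; split; last by rewrite sx xt.
    have t0 : 0 <= t by exact: le_trans (le_trans (ltW s0) sx) xt.
    have et : 0 <= e^-1 * t by rewrite mulr_ge0// invr_ge0 ltW.
    have h1 : normc x.1 <= b.
      apply: le_trans (rho_fst_le x) _.
      apply: (@le_trans _ _ (e^-1 * t)); last by rewrite lerDl addr_ge0.
      by rewrite ler_wpM2l// invr_ge0 ltW.
    have h2 : normc x.2 <= b.
      apply: le_trans (rho_snd_le x) _.
      by apply: (@le_trans _ _ (1 + t)); [rewrite lerD2l|rewrite lerDr].
    by split; [exact: le_trans (normc_geRe _) h1|exact: le_trans (normc_geIm _) h1|
      exact: le_trans (normc_geRe _) h2|exact: le_trans (normc_geIm _) h2].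
  rewrite KE; apply: compact_closedI; first exact: C2_box_compact.
  apply: preimage_closed => [x _|]; first exact: rho_continuous.
  exact: interval_closed.
have K0 x : K x -> x != 0.
  move=> /andP[sx _]; apply: contraTneq (lt_le_trans s0 sx) => ->.
  by rewrite /rho normc0 mulr0 add0r expr0n (gtn_eqF r0) ltxx.
pose h x := rho e r (val (g (toW x))).
have ch : {within K, continuous h}.
  apply: continuous_in_subspaceT => x; rewrite inE => /K0 x0.
  apply: (@continuous_comp _ _ _ (fun x => val (g (toW x)))); last exact: rho_continuous.
  apply: (@continuous_comp _ _ _ (fun x => g (toW x)) val); last exact: val_continuous.
  by apply: continuous_comp; [exact: toW_continuous|exact: cg].
have [KN|KE] := pselect (K !=set0).
  have [x Kx xmax] := compact_EVT_max KN cK ch.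
  exists (h x); first by apply: ltW; exact: rhoW_gt0.
  by move=> p ps; have := xmax (val p); rewrite inE /h valWK; apply.
by exists 0 => // p ps; exfalso; apply: KE; exists (val p).
Qed.

Lemma rho_iter n p : rhoW (iter n f p) <= lam ^+ n * rhoW p.
Proof.
elim: n => [|n IH]; first by rewrite expr0 mul1r.
rewrite iterS exprS -mulrA; apply: le_trans (flam _) _.
by apply: ler_wpM2l => //; case/andP: lam01 => /ltW.
Qed.

Lemma rho_iterV n p : rhoW (iter n finv p) <= L ^+ n * rhoW p.
Proof.
elim: n => [|n IH]; first by rewrite expr0 mul1r.
rewrite iterS exprS -mulrA; apply: le_trans (fL _) _.
by apply: ler_wpM2l => //; apply: ltW; exact: lt_trans L1.
Qed.

Lemma lam_small (x : R) : 0 <= x -> exists n, lam ^+ n * x <= 1.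
Proof.
move=> x0; have [l0 l1] := andP lam01.

have [n] : exists n, lam ^+ n < (x + 1)^-1.
  have : (fun n => lam ^+ n) @ \oo --> (0 : R) by apply: cvg_expr; rewrite gtr0_norm.
  move=> /cvgrPdistC_lt/(_ (x + 1)^-1); rewrite invr_gt0 ltr_wpDl// => /(_ isT)[n _ hn].
  exists n; have := hn n (leqnn n); rewrite /= subr0 gtr0_norm// exprn_gt0//.
move=> /ltW hn; exists n; apply: le_trans (ler_wpM2r x0 hn) _.
by rewrite ler_pdivrMl ?ltr_wpDl// mulr1 lerDl.
Qed.

(** Stop at the first iterate of size at most 1: the one before exceeds 1, and f divides the size by
    at most L. The second conclusion bounds n logarithmically in the size of [p], which is what
    makes growth polynomial. *)
Lemma annulus_outer p : 1 < rhoW p -> exists n, [/\ L^-1 <= rhoW (iter n.+1 f p) <= 1 &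
  1 <= lam ^+ n * rhoW p].
Proof.
move=> p1.
have [m hm] : exists m, rhoW (iter m f p) <= 1.
  have [m hm] := lam_small (ltW (rhoW_gt0 p)).
  by exists m; exact: le_trans (rho_iter m p) hm.
pose P m := rhoW (iter m f p) <= 1.
case: (@ex_minnP P (ex_intro _ m hm)) => -[|n] hn hmin.
  by move: hn; rewrite /P leNgt p1.
rewrite /P in hn hmin; have n1 : 1 < rhoW (iter n f p).
  by rewrite ltNge; apply/negP => /hmin; rewrite ltnn.
exists n; split; last by apply: le_trans (rho_iter n p); exact: ltW.
have L0 := lt_trans ltr01 L1.
rewrite hn andbT -[L^-1]mulr1 ler_pdivrMl//.
by apply: le_trans (ltW n1) _; have := fL (iter n.+1 f p); rewrite iterS fK.
Qed.

(** Iterates of the inverse eventually leave the unit ball of [rho]; the last one before the first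
    exit is in the annulus, since the inverse expands by at most L. *)
Lemma annulus_inner p : rhoW p <= 1 -> exists n, L^-1 <= rhoW (iter n finv p) <= 1.
Proof.
move=> p1; have L0 := lt_trans ltr01 L1.
have [l0 l1] := andP lam01.
have expand m : rhoW p <= lam ^+ m * rhoW (iter m finv p).
  by have := rho_iter m (iter m finv p); rewrite (iterK _ Kf).
have [m hm] : exists m, 1 < rhoW (iter m finv p).
  have x0 : 0 <= 2 * (rhoW p)^-1 by rewrite mulr_ge0// invr_ge0 ltW// rhoW_gt0.
  have [m hm] := lam_small x0.
  exists m; rewrite ltNge; apply/negP => le1.
  have h : rhoW p <= lam ^+ m.
    by apply: le_trans (expand m) _; rewrite ler_piMr// exprn_ge0// ltW.
  have : 2 <= (1 : R).
    apply: le_trans hm; rewrite mulrCA -[X in X <= _]mulr1 ler_pM2l//.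
    by rewrite ler_pdivlMr ?mul1r// rhoW_gt0.
  by rewrite lern1.
pose P m := 1 < rhoW (iter m finv p).
case: (@ex_minnP P (ex_intro _ m hm)) => -[|n] hn hmin.
  by move: hn; rewrite /P ltNge p1.
rewrite /P in hn hmin; have n1 : rhoW (iter n finv p) <= 1.
  by rewrite leNgt; apply/negP => /hmin; rewrite ltnn.
exists n; rewrite n1 andbT -[L^-1]mulr1 ler_pdivrMl//.
by apply: le_trans (ltW hn) _; rewrite iterS; exact: fL.
Qed.

(** Carry [p] into the annulus, apply [g] there and return. From the inside the return is
    contracting; from the outside it costs a power of L with logarithmic exponent. *)
Lemma commuting_growth (g : W -> W) : continuous g -> g \o f = f \o g ->
  exists M k, 0 <= M /\ forall p, rhoW (g p) <= M * (1 + rhoW p) ^+ k.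
Proof.
move=> cg gf; have L0 := lt_trans ltr01 L1; have [l0 l1] := andP lam01.
have gfn n p : g (iter n f p) = iter n f (g p).
  by elim: n => //= n <-; exact: (congr1 (@^~ (iter n f p)) gf).
have LV0 : 0 < L^-1 by rewrite invr_gt0.
have [M M0 hM] := @annulus_bound g L^-1 1 LV0 cg.
(* With lam^k L <= 1, the factor L^n is at most lam^(- n k), hence at most the k-th power of the
   size of [p]. *)
have [k hk] := lam_small (ltW L0).
exists (M * L), k; split; first by rewrite mulr_ge0// ltW.
move=> p; have r1 : 1 <= 1 + rhoW p by rewrite lerDl ltW// rhoW_gt0.
have ML : 0 <= M * L by rewrite mulr_ge0// ltW.
have [p1|p1] := leP (rhoW p) 1.
  have [n hn] := annulus_inner p1.
  apply: (@le_trans _ _ M); last first.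
    rewrite -mulrA ler_peMr//; apply: mulr_ege1; first exact: ltW.
    exact: exprn_ege1.
  have -> : g p = iter n f (g (iter n finv p)) by rewrite -gfn (iterK _ Kf).
  apply: le_trans (rho_iter _ _) _; apply: le_trans (hM _ hn).
  by apply: ler_piMl; [exact/ltW/rhoW_gt0|apply: exprn_ile1; exact: ltW].
have [n [hn hnp]] := annulus_outer p1.
have -> : g p = iter n.+1 finv (g (iter n.+1 f p)) by rewrite gfn (iterK _ fK).
apply: le_trans (rho_iterV _ _) _.
apply: (@le_trans _ _ (L ^+ n.+1 * M)).
  by apply: ler_wpM2l; [apply: exprn_ge0; exact: ltW|exact: hM].
rewrite [X in X <= _]mulrC exprS mulrA ler_wpM2l//.
apply: (@le_trans _ _ (rhoW p ^+ k)); last first.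
  have pg := ltW (rhoW_gt0 p).
  by apply: lerXn2r; rewrite ?nnegrE //; [exact: addr_ge0|rewrite lerDr].
apply: (@le_trans _ _ (L ^+ n * (lam ^+ n * rhoW p) ^+ k)).
  by apply: ler_peMr; [apply: exprn_ge0; exact: ltW|exact: exprn_ege1].
rewrite exprMn mulrA; apply: ler_piMl; first exact/exprn_ge0/ltW/rhoW_gt0.
rewrite -exprM mulnC exprM -exprMn mulrC.
by apply: exprn_ile1 => //; apply: mulr_ge0; [apply: exprn_ge0; exact: ltW|exact: ltW].
Qed.

Section Lines.
Variable g : W -> W.
Hypothesis holg : @holomorphic R (Defs.W R) (Defs.W R) g.

Definition gfst (z w : C) : C := (val (g (toW (z, w)))).1.
Definition gsnd (z w : C) : C := (val (g (toW (z, w)))).2.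

Lemma differentiable_hline (z w : Co) : differentiable (fun t : Co => (t, w) : C2) z.
Proof.
apply: (@differentiable_pair _ Co Co Co id (cst w)); first exact: cdiff_id.
exact: differentiable_cst.
Qed.

Lemma differentiable_vline (z w : Co) : differentiable (fun t : Co => (z, t) : C2) w.
Proof.
apply: (@differentiable_pair _ Co Co Co (cst z) id); last exact: cdiff_id.
exact: differentiable_cst.
Qed.

Lemma ext_differentiable (x : C2) : x != 0 -> differentiable (ext g) x.
Proof. by move=> x0; have := (holomorphicP g).1 holg (toW x); rewrite toWK. Qed.

Lemma cdiff_gfst_h w z : w != 0 -> cdiff (gfst ^~ w) z.
Proof.
move=> w0; apply: (@differentiable_comp _ Co C2 Co (fun t => ext g (t, w)) fst).
  apply: (@differentiable_comp _ Co C2 C2 (fun t => (t, w)) (ext g)).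
    exact: differentiable_hline.
  by apply: ext_differentiable; rewrite pair_neq0 w0 orbT.
exact: differentiable_fst.
Qed.

Lemma cdiff_gsnd_h w z : w != 0 -> cdiff (gsnd ^~ w) z.
Proof.
move=> w0; apply: (@differentiable_comp _ Co C2 Co (fun t => ext g (t, w)) snd).
  apply: (@differentiable_comp _ Co C2 C2 (fun t => (t, w)) (ext g)).
    exact: differentiable_hline.
  by apply: ext_differentiable; rewrite pair_neq0 w0 orbT.
exact: differentiable_snd.
Qed.

Lemma cdiff_gfst_v w z : z != 0 -> cdiff (gfst z) w.
Proof.
move=> z0; apply: (@differentiable_comp _ Co C2 Co (fun t => ext g (z, t)) fst).
  apply: (@differentiable_comp _ Co C2 C2 (fun t => (z, t)) (ext g)).
    exact: differentiable_vline.
  by apply: ext_differentiable; rewrite pair_neq0 z0.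
exact: differentiable_fst.
Qed.

Lemma cdiff_gsnd_v w z : z != 0 -> cdiff (gsnd z) w.
Proof.
move=> z0; apply: (@differentiable_comp _ Co C2 Co (fun t => ext g (z, t)) snd).
  apply: (@differentiable_comp _ Co C2 C2 (fun t => (z, t)) (ext g)).
    exact: differentiable_vline.
  by apply: ext_differentiable; rewrite pair_neq0 z0.
exact: differentiable_snd.
Qed.

(* If g conjugated f to its inverse, g would tend to 0 at infinity, hence be
   constant on the line w = 1. *)
Lemma not_inverse_conjugate : g \o f <> finv \o g.
Proof.
move=> gf; have cg : continuous g := holomorphic_W_continuous holg.
have L0 := lt_trans ltr01 L1; have [l0 l1] := andP lam01.
have gfn n p : g (iter n f p) = iter n finv (g p).
  by elim: n => //= n <-; exact: (congr1 (@^~ (iter n f p)) gf).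
have LV0 : 0 < L^-1 by rewrite invr_gt0.
have [M M0 hM] := @annulus_bound g L^-1 1 LV0 cg.
(* A point of size above L^N needs at least N steps to reach the annulus. As [g] turns f into its
   inverse, returning now means applying f, which shrinks the bounded value by at least lam^N. *)
have small (d : R) : 0 < d -> exists T, 1 <= T /\ forall p, T < rhoW p -> rhoW (g p) <= d.
  move=> d0; have [N hN] := lam_small (divr_ge0 M0 (ltW d0)).
  exists (L ^+ N); split; first by apply: exprn_ege1; exact: ltW.
  move=> p pT; have p1 : 1 < rhoW p.
    by apply: le_lt_trans pT; apply: exprn_ege1; exact: ltW.
  have [n [hn _]] := annulus_outer p1.
  have Nn : (N <= n.+1)%N.
    rewrite leqNgt; apply/negP => nN; move: pT; apply/negP; rewrite -leNgt.
    rewrite -(iterK n.+1 fK p); apply: le_trans (rho_iterV _ _) _.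
    apply: (@le_trans _ _ (L ^+ n.+1)).
      by apply: ler_piMr; [apply: exprn_ge0; exact: ltW|case/andP: hn].
    by apply: ler_weXn2l; [exact: ltW|exact: ltnW].
  have -> : g p = iter n.+1 f (g (iter n.+1 f p)) by rewrite gfn (iterK _ Kf).
  apply: le_trans (rho_iter _ _) _.
  apply: (@le_trans _ _ (lam ^+ N * M)).
    apply: ler_pM; [by apply: exprn_ge0; exact: ltW|exact/ltW/rhoW_gt0| |exact: hM].
    by apply: ler_wiXn2l => //; exact: ltW.
  by move: hN; rewrite mulrA ler_pdivrMr// mul1r.
have p1 z : 1 <= rho e r (z, 1).
  by rewrite /rho /= normc1 expr1n lerDr mulr_ge0 ?normc_ge0// ltW.
have n0 (z : C) : (z, 1) != 0 :> C2 by rewrite pair_neq0 /= oner_neq0 orbT.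
pose G z : W := g (toW (z, 1)).
(* On the line w = 1 the size is at least 1, so an annulus bound covers the part up to T and [small]
   the rest. *)
have [B hB] : exists B, forall z, rhoW (G z) <= B.
  have [T [T1 hT]] := small 1 ltr01.
  have [M' M'0 hM'] := @annulus_bound g 1 T ltr01 cg.
  exists (1 + M') => z; have [zT|zT] := leP (rho e r (z, 1)) T.
    apply: (@le_trans _ _ M'); last by rewrite lerDr.
    by apply: hM'; rewrite toWK// p1 zT.
  apply: (@le_trans _ _ 1); last by rewrite lerDl.
  by apply: hT; rewrite toWK.
have cst_of (F : C -> C) (B' : R) : (forall z, cdiff F z) -> (forall z, normc (F z) <= B') ->
    forall z, F z = F 0.
  move=> dF FB z.
  have [|p sp hp] := @liouville_poly R F 0 B' dF.
    by move=> t; rewrite expr0 mulr1.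
  by rewrite !hp [p](size1_polyC sp) !hornerC.
have G0 z : val (G z) = val (G 0).
  rewrite [LHS]surjective_pairing [RHS]surjective_pairing; congr (_, _).
    apply: (cst_of (gfst ^~ 1) (e^-1 * B)) => t.
      by apply: cdiff_gfst_h; rewrite oner_neq0.
    apply: le_trans (rho_fst_le _) _; apply: ler_wpM2l (hB t).
    by rewrite invr_ge0 ltW.
  apply: (cst_of (gsnd ^~ 1) (1 + B)) => t.
    by apply: cdiff_gsnd_h; rewrite oner_neq0.
  by apply: le_trans (rho_snd_le _) _; rewrite lerD2l; exact: hB.
have G0pos := rhoW_gt0 (G 0).
have [T [T1 hT]] := small _ (divr_gt0 G0pos (ltr0Sn R 1)).
have T0 : 0 <= T by apply: le_trans T1.
(* The first coordinate alone contributes T to the size of this point, and w = 1 makes the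
   inequality strict. *)
have := hT (toW ((e^-1 * T)%:C, 1)); rewrite toWK//.
have -> : T < rho e r ((e^-1 * T)%:C, 1).
  rewrite /rho /= normc_real normc1 expr1n ger0_norm ?mulr_ge0// ?invr_ge0 ?ltW//.
  by rewrite mulVKf ?gt_eqF// ltrDl.
move=> /(_ isT); rewrite -/(G _) G0 leNgt => /negP; apply.
by rewrite ltr_pdivrMr// ltr_pMr// ltr1n.
Qed.

Lemma liouville_growth (F : C -> C) (k d : nat) (M A : R) (N : C -> R) : 0 <= M ->
  (forall z, cdiff F z) -> (forall z, 0 <= N z) ->
  (forall z, normc (F z) <= M * (1 + N z) ^+ k) -> (forall z, 1 + N z <= A * (1 + normc z) ^+ d) ->
  exists2 p : {poly C}, (size p <= (d * k).+1)%N & forall z, F z = p.[z].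
Proof.
move=> M0 dF N0 FM NA; apply: (@liouville_poly R F (d * k) (M * A ^+ k) dF) => z.
apply: le_trans (FM z) _; rewrite -mulrA ler_wpM2l// exprM -exprMn.
have N1 : 0 <= 1 + N z by rewrite addr_ge0.
by apply: lerXn2r; rewrite ?nnegrE//; apply: le_trans (NA z).
Qed.

(** On each line [rho] grows with degree 1 in z and degree r in w, so Liouville's theorem applies.
    Interpolation in z needs a degree bound in that variable only, and k is independent of w. *)
Lemma commuting_separately_poly : g \o f = f \o g -> exists N : nat,
  [/\ forall w, w != 0 -> exists2 p : {poly C}, (size p <= N)%N & forall z, gfst z w = p.[z],
      forall w, w != 0 -> exists2 p : {poly C}, (size p <= N)%N & forall z, gsnd z w = p.[z],
      forall z, z != 0 -> exists p : {poly C}, forall w, gfst z w = p.[w] &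
      forall z, z != 0 -> exists p : {poly C}, forall w, gsnd z w = p.[w]].
Proof.
move=> gf; have [M [k [M0 hM]]] := commuting_growth (holomorphic_W_continuous holg) gf.
have rho0 x : 0 <= rho e r x.
  by rewrite addr_ge0 ?mulr_ge0 ?exprn_ge0 ?normc_ge0// ltW.
have E0 : 0 <= e^-1 * M by rewrite mulr_ge0// invr_ge0 ltW.
have b1 z w : (z, w) != 0 :> C2 -> normc (gfst z w) <= e^-1 * M * (1 + rho e r (z, w)) ^+ k.
  move=> zw; apply: le_trans (rho_fst_le _) _; rewrite -mulrA ler_wpM2l ?invr_ge0 ?(ltW e0)//.
  by have := hM (toW (z, w)); rewrite toWK.
have b2 z w : (z, w) != 0 :> C2 -> normc (gsnd z w) <= (1 + M) * (1 + rho e r (z, w)) ^+ k.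
  move=> zw; apply: le_trans (rho_snd_le _) _; rewrite mulrDl mul1r; apply: lerD.
    by apply: exprn_ege1; rewrite lerDl.
  by have := hM (toW (z, w)); rewrite toWK.
have hz w z : 1 + rho e r (z, w) <= (1 + e + normc w ^+ r) * (1 + normc z) ^+ 1.
  have nz := normc_ge0 z; have nw := exprn_ge0 r (normc_ge0 w).
  rewrite /rho /= expr1 -subr_ge0.
  have -> : (1 + e + normc w ^+ r) * (1 + normc z) - (1 + (e * normc z + normc w ^+ r)) =
    e + normc z + normc w ^+ r * normc z by ring.
  by rewrite !addr_ge0 ?mulr_ge0 ?(ltW e0).
have hw z w : 1 + rho e r (z, w) <= (2 + e * normc z) * (1 + normc w) ^+ r.
  have n1 : 1 <= (1 + normc w) ^+ r by apply: exprn_ege1; rewrite lerDl normc_ge0.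
  have ez : 0 <= e * normc z by rewrite mulr_ge0 ?normc_ge0 ?(ltW e0).
  have nw : normc w ^+ r <= (1 + normc w) ^+ r.
    by apply: lerXn2r; rewrite ?nnegrE ?addr_ge0 ?normc_ge0// lerDr.
  have h : e * normc z <= e * normc z * (1 + normc w) ^+ r by rewrite ler_peMr.
  rewrite /rho /= mulrDl mulr_natl mulr2n -!addrA; apply: lerD => //.
  by rewrite addrC; apply: lerD.
have n1 w z : w != 0 -> (z, w) != 0 :> C2 by move=> w0; rewrite pair_neq0 w0 orbT.
have n2 w z : z != 0 -> (z, w) != 0 :> C2 by move=> z0; rewrite pair_neq0 z0.
exists (1 * k).+1; split.
- move=> w w0; apply: (liouville_growth E0 _ _ (fun z => b1 z w (n1 w z w0)) (hz w)) => // z.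
  exact: cdiff_gfst_h.
- move=> w w0; apply: (liouville_growth _ _ _ (fun z => b2 z w (n1 w z w0)) (hz w)) => //.
    by rewrite addr_ge0.
  by move=> z; exact: cdiff_gsnd_h.
- move=> z z0.
  have [|//|p _ hp] := liouville_growth E0 _ _ (fun w => b1 z w (n2 w z z0)) (hw z).
    by move=> w; exact: cdiff_gfst_v.
  by exists p.
- move=> z z0.
  have [||//|p _ hp] := liouville_growth _ _ _ (fun w => b2 z w (n2 w z z0)) (hw z).
  + by rewrite addr_ge0.
  + by move=> w; exact: cdiff_gsnd_v.
  by exists p.
Qed.

End Lines.

End Growth.

(** * Polynomials in two variables *)

Section BivariatePolynomials.
Variable K : numFieldType.
Implicit Types (p q : {poly K}) (P Q : {poly {poly K}}).

(** The outer variable is z and the coefficients are polynomials in w, so the coefficient of z^n w^j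
    has indices n and j in this order. *)
Definition eval2 P (z w : K) : K := P.[z%:P].[w].

Lemma poly_eq_away0 p q : (forall z, z != 0 -> p.[z] = q.[z]) -> p = q.
Proof.
move=> pq; apply/eqP; rewrite -subr_eq0; apply/negPn/negP => d0.
pose s := [seq i.+1%:R : K | i <- iota 0 (size (p - q))].
have : (size s < size (p - q)%R)%N.
  apply: max_poly_roots d0 _ _.
    by apply/allP => _ /mapP[i _ ->]; rewrite /root hornerD hornerN pq ?subrr//.
  by rewrite map_inj_uniq ?iota_uniq// => i j /eqP; rewrite eqr_nat eqSS => /eqP.
by rewrite size_map size_iota ltnn.
Qed.

(** Lagrange interpolation in z at the nonzero nodes 1, 2, ..., with the polynomials h(i, w) as
    values, is exact for each nonzero w. The line w = 0 follows since, for fixed nonzero z, both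
    sides are polynomials in w that agree off 0. *)
Lemma separately_poly_eval2 (h : K -> K -> K) N :
  (forall w, w != 0 -> exists2 p : {poly K}, (size p <= N)%N & forall z, h z w = p.[z]) ->
  (forall z, z != 0 -> exists p : {poly K}, forall w, h z w = p.[w]) ->
  exists P, forall z w, (z != 0) || (w != 0) -> h z w = eval2 P z w.
Proof.
move=> hz hw; pose x i : K := i.+1%:R.
have xI : injective x by move=> i j /eqP; rewrite eqr_nat eqSS => /eqP.
have x0 i : x i != 0 by rewrite pnatr_eq0.
pose q i := xget 0 [set q : {poly K} | forall w, h (x i) w = q.[w]].
have hq i w : h (x i) w = (q i).[w].
  by have /(xgetPex 0) := hw _ (x0 i); apply.
pose P : {poly {poly K}} := \sum_(i < N.+1) (q i)%:P * map_poly polyC (tnth (lagrange N.+1 x) i).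
exists P => z w.
have E (t : K) : eval2 P z t = \sum_(i < N.+1) (q i).[t] * (tnth (lagrange N.+1 x) i : {poly K}).[z].
  rewrite /eval2 /P !horner_sum; apply: eq_bigr => i _.
  by rewrite hornerM hornerC horner_map hornerM hornerC.
have main (t : K) : t != 0 -> h z t = eval2 P z t.
  move=> t0; rewrite E; have [p sp hp] := hz t t0.
  rewrite hp {1}(@lagrange_gen K N.+1 x _ xI p) ?(leq_trans sp)// horner_sum.
  by apply: eq_bigr => i _; rewrite hornerM hornerC -hp hq.
have [w0|w0] := eqVneq w 0; last by move=> _; exact: main.
rewrite orbF => z0; have [p hp] := hw z z0.
rewrite hp /eval2; congr (_.[w]); apply: poly_eq_away0 => t t0.
by rewrite -hp main.
Qed.

Lemma scaled_coef p q (a b : K) : (forall w, w != 0 -> b * p.[a * w] = q.[w]) ->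
  forall j, b * a ^+ j * p`_j = q`_j.
Proof.
move=> pq j; have <- : \poly_(i < size p) (b * a ^+ i * p`_i) = q.
  apply: poly_eq_away0 => w w0; rewrite -pq// horner_poly horner_coef mulr_sumr.
  by apply: eq_bigr => i _; rewrite exprMn; ring.
rewrite coef_poly; case: ltnP => // sp.
by rewrite (nth_default _ sp) mulr0.
Qed.

Lemma size_affine_exp (a c : K) m : (size ((a *: 'X + c%:P) ^+ m)%R <= m.+1)%N.
Proof.
have h : (size (a *: 'X + c%:P)%R <= 2)%N.
  rewrite (leq_trans (size_polyD _ _))// geq_max (leq_trans (size_scale_leq _ _)) ?size_polyX//.
  by rewrite (leq_trans (size_polyC_leq1 _)).
apply: leq_trans (size_poly_exp_leq _ _) _; rewrite ltnS.
rewrite -[X in (_ <= X)%N]mul1n leq_mul2r; apply/orP; right.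
by move: h; case: size => [|[|[|]]].
Qed.

Lemma coef_affine_exp (a c : K) n : ((a *: 'X + c%:P) ^+ n)`_n = a ^+ n.
Proof.
elim: n => [|n IH]; first by rewrite !expr0 coef1.
rewrite exprS mulrDl coefD -scalerAl coefZ mul_polyC coefZ coefXM /= IH.
by rewrite [X in c * X]nth_default ?mulr0 ?addr0 -?exprS// size_affine_exp.
Qed.

(** The translation by [c] disturbs only the coefficients below the top one; this is what survives
    of the eigenvalue equation when kap is nonzero. *)
Lemma affine_top_coef p q (a c : K) n : (forall z, p.[a * z + c] = q.[z]) ->
  (size p <= n.+1)%N -> a ^+ n * p`_n = q`_n.
Proof.
move=> pq sp; have <- : p \Po (a *: 'X + c%:P) = q.
  by apply: poly_eq_away0 => z _; rewrite horner_comp !hornerE pq.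
have sz m : (m < n)%N -> ((a *: 'X + c%:P) ^+ m)`_n = 0.
  by move=> mn; apply: nth_default; apply: leq_trans mn; exact: size_affine_exp.
have -> : p \Po (a *: 'X + c%:P) = \sum_(i < n.+1) p`_i *: (a *: 'X + c%:P) ^+ i.
  rewrite comp_polyE (big_ord_widen _ (fun i => p`_i *: (a *: 'X + c%:P) ^+ i) sp).
  rewrite big_mkcond; apply: eq_bigr => i _; case: ltnP => // pi.
  by rewrite nth_default ?scale0r.
rewrite coef_sum big_ord_recr /= big1 ?add0r.
  by rewrite coefZ coef_affine_exp mulrC.
by move=> i _; rewrite coefZ sz ?mulr0.
Qed.

Definition slice P (w : K) : {poly K} := map_poly (horner_eval w) P.

Lemma horner_slice P z w : (slice P w).[z] = eval2 P z w.
Proof.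
rewrite /slice /eval2 -[P.[_].[w]]/(horner_eval w P.[z%:P]) -horner_map /=.
by rewrite /horner_eval hornerC.
Qed.

Lemma coef_slice P w n : (slice P w)`_n = (P`_n).[w].
Proof. by rewrite coef_map. Qed.

Lemma size_slice P w : (size (slice P w) <= size P)%N.
Proof. exact: size_poly. Qed.

Lemma eval2_linear P r : (0 < r)%N ->
  (forall n j, P`_n`_j != 0 -> (n, j) = (1, 0)%N \/ (n, j) = (0, r)%N) ->
  forall z w, eval2 P z w = P`_1`_0 * z + P`_0`_r * w ^+ r.
Proof.
move=> r0 supp z w.
have P1 : P`_1 = (P`_1`_0)%:P.
  apply/polyP => j; rewrite coefC; case: eqP => [->//|j0].
  by apply/eqP/negPn/negP => /supp[[/j0]|[]].
have P0 : P`_0 = P`_0`_r *: 'X^r.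
  apply/polyP => j; rewrite coefZ coefXn; case: eqP => [->|jr]; first by rewrite mulr1.
  by rewrite mulr0; apply/eqP/negPn/negP => /supp[[]|[/jr]].
have Pn n : (1 < n)%N -> P`_n = 0.
  move=> n1; apply/polyP => j; rewrite coef0.
  by apply/eqP/negPn/negP => /supp[[n1' _]|[n0 _]]; rewrite ?n1' ?n0 in n1.
have -> : eval2 P z w = ((P`_1`_0) *: 'X + (P`_0`_r * w ^+ r)%:P).[z].
  rewrite -horner_slice; congr (_.[z]); apply/polyP => -[|[|n]]; rewrite coef_slice.
  - by rewrite coefD coefZ coefX mulr0 add0r coefC /= P0 hornerZ hornerXn coefZ coefXn eqxx mulr1.
  - by rewrite coefD coefZ coefX mulr1 coefC /= addr0 P1 hornerC coefC.
  - by rewrite coefD coefZ coefX mulr0 coefC /= addr0 Pn// horner0.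
by rewrite hornerD hornerZ hornerX hornerC.
Qed.

End BivariatePolynomials.

(** * Comparison of coefficients in the commutation relation *)

Section CommutingPolynomials.
Variables (K : numFieldType) (P Q : {poly {poly K}}) (mu kap de : K) (r : nat).
Hypotheses (r0 : (0 < r)%N) (de_inj : injective (GRing.exp de)).
Hypothesis EQ : forall z w, w != 0 ->
  eval2 Q (mu * z + kap * w ^+ r) (de * w) = de * eval2 Q z w.
Hypothesis EP : forall z w, w != 0 ->
  eval2 P (mu * z + kap * w ^+ r) (de * w) = mu * eval2 P z w + kap * eval2 Q z w ^+ r.

(** Composition with f multiplies z^n w^j by mu^n de^j up to lower powers of z. These are absent if
    kap = 0, and do not affect the top power of z otherwise. *)
Lemma commuting_coefQ n j : (kap == 0) || (size Q <= n.+1)%N ->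
  mu ^+ n * de ^+ j * Q`_n`_j = de * Q`_n`_j.
Proof.
move=> hn; rewrite -[RHS]coefZ; apply: scaled_coef => w w0; rewrite hornerZ -!coef_slice -[RHS]coefZ.
have E z : (slice Q (de * w)).[mu * z + kap * w ^+ r] = (de *: slice Q w).[z].
  by rewrite hornerZ !horner_slice EQ.
case/orP: hn => [/eqP k0|sQ].
  rewrite -[mu ^+ n]mul1r; apply: scaled_coef => z _.
  by rewrite mul1r -E k0 mul0r addr0.
by apply: (affine_top_coef E); apply: leq_trans sQ; exact: size_slice.
Qed.

(** Once Q = d w, the extra term kap (d w)^r is free of z, hence invisible to the coefficients with
    n > 0. *)
Lemma commuting_coefP n j : (kap == 0) || (size P <= n.+1)%N ->
  kap = 0 \/ (0 < n)%N /\ (exists d, forall z w, w != 0 -> eval2 Q z w = d * w) ->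
  mu ^+ n * de ^+ j * P`_n`_j = mu * P`_n`_j.
Proof.
move=> hn hQ; rewrite -[RHS]coefZ; apply: scaled_coef => w w0; rewrite hornerZ -!coef_slice -[RHS]coefZ.
have [k0|[n0 [d Qd]]] := hQ.
  rewrite -[mu ^+ n]mul1r; apply: scaled_coef => z _.
  rewrite mul1r hornerZ !horner_slice.
  by have := EP z w0; rewrite k0 !mul0r !addr0.
have E z : (slice P (de * w)).[mu * z + kap * w ^+ r] =
    (mu *: slice P w + (kap * (d * w) ^+ r)%:P).[z].
  by rewrite hornerD hornerC hornerZ !horner_slice EP// Qd.
have -> : (mu *: slice P w)`_n = (mu *: slice P w + (kap * (d * w) ^+ r)%:P)`_n.
  by rewrite coefD coefC (gtn_eqF n0) addr0.
case/orP: hn => [/eqP k0|sP].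
  rewrite -[mu ^+ n]mul1r; apply: scaled_coef => z _.
  by rewrite mul1r -E k0 mul0r addr0.
by apply: (affine_top_coef E); apply: leq_trans sP; exact: size_slice.
Qed.

Arguments commuting_coefQ n j : clear implicits.
Arguments commuting_coefP n j : clear implicits.

Lemma eigen_coef (a b x : K) : a * x = b * x -> x != 0 -> a = b.
Proof. by move=> /eqP + x0; rewrite (inj_eq (mulIf x0)) => /eqP. Qed.

Lemma resonant_exp n j : mu = de ^+ r -> mu ^+ n * de ^+ j = de ^+ (r * n + j).
Proof. by move=> ->; rewrite -exprM -exprD. Qed.

Lemma commuting_nonresonant : kap = 0 ->
  (forall n j, mu ^+ n * de ^+ j = mu -> (n, j) = (1, 0)%N) ->
  (forall n j, mu ^+ n * de ^+ j = de -> (n, j) = (0, 1)%N) ->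
  exists a d, forall z w, eval2 P z w = a * z /\ eval2 Q z w = d * w.
Proof.
move=> k0 hmu hde; exists P`_1`_0, Q`_0`_1 => z w.
have sP n j : P`_n`_j != 0 -> (n, j) = (1, 0)%N.
  by move=> nz; apply: hmu; apply: eigen_coef nz; apply: commuting_coefP; [rewrite k0 eqxx|left].
have sQ n j : Q`_n`_j != 0 -> (n, j) = (0, 1)%N.
  by move=> nz; apply: hde; apply: eigen_coef nz; apply: commuting_coefQ; rewrite k0 eqxx.
split; rewrite (eval2_linear (ltn0Sn 0)).
- have -> : P`_0`_1 = 0; last by rewrite mul0r addr0.
  by apply/eqP/negPn/negP => /sP.
- by move=> n j /sP; left.
- have -> : Q`_1`_0 = 0; last by rewrite mul0r add0r expr1.
  by apply/eqP/negPn/negP => /sQ.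
- by move=> n j /sQ; right.
Qed.

Lemma commuting_resonantP : kap = 0 -> mu = de ^+ r ->
  exists a b, forall z w, eval2 P z w = a * z + b * w ^+ r.
Proof.
move=> k0 mude; exists P`_1`_0, P`_0`_r => z w; apply: eval2_linear => // n j nz.
have : mu ^+ n * de ^+ j = mu.
  by apply: eigen_coef nz; apply: commuting_coefP; [rewrite k0 eqxx|left].
rewrite resonant_exp// mude => /de_inj.
case: n {nz} => [|[|n]]; rewrite ?muln0 ?muln1 ?add0n; first by right; congr (_, _).
  by left; congr (_, _); lia.
nia.
Qed.

(** The resonance says r n + j = 1, since the powers of [de] are distinct. *)
Lemma resonantQ_support n j : mu = de ^+ r -> mu ^+ n * de ^+ j = de ->
  (n, j) = (0, 1)%N \/ [/\ n = 1%N, j = 0%N & r = 1%N].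
Proof.
move=> mude; rewrite resonant_exp// -[X in _ = X]expr1 => /de_inj.
case: n => [|[|n]]; rewrite ?muln0 ?muln1 ?add0n; first by move->; left.
  by right; split => //; lia.
nia.
Qed.

Lemma commuting_resonantQ : kap = 0 -> mu = de ^+ r ->
  exists c d, forall z w, eval2 Q z w = c * z + d * w /\ ((1 < r)%N -> c = 0).
Proof.
move=> k0 mude; exists Q`_1`_0, Q`_0`_1 => z w.
have supp n j : Q`_n`_j != 0 -> mu ^+ n * de ^+ j = de.
  by apply: eigen_coef; apply: commuting_coefQ; rewrite k0 eqxx.
split.
  rewrite (eval2_linear (ltn0Sn 0)) ?expr1// => n j /supp /(resonantQ_support mude).
  by case=> [->|[-> -> _]]; [right|left].
move=> r1; apply/eqP/negPn/negP => /supp /(resonantQ_support mude)[//|[_ _ r1']].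
by rewrite r1' in r1.
Qed.

(** Only top coefficients are controlled directly, so the degree in z is bounded first: Q is reduced
    to d w, and then P to degree at most 1. The part of P free of z is compared last, and its
    resonant term ties the coefficient of z to d^r. *)
Lemma commuting_jordan : kap != 0 -> mu = de ^+ r ->
  exists a b, forall z w, eval2 P z w = a ^+ r * z + b * w ^+ r /\ eval2 Q z w = a * w.
Proof.
move=> k0 mude.
have [d Qd] : exists d, forall z w, eval2 Q z w = d * w.
  have sQ2 : (size Q <= 2)%N.
    rewrite leqNgt; apply/negP => sQ.
    have : lead_coef Q != 0 by rewrite lead_coef_eq0; apply: contraTneq sQ => ->; rewrite size_poly0.
    rewrite lead_coefE; set n := (size Q).-1 => Qn.
    have [j nz] : exists j, Q`_n`_j != 0.
      by exists (size Q`_n).-1; rewrite -lead_coefE lead_coef_eq0.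
    have nE : n.+1 = size Q by rewrite /n prednK// ltnW// ltnW.
    have := eigen_coef (commuting_coefQ n j _) nz; rewrite nE leqnn orbT => /(_ isT).
    move/(resonantQ_support mude) => [[n0 _]|[n1 _ _]].
      by rewrite -nE n0 in sQ.
    by rewrite -nE n1 in sQ.
  have Q1 j : j != 0%N -> Q`_1`_j = 0.
    move=> j0; apply/eqP/negPn/negP => nz.
    have := eigen_coef (commuting_coefQ 1 j _) nz; rewrite sQ2 orbT => /(_ isT).
    by move/(resonantQ_support mude) => [//|[_ jE _]]; rewrite jE in j0.
  (* A term in z resonates only for r = 1. At z = 0 the shift then adds kap times its coefficient to
     the coefficient of w, where the diagonal contributions cancel. *)
  have Q10 : Q`_1`_0 = 0.
    apply/eqP/negPn/negP => nz.
    have := eigen_coef (commuting_coefQ 1 0 _) nz; rewrite sQ2 orbT => /(_ isT).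
    move/(resonantQ_support mude) => [//|[_ _ r1]].
    have Qzw z w : eval2 Q z w = Q`_1`_0 * z + (Q`_0).[w].
      rewrite -horner_slice (@horner_coef_wide _ 2); last exact: leq_trans (size_slice _ _) sQ2.
      rewrite big_ord_recl big_ord1 /= !coef_slice expr0 mulr1 expr1 addrC; congr (_ * _ + _).
      have -> : Q`_1 = (Q`_1`_0)%:P; last by rewrite hornerC coefC.
      by apply/polyP => j; rewrite coefC; case: eqP => [->//|/eqP /Q1].
    have E : forall w, w != 0 -> 1 * (Q`_0).[de * w] = (de *: Q`_0 - (Q`_1`_0 * kap) *: 'X).[w].
      move=> w w0; have := EQ 0 w0; rewrite !Qzw mulr0 !add0r r1 expr1 mul1r => h.
      rewrite hornerD hornerN !hornerZ hornerX.
      have -> : (Q`_0).[de * w] = de * (Q`_1`_0 * 0 + (Q`_0).[w]) - Q`_1`_0 * (kap * w).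
        by rewrite -h addrC addKr.
      by rewrite mulr0 add0r mulrA.
    have := scaled_coef E 1; rewrite mul1r expr1 coefB !coefZ coefX mulr1 => /eqP.
    rewrite -[X in X == _]addr0 (inj_eq (addrI _)) eq_sym oppr_eq0 mulf_eq0 (negbTE k0) orbF.
    exact/negP.
  have sQ1 : (size Q <= 1)%N.
    apply/leq_sizeP => -[//|[|n]] _; last by apply: nth_default; exact: leq_trans sQ2 _.
    apply/polyP => j; rewrite coef0; have [->//|j0] := eqVneq j 0%N; exact: Q1.
  exists Q`_0`_1 => z w; rewrite (eval2_linear (ltn0Sn 0)).
    by rewrite Q10 mul0r add0r expr1.
  move=> [|n] j nz; last by rewrite (nth_default _ (leq_trans sQ1 _)) ?coef0 ?eqxx in nz.
  have := eigen_coef (commuting_coefQ 0 j _) nz; rewrite sQ1 orbT => /(_ isT).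
  by move/(resonantQ_support mude) => [->|[]//]; right.
have hQ n : (0 < n)%N -> kap = 0 \/ (0 < n)%N /\ (exists d, forall z w, w != 0 -> eval2 Q z w = d * w).
  by move=> n0; right; split=> //; exists d => z w _; exact: Qd.
have suppP n j : (0 < n)%N -> (size P <= n.+1)%N -> P`_n`_j != 0 -> (n, j) = (1, 0)%N.
  move=> n0 sP nz.
  have := eigen_coef (commuting_coefP n j _ (hQ n n0)) nz; rewrite sP orbT => /(_ isT).
  rewrite resonant_exp// mude => /de_inj.
  case: n n0 {sP nz} => [//|[|n]] _; rewrite ?muln1; first by move=> h; congr (_, _); lia.
  nia.
have sP2 : (size P <= 2)%N.
  rewrite leqNgt; apply/negP => sP.
  have : lead_coef P != 0 by rewrite lead_coef_eq0; apply: contraTneq sP => ->; rewrite size_poly0.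
  rewrite lead_coefE; set n := (size P).-1 => Pn.
  have nE : n.+1 = size P by rewrite /n prednK// ltnW// ltnW.
  have n1 : (1 < n)%N by rewrite -ltnS nE.
  have := suppP n (size P`_n).-1 (ltnW n1).
  rewrite -lead_coefE lead_coef_eq0 nE leqnn => /(_ isT Pn) [nE1 _].
  by rewrite nE1 in n1.
have P1 : P`_1 = (P`_1`_0)%:P.
  apply/polyP => j; rewrite coefC; case: eqP => [->//|j0].
  by apply/eqP/negPn/negP => /(suppP 1%N j isT sP2)[/j0].
have Pzw z w : eval2 P z w = P`_1`_0 * z + (P`_0).[w].
  rewrite -horner_slice (@horner_coef_wide _ 2); last exact: leq_trans (size_slice _ _) sP2.
  by rewrite big_ord_recl big_ord1 /= !coef_slice expr0 mulr1 expr1 addrC {1}P1 hornerC.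
have E : forall w, w != 0 -> 1 * (P`_0).[de * w] =
    (mu *: P`_0 + (kap * (d ^+ r - P`_1`_0)) *: 'X^r).[w].
  move=> w w0; have := EP 0 w0; rewrite !Pzw !Qd mulr0 !add0r mul1r => h.
  rewrite hornerD !hornerZ hornerXn.
  have -> : (P`_0).[de * w] = mu * (P`_1`_0 * 0 + (P`_0).[w]) + kap * (d * w) ^+ r - P`_1`_0 * (kap * w ^+ r).
    by rewrite -h addrC addKr.
  by rewrite exprMn; ring.
have Ec j := scaled_coef E j.
(* The coefficient of w^r is resonant: its diagonal contributions on both sides cancel, leaving kap
   times the difference of the two quantities. *)
have dr : P`_1`_0 = d ^+ r.
  have := Ec r; rewrite mul1r coefD !coefZ coefXn eqxx mulr1 -mude => /eqP.
  rewrite -[X in X == _]addr0 (inj_eq (addrI _)) eq_sym mulf_eq0 (negbTE k0) /= subr_eq0.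
  by move/eqP.
have P0 : P`_0 = P`_0`_r *: 'X^r.
  apply/polyP => j; rewrite coefZ coefXn; case: eqP => [->|jr]; first by rewrite mulr1.
  rewrite mulr0; have := Ec j; rewrite mul1r coefD !coefZ coefXn.
  case: eqP => // _; rewrite mulr0 addr0 mude => h.
  by apply/eqP/negPn/negP => nz; apply: jr; apply: de_inj; exact: eigen_coef h nz.
exists d, P`_0`_r => z w; split; last exact: Qd.
by rewrite Pzw dr P0 hornerZ hornerXn coefZ coefXn eqxx mulr1.
Qed.

End CommutingPolynomials.

(** * The centralizers in each class of contractions *)

Section Classification.
Variable R : realType.
Local Notation C := R[i].
Local Notation W := (W R).
Local Notation C2 := (C2 R).

Section Commuting.
Variables (f g : W -> W) (mu kap de : C) (r : nat).
Hypotheses (mu01 : 0 < normc mu < 1) (de01 : 0 < normc de < 1) (r0 : (0 < r)%N).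
Hypotheses (fE : given_by f (lowerF mu kap r de)).
Hypotheses (holg : @holomorphic R (Defs.W R) (Defs.W R) g) (gf : g \o f = f \o g).

Lemma exp_contraction_inj : injective (GRing.exp de).
Proof.
case/andP: de01 => d0 d1 m n /(congr1 (@normc R)); rewrite !normcX.
by apply: ieexprIn; rewrite // lt_eqF.
Qed.

Lemma contraction_neq0 (a : C) : 0 < normc a < 1 -> a != 0.
Proof. by rewrite -normc_gt0 => /andP[]. Qed.

(** Requiring w nonzero keeps the point off the origin, and still leaves enough points to compare
    coefficients. *)
Lemma centralizer_eval2 : exists P Q : {poly {poly C}},
  [/\ forall p, val (g p) = (eval2 P (val p).1 (val p).2, eval2 Q (val p).1 (val p).2),
   forall z w, w != 0 -> eval2 Q (mu * z + kap * w ^+ r) (de * w) = de * eval2 Q z w &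
   forall z w, w != 0 -> eval2 P (mu * z + kap * w ^+ r) (de * w) =
     mu * eval2 P z w + kap * eval2 Q z w ^+ r].
Proof.
have mu0 := contraction_neq0 mu01; have de0 := contraction_neq0 de01.
have [e [lam [L [e0 lam01 L1 flam fL]]]] := lower_rho_contracts mu01 de01 r0 fE.
have [fK Kf] := lowerK mu0 de0 r0 fE.
have [N [h1 h2 h3 h4]] := commuting_separately_poly e0 r0 lam01 L1 fK Kf flam fL holg gf.
have [P hP] := separately_poly_eval2 h1 h3.
have [Q hQ] := separately_poly_eval2 h2 h4.
have gE p : val (g p) = (eval2 P (val p).1 (val p).2, eval2 Q (val p).1 (val p).2).
  have p0 := val_neq0 p; rewrite pair_neq0 in p0.
  by rewrite -hP// -hQ// /gfst /gsnd -!surjective_pairing valWK.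
have key z w : w != 0 -> lowerF mu kap r de (eval2 P z w) (eval2 Q z w) =
    (eval2 P (mu * z + kap * w ^+ r) (de * w), eval2 Q (mu * z + kap * w ^+ r) (de * w)).
  move=> w0; pose p : W := toW (z, w).
  have pE : val p = (z, w) by rewrite toWK// pair_neq0 w0 orbT.
  by have := congr1 val (congr1 (@^~ p) gf); rewrite /= gE !fE gE pE => <-.
by exists P, Q; split => // z w w0; have := key z w w0; rewrite /lowerF => -[].
Qed.

End Commuting.

Lemma lower_coef_neq0 (g : W -> W) a b r d : (0 < r)%N -> given_by g (lowerF a b r d) ->
  a != 0 /\ d != 0.
Proof.
move=> r0 gE.
have a0 : a != 0.
  apply: contraTneq (val_neq0 (g (toW (1, 0)))) => a0.
  rewrite gE toWK ?pair_neq0 ?oner_neq0// /lowerF /= a0 mul0r expr0n (gtn_eqF r0) !mulr0 addr0.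
  by rewrite eqxx.
(* At this point the first coordinate a z + b w^r vanishes, so d = 0 would send it to the origin. *)
split => //; apply: contraTneq (val_neq0 (g (toW (- (b / a), 1)))) => d0.
rewrite gE toWK ?pair_neq0 /= ?oner_neq0 ?orbT// /lowerF /= d0 mul0r expr1n mulr1.
by rewrite mulrN mulrC divfK// addNr eqxx.
Qed.

Lemma conjcD (z w : C) : conjc (z + w) = conjc z + conjc w.
Proof. exact: rmorphD. Qed.

Lemma conjcM (z w : C) : conjc (z * w) = conjc z * conjc w.
Proof. exact: rmorphM. Qed.

Lemma conjcX (z : C) n : conjc (z ^+ n) = conjc z ^+ n.
Proof. exact: rmorphXn. Qed.

Lemma conj_fixed_real (z : C) : conjc z = z -> z = (complex.Re z)%:C.
Proof.
case: z => a b [] bE; congr (_ +i* _); apply/eqP.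
by rewrite -[_ == 0](@mulrn_eq0 _ b 2) mulr2n -{1}bE addNr.
Qed.

Lemma c_given_by : given_by (@c R) (fun z w => (conjc z, conjc w)). Proof. by []. Qed.
Lemma c'_given_by : given_by (@c' R) (fun z w => (conjc w, conjc z)). Proof. by []. Qed.

(** Real points are the fixed points of [c], and [g] permutes them; evaluated at (1, 0) and (0, 1)
    this makes the coefficients real. *)
Lemma commute_c_real (g : W -> W) (F : C -> C -> C * C) (z w : C) : given_by g F ->
  g \o @c R = @c R \o g -> (z != 0) || (w != 0) -> conjc z = z -> conjc w = w ->
  (F z w).1 = (complex.Re (F z w).1)%:C /\ (F z w).2 = (complex.Re (F z w).2)%:C.
Proof.
move=> gE gc zw0 zR wR.
have x0 : ((z, w) : C2) != 0 by rewrite pair_neq0.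
have xc : c (toW (z, w)) = toW (z, w) by apply: W_inj; rewrite c_given_by toWK//= zR wR.
have : val (g (c (toW (z, w)))) = val (c (g (toW (z, w)))) by rewrite (commutingE _ gc).
rewrite xc c_given_by gE toWK//=.
by case: (F _ _) => u v /= [] h1 h2; split; apply: conj_fixed_real.
Qed.

Lemma given_by_comp (g h : W -> W) F G : given_by g F -> given_by h G ->
  given_by (g \o h) (fun z w => F (G z w).1 (G z w).2).
Proof. by move=> gF hG p; rewrite /= gF hG. Qed.

Lemma given_by_commute (g h : W -> W) F G : given_by g F -> given_by h G ->
  (forall z w, F (G z w).1 (G z w).2 = G (F z w).1 (F z w).2) -> g \o h = h \o g.
Proof.
move=> gF hG FG; apply/funext => p; apply: W_inj.
by rewrite (given_by_comp gF hG) (given_by_comp hG gF) FG.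
Qed.

Lemma eq_given_by (g : W -> W) F G : (forall z w, F z w = G z w) -> given_by g F -> given_by g G.
Proof. by move=> FG gF p; rewrite gF FG. Qed.

Lemma real_eval2_conj (P : {poly {poly R}}) (z w : C) :
  real_poly_eval P (conjc z) (conjc w) = conjc (real_poly_eval P z w).
Proof.
rewrite /real_poly_eval; set PC := map_poly _ P.
have PCE : PC = map_poly (map_poly conjc) PC.
  rewrite /PC -map_poly_comp; apply: eq_map_poly => q /=.
  rewrite -map_poly_comp; apply: eq_map_poly => t /=.
  by rewrite oppr0.
rewrite {1}PCE -horner_map; congr (_.[_]).
by rewrite -horner_map /= map_polyC.
Qed.

Lemma real_coefficients_commute_c (f : W -> W) : real_coefficients f -> f \o @c R = @c R \o f.
Proof.
move=> [P [Q fE]]; apply: (given_by_commute fE c_given_by) => z w /=.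
by rewrite !real_eval2_conj.
Qed.

Lemma norm_contraction (a : C) : 0 < `|a| < 1 -> 0 < normc a < 1.
Proof. by rewrite normcR -[1 in X in X -> _]/(1%:C) !ltcR. Qed.

Definition linF (a b c d z w : C) : C * C := (a * z + b * w, c * z + d * w).

Lemma linear_det_neq0 (g : W -> W) a b c d : given_by g (linF a b c d) -> a * d - b * c != 0.
Proof.
move=> gE; apply/negP => /eqP det0.
have ker (x : C2) : x != 0 -> linF a b c d x.1 x.2 <> (0, 0).
  by move=> x0 Fx; have := val_neq0 (g (toW x)); rewrite gE toWK// Fx eqxx.
(* If the determinant is zero, (b, -a) and (d, -c) lie in the kernel; if b = d = 0 as well, (0, 1)
   does. *)
have [b0|b0] := eqVneq b 0; last first.
  apply: (ker (b, - a)); first by rewrite pair_neq0 b0.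
  by congr (_, _) => /=; [ring|rewrite -[RHS]oppr0 -det0; ring].
have [d0|d0] := eqVneq d 0; last first.
  apply: (ker (d, - c)); first by rewrite pair_neq0 d0.
  by congr (_, _) => /=; [rewrite -det0; ring|ring].
by apply: (ker (0, 1)); rewrite ?pair_neq0 ?oner_neq0 ?orbT// /linF /= b0 d0 !mulr0 !mul0r addr0.
Qed.

Lemma linF_differentiable a b c d (x : C2) :
  differentiable (fun y : C2 => linF a b c d y.1 y.2 : C2) x.
Proof.
pose Co : normedModType C := C^o.
have dM (k : C) (u : C2 -> Co) : differentiable u x -> differentiable (fun y => k * u y : Co) x.
  by move=> du; apply: (@differentiableM _ C2 (cst k)) => //; exact: differentiable_cst.
have d1 := differentiable_fst x; have d2 := differentiable_snd x.
apply: (@differentiable_pair _ C2 Co Co (fun y => a * y.1 + b * y.2) (fun y => c * y.1 + d * y.2)).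
  by apply: differentiableD; apply: dM.
by apply: differentiableD; apply: dM.
Qed.

Lemma linear_Aut (g : W -> W) a b c d : a * d - b * c != 0 -> given_by g (linF a b c d) ->
  Aut_h (Defs.W R) g.
Proof.
set D := _ - _ => D0 gE.
have hol h a' b' c' d' : given_by h (linF a' b' c' d') ->
    @holomorphic R (Defs.W R) (Defs.W R) h.
  by move/given_by_holomorphic; apply => p; exact: linF_differentiable.
pose G (z w : C) : C2 := linF (d / D) (- (b / D)) (- (c / D)) (a / D) z w.
have FG z w : linF a b c d (G z w).1 (G z w).2 = (z, w).
  by rewrite /G /linF /=; congr (_, _); rewrite /D; field.
have GF z w : G (linF a b c d z w).1 (linF a b c d z w).2 = (z, w).
  by rewrite /G /linF /=; congr (_, _); rewrite /D; field.
pose h (p : W) : W := toW (G (val p).1 (val p).2).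
have hE : given_by h G.
  move=> p; rewrite toWK//; apply/negP => /eqP G0.
  have := FG (val p).1 (val p).2; rewrite G0 /linF /= !mulr0 addr0 -surjective_pairing.
  by move/esym/eqP; apply/negP; exact: val_neq0.
split; first exact: hol gE.
exists h; split; first exact: hol hE.
  by move=> p; apply: W_inj; rewrite hE gE GF -surjective_pairing.
by move=> p; apply: W_inj; rewrite gE hE FG -surjective_pairing.
Qed.

Lemma det_mx22 (A : 'M[R]_2) : \det A = A 0 0 * A 1 1 - A 0 1 * A 1 0.
Proof.
rewrite (expand_det_row _ 0) big_ord_recl big_ord1 /cofactor !det_mx11 !mxE /=.
have -> : lift 0 0 = 1 :> 'I_2 by apply: val_inj.
have -> : lift 1 0 = 0 :> 'I_2 by apply: val_inj.
by rewrite /bump /= addn0 expr0 mul1r expr1 mulN1r mulrN.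
Qed.

(** The resonant diagonal case with r = 1, the only one in which z may enter the second
    coordinate. *)
Lemma centralizer_IV (f : W -> W) : IV f -> Aut_h_W f (@c R) =
  [set g | exists2 A : 'M[R]_2, A \in unitmx &
    given_by g (fun z w => ((A 0 0)%:C * z + (A 0 1)%:C * w,
                            (A 1 0)%:C * z + (A 1 1)%:C * w))].
Proof.
move=> [alpha [/norm_contraction al fE]].
have fE' : given_by f (lowerF alpha 0 1 alpha).
  by apply: eq_given_by fE => z w; rewrite /lowerF mul0r addr0.
have det_unit (A : 'M[R]_2) : (A \in unitmx) =
    ((A 0 0)%:C * (A 1 1)%:C - (A 0 1)%:C * (A 1 0)%:C != 0 :> C).
  by rewrite unitmxE unitfE det_mx22 -!rmorphM -rmorphB fmorph_eq0.
apply/seteqP; split => g.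
  move=> [[hg _] gf gc].
  have [P [Q [gE EQ EP]]] := centralizer_eval2 al al (ltn0Sn 0) fE' hg gf.
  have inj := exp_contraction_inj al.
  have [a [b Pab]] := commuting_resonantP (ltn0Sn 0) inj EP erefl erefl.
  have [c' [d Qcd]] := commuting_resonantQ (ltn0Sn 0) inj EQ erefl erefl.
  have {}gE : given_by g (linF a b c' d).
    by move=> p; rewrite gE Pab (Qcd _ _).1.
  have nz1 : (1 : C) != 0 by exact: oner_neq0.
  have := @commute_c_real g _ 1 0 gE gc (introT orP (or_introl nz1)) (conjc1 R) (conjc0 R).
  rewrite /linF /= !mulr0 !mulr1 !addr0 => -[aR cR].
  have := @commute_c_real g _ 0 1 gE gc (introT orP (or_intror nz1)) (conjc0 R) (conjc1 R).
  rewrite /linF /= !mulr0 !mulr1 !add0r => -[bR dR].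
  pose A : 'M[R]_2 := \matrix_(i, j) complex.Re
    (if i == 0 then if j == 0 then a else b else if j == 0 then c' else d).
  have D0 := linear_det_neq0 gE.
  exists A; last by rewrite !mxE /= -aR -bR -cR -dR.
  by rewrite det_unit !mxE /= -aR -bR -cR -dR.
move=> [A]; rewrite det_unit => Au gE; split.
- exact: linear_Aut Au gE.
- by apply: (given_by_commute gE fE) => z w /=; congr (_, _); ring.
- apply: (given_by_commute gE c_given_by) => z w /=.
  by rewrite !conjcD !conjcM !conjc_real.
Qed.

Lemma Aut_lower_real (f g : W -> W) (a b d : R) r : (0 < r)%N -> a != 0 -> d != 0 ->
  given_by g (lowerF a%:C b%:C r d%:C) -> g \o f = f \o g -> Aut_h_W f (@c R) g.
Proof.
move=> r0 a0 d0 gE gf; split=> //.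
  by apply: lower_Aut gE; rewrite ?fmorph_eq0.
apply: (given_by_commute gE c_given_by) => z w /=.
by rewrite /lowerF !conjcD !conjcM conjcX !conjc_real.
Qed.

Lemma lower_real_coef (g : W -> W) a b r d : (0 < r)%N -> given_by g (lowerF a b r d) ->
  g \o @c R = @c R \o g ->
  [/\ a = (complex.Re a)%:C, b = (complex.Re b)%:C & d = (complex.Re d)%:C].
Proof.
move=> r0 gE gc; have nz1 : (1 : C) != 0 by exact: oner_neq0.
have := @commute_c_real g _ 1 0 gE gc (introT orP (or_introl nz1)) (conjc1 R) (conjc0 R).
rewrite /lowerF /= expr0n (gtn_eqF r0) !mulr0 mulr1 addr0 => -[aR _].
have := @commute_c_real g _ 0 1 gE gc (introT orP (or_intror nz1)) (conjc0 R) (conjc1 R).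
by rewrite /lowerF /= expr1n mulr0 !mulr1 add0r => -[bR dR].
Qed.

Lemma centralizer_III (f : W -> W) r : III r f -> Aut_h_W f (@c R) =
  [set g | exists a b d : R, [/\ a != 0, d != 0 &
    given_by g (fun z w => (a%:C * z + b%:C * w ^+ r, d%:C * w))]].
Proof.
move=> [r2 [de [/norm_contraction de01 fE]]]; have r0 : (0 < r)%N := ltnW r2.
have fE' : given_by f (lowerF (de ^+ r) 0 r de).
  by apply: eq_given_by fE => z w; rewrite /lowerF mul0r addr0.
have mu01 : 0 < normc (de ^+ r) < 1.
  case/andP: de01 => d0 d1; rewrite normcX exprn_gt0//=.
  by rewrite exprn_ilt1 ?normc_ge0// -lt0n.
apply/seteqP; split => g.
  move=> [[hg _] gf gc].
  have [P [Q [gE EQ EP]]] := centralizer_eval2 mu01 de01 r0 fE' hg gf.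
  have inj := exp_contraction_inj de01.
  have [a [b Pab]] := commuting_resonantP r0 inj EP erefl erefl.
  have [c' [d Qcd]] := commuting_resonantQ r0 inj EQ erefl erefl.
  have {}gE : given_by g (lowerF a b r d).
    move=> p; rewrite gE Pab (Qcd _ _).1 /lowerF.
    by rewrite ((Qcd 0 0).2 r2) mul0r add0r.
  have [a0 d0] := lower_coef_neq0 r0 gE.
  have [aR bR dR] := lower_real_coef r0 gE gc.
  exists (complex.Re a), (complex.Re b), (complex.Re d).
  by split; rewrite -?aR -?bR -?dR// -(inj_eq (@complexI R)) -?aR -?dR.
move=> [a [b [d [a0 d0 gE]]]].
apply: (Aut_lower_real r0 a0 d0 gE); apply: (given_by_commute gE fE) => z w /=.
by rewrite exprMn; congr (_, _); ring.
Qed.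

(** With kap = 1 this serves both II_a and II_b, the latter being the case r = 1. *)
Lemma centralizer_jordan (f : W -> W) r de (kap : R) : (0 < r)%N -> 0 < normc de < 1 -> kap != 0 ->
  given_by f (lowerF (de ^+ r) kap%:C r de) -> Aut_h_W f (@c R) =
  [set g | exists a b : R, a != 0 /\ given_by g (lowerF (a ^+ r)%:C b%:C r a%:C)].
Proof.
move=> r0 de01 k0 fE.
have mu01 : 0 < normc (de ^+ r) < 1.
  case/andP: de01 => d0 d1; rewrite normcX exprn_gt0//=.
  by rewrite exprn_ilt1 ?normc_ge0// -lt0n.
apply/seteqP; split => g.
  move=> [[hg _] gf gc].
  have [P [Q [gE EQ EP]]] := centralizer_eval2 mu01 de01 r0 fE hg gf.
  have kc0 : kap%:C != 0 :> C by rewrite fmorph_eq0.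
  have [a [b PQ]] := commuting_jordan r0 (exp_contraction_inj de01) EQ EP kc0 erefl.
  have {}gE : given_by g (lowerF (a ^+ r) b r a).
    by move=> p; rewrite gE (PQ _ _).1 (PQ _ _).2.
  have [_ a0] := lower_coef_neq0 r0 gE.
  have [_ bR aR] := lower_real_coef r0 gE gc.
  exists (complex.Re a), (complex.Re b).
  by split; rewrite ?rmorphXn /= -?aR -?bR// -(inj_eq (@complexI R)) -?aR.
move=> [a [b [a0 gE]]].
apply: (Aut_lower_real r0 _ a0 gE); first by rewrite expf_neq0.
apply: (given_by_commute gE fE) => z w; rewrite /lowerF /= !rmorphXn /=.
by rewrite !exprMn; congr (_, _); ring.
Qed.

Lemma centralizer_IIa (f : W -> W) r : IIa r f -> Aut_h_W f (@c R) =
  [set g | exists a b : R, a != 0 /\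
    given_by g (fun z w => ((a ^+ r)%:C * z + b%:C * w ^+ r, a%:C * w))].
Proof.
move=> [r2 [de [/norm_contraction de01 fE]]].
apply: (@centralizer_jordan f r de 1); rewrite ?oner_neq0//; first exact: ltnW.
by apply: eq_given_by fE => z w; rewrite /lowerF mul1r.
Qed.

Lemma centralizer_IIb (f : W -> W) : IIb f -> Aut_h_W f (@c R) =
  [set g | exists a b : R, a != 0 /\
    given_by g (fun z w => (a%:C * z + b%:C * w, a%:C * w))].
Proof.
move=> [alpha [/norm_contraction al fE]].
rewrite (@centralizer_jordan f 1 alpha 1)// ?oner_neq0//.
by apply: eq_given_by fE => z w; rewrite /lowerF mul1r.
Qed.

(** For n = 0 this is the hypothesis. Otherwise one factor [al] cancels, and a product of powers of
    numbers of modulus less than 1 equals 1 only for zero exponents. *)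
Lemma nonresonant_monomials (al de : C) : 0 < normc al < 1 -> 0 < normc de < 1 ->
  (forall r, al != de ^+ r) -> forall n j, al ^+ n * de ^+ j = al -> (n, j) = (1, 0)%N.
Proof.
move=> al01 de01 nr n j; case: n => [|n].
  by rewrite expr0 mul1r => /esym/eqP; rewrite (negbTE (nr j)).
rewrite exprS -mulrA -[X in _ = X]mulr1 => /(mulfI (contraction_neq0 al01)).
move/(congr1 (@normc R)); rewrite normcM !normcX normc1 => h.
have [/andP[a0 a1] /andP[d0 d1]] := (al01, de01).
have small (x : R) m : 0 < x -> x < 1 -> 0 < x ^+ m <= 1.
  by move=> x0 x1; rewrite exprn_gt0//= exprn_ile1// ltW.
have /andP[an0 an1] := small _ n a0 a1; have /andP[dj0 dj1] := small _ j d0 d1.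
have prod_lt (x y : R) : 0 < x <= 1 -> 0 < y <= 1 -> x * y = 1 -> x = 1 /\ y = 1.
  move=> /andP[x0 x1] /andP[y0 y1] xy.
  have xE : x = 1 by apply/le_anti; rewrite x1 -xy ler_piMr// ltW.
  by split=> //; rewrite -xy xE mul1r.
have [hn hj] := prod_lt _ _ (small _ n a0 a1) (small _ j d0 d1) h.
have pow1 (x : R) m : 0 < x -> x < 1 -> x ^+ m = 1 -> m = 0%N.
  move=> x0 x1; case: m => // m xm.
  by have : x ^+ m.+1 < 1 by [rewrite exprn_ilt1// ltW]; rewrite xm ltxx.
by rewrite (pow1 _ _ a0 a1 hn) (pow1 _ _ d0 d1 hj).
Qed.

Lemma centralizer_diagonal (f g : W -> W) (al de : C) : 0 < normc al < 1 -> 0 < normc de < 1 ->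
  (forall r, al != de ^+ r) -> (forall r, de != al ^+ r) ->
  given_by f (fun z w => (al * z, de * w)) ->
  @holomorphic R (Defs.W R) (Defs.W R) g -> g \o f = f \o g ->
  exists a d, given_by g (lowerF a 0 1 d).
Proof.
move=> al01 de01 nr nr' fE hg gf.
have fE' : given_by f (lowerF al 0 1 de).
  by apply: eq_given_by fE => z w; rewrite /lowerF mul0r addr0.
have [P [Q [gE EQ EP]]] := centralizer_eval2 al01 de01 (ltn0Sn 0) fE' hg gf.
have [||a [d PQ]] := commuting_nonresonant EQ EP erefl.
- exact: nonresonant_monomials.
(* The second coordinate is the first one with the eigenvalues exchanged, so it uses the other
   nonresonance condition. *)
- move=> n j; rewrite mulrC => /(nonresonant_monomials de01 al01 nr')[-> ->].
  by [].
exists a, d => p; rewrite gE (PQ _ _).1 (PQ _ _).2 /lowerF mul0r addr0.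
by [].
Qed.

Lemma centralizer_IIc (f : W -> W) (al de : C) : IIc al de f -> (forall r, de != al ^+ r) ->
  Aut_h_W f (@c R) = [set g | exists a d : R, [/\ a != 0, d != 0 &
    given_by g (fun z w => (a%:C * z, d%:C * w))]].
Proof.
move=> [/norm_contraction al01 /norm_contraction de01 nr fE] nr'.
apply/seteqP; split => g.
  move=> [[hg _] gf gc].
  have [a [d gE]] := centralizer_diagonal al01 de01 nr nr' fE hg gf.
  have [a0 d0] := lower_coef_neq0 (ltn0Sn 0) gE.
  have [aR _ dR] := lower_real_coef (ltn0Sn 0) gE gc.
  exists (complex.Re a), (complex.Re d).
  split; rewrite -?aR -?dR// -?(inj_eq (@complexI R)) -?aR -?dR//.
  by apply: eq_given_by gE => z w; rewrite /lowerF mul0r addr0.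
move=> [a [d [a0 d0 gE]]].
apply: (@Aut_lower_real f g a 0 d 1 _ a0 d0) => //.
  by apply: eq_given_by gE => z w; rewrite /lowerF mul0r addr0.
by apply: (given_by_commute gE fE) => z w /=; congr (_, _); ring.
Qed.

Lemma normc_conj (z : C) : normc (conjc z) = normc z.
Proof. by case: z => a b; rewrite /normc /= sqrrN. Qed.

(** Comparing moduli forces r = 1, and then [al] would be real. *)
Lemma conj_nonresonant (al : C) : 0 < normc al < 1 -> al \isn't Num.real ->
  forall r, al != conjc al ^+ r.
Proof.
move=> al01 nreal r; apply/negP => /eqP alE.
have := congr1 (@normc R) alE; rewrite normcX normc_conj -[X in X = _]expr1 => e.
have [a0 a1] := andP al01.
have r1 : r = 1%N by apply/esym; apply: (ieexprIn a0 _) e; rewrite lt_eqF.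
move: nreal; rewrite r1 expr1 in alE.
have alR := conj_fixed_real (esym alE).
by rewrite alR => /negP; apply; apply/complex_realP; exists (complex.Re al).
Qed.

Lemma centralizer_IIc' (f : W -> W) : IIc' f -> Aut_h_W f (@c' R) =
  [set g | exists a : C, a != 0 /\ given_by g (fun z w => (a * z, conjc a * w))].
Proof.
move=> [al [/norm_contraction al01 nreal fE]].
have al01' : 0 < normc (conjc al) < 1 by rewrite normc_conj.
have nr := conj_nonresonant al01 nreal.
have nr' r : conjc al != al ^+ r.
  apply: contra (nr r) => /eqP e.
  by rewrite -conjcX -e conjcK.
apply/seteqP; split => g.
  move=> [[hg _] gf gc].
  have [a [d gE]] := centralizer_diagonal al01 al01' nr nr' fE hg gf.
  have [a0 d0] := lower_coef_neq0 (ltn0Sn 0) gE.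
  (* [c'] exchanges (0, 1) and (1, 0), so commutation at (0, 1) compares the two diagonal
     coefficients. *)
  have dE : d = conjc a.
    have x0 : ((0, 1) : C2) != 0 by rewrite pair_neq0 /= oner_neq0 orbT.
    have := congr1 val (commutingE (toW (0, 1)) gc).
    rewrite c'_given_by !gE c'_given_by toWK// /lowerF.
    move=> gc01; have : a * conjc 1 + 0 * conjc 0 ^+ 1 = conjc (d * 1) := congr1 fst gc01.
    by rewrite conjc1 mul0r addr0 !mulr1 => ->; rewrite conjcK.
  exists a; split => //; apply: eq_given_by gE => z w.
  by rewrite /lowerF mul0r addr0 dE.
move=> [a [a0 gE]]; split.
- apply: (@lower_Aut _ g a 0 1 (conjc a)) => //; first by rewrite conjc_eq0.
  by apply: eq_given_by gE => z w; rewrite /lowerF mul0r addr0.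
- by apply: (given_by_commute gE fE) => z w /=; congr (_, _); ring.
- apply: (given_by_commute gE c'_given_by) => z w.
  by rewrite [LHS]/= [RHS]/= !conjcM conjcK.
Qed.

Lemma contraction_normal_form (f : W -> W) :
  [\/ IV f, exists r, III r f, exists r, IIa r f
    | IIb f \/ exists alpha delta, IIc alpha delta f] ->
  exists mu kap r de, [/\ 0 < normc mu < 1, 0 < normc de < 1, (0 < r)%N &
    given_by f (lowerF mu kap r de)].
Proof.
have pow01 (de : C) r : (0 < r)%N -> 0 < normc de < 1 -> 0 < normc (de ^+ r) < 1.
  move=> r0 /andP[d0 d1]; rewrite normcX exprn_gt0//=.
  by rewrite exprn_ilt1 ?normc_ge0// -lt0n.
case=> [[al [/norm_contraction al01 fE]]|[r [r2 [de [/norm_contraction de01 fE]]]]|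
  [r [r2 [de [/norm_contraction de01 fE]]]]|
  [[al [/norm_contraction al01 fE]]|[al [de [/norm_contraction al01 /norm_contraction de01 _ fE]]]]].
- exists al, 0, 1%N, al; split=> //.
  by apply: eq_given_by fE => z w; rewrite /lowerF mul0r addr0.
- exists (de ^+ r), 0, r, de; split=> //; [exact: pow01 (ltnW r2) _|exact: ltnW|].
  by apply: eq_given_by fE => z w; rewrite /lowerF mul0r addr0.
- exists (de ^+ r), 1, r, de; split=> //; [exact: pow01 (ltnW r2) _|exact: ltnW|].
  by apply: eq_given_by fE => z w; rewrite /lowerF mul1r.
- exists al, 1, 1%N, al; split=> //.
  by apply: eq_given_by fE => z w; rewrite /lowerF mul1r.
- exists al, 0, 1%N, de; split=> //.
  by apply: eq_given_by fE => z w; rewrite /lowerF mul0r addr0.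
Qed.

Lemma IIc'_commute (f : W -> W) : IIc' f -> f \o @c' R = @c' R \o f.
Proof.
move=> [al [_ _ fE]]; apply: (given_by_commute fE c'_given_by) => z w.
by rewrite [LHS]/= [RHS]/= !conjcM conjcK.
Qed.

End Classification.

(** * The covering of the Hopf surface *)

Section CNorm.
Variable R : realType.
Local Notation C := R[i].
Variable V : normedModType C.
Implicit Types x y : V.

Definition cnorm x : R := complex.Re `|x|.

Lemma cnormE x : `|x| = (cnorm x)%:C.
Proof. by rewrite RRe_real// normr_real. Qed.

Lemma cnorm_ge0 x : 0 <= cnorm x.
Proof. by rewrite -lecR -cnormE normr_ge0. Qed.

Lemma cnorm0 : cnorm 0 = 0. Proof. by rewrite /cnorm normr0. Qed.

Lemma cnormD x y : cnorm (x + y) <= cnorm x + cnorm y.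
Proof. by rewrite -lecR rmorphD /= -!cnormE ler_normD. Qed.

Lemma cnormZ (s : R) x : cnorm (s%:C *: x) = `|s| * cnorm x.
Proof.
apply: (@complexI R); rewrite rmorphM /= -!cnormE normrZ; congr (_ * _).
by rewrite normcR normc_real.
Qed.

Lemma cnorm_distrC x y : cnorm (x - y) = cnorm (y - x).
Proof. by rewrite /cnorm distrC. Qed.

Lemma near_cnormP x (P : V -> Prop) :
  (\forall y \near x, P y) <-> exists2 d : R, 0 < d & forall y, cnorm (y - x) < d -> P y.
Proof.
split.
  move=> /nbhs_ballP[e /= e0 eP].
  have eE : e = (complex.Re e)%:C by rewrite RRe_real // gtr0_real.
  exists (complex.Re e); first by rewrite -ltcR -eE.
  move=> t ht; apply: eP; rewrite -ball_normE /ball_/= eE cnormE ltcR.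
  by rewrite cnorm_distrC.
move=> [d d0 dP]; apply/nbhs_ballP; exists d%:C; first by rewrite /= ltcR.
by move=> t; rewrite -ball_normE /ball_/= cnormE ltcR cnorm_distrC; exact: dP.
Qed.

Definition seg x y (s : R) : V := x + s%:C *: (y - x).

Lemma seg0 x y : seg x y 0 = x. Proof. by rewrite /seg scale0r addr0. Qed.
Lemma seg1 x y : seg x y 1 = y. Proof. by rewrite /seg scale1r addrC subrK. Qed.

Lemma seg_dist x y s t : cnorm (seg x y s - seg x y t) = `|s - t| * cnorm (y - x).
Proof.
by rewrite /seg opprD addrACA subrr add0r -scalerBl -rmorphB cnormZ.
Qed.

Lemma seg_continuous x y : continuous (seg x y).
Proof.
move=> s A /= /near_cnormP[d d0 dA]; apply/nbhs_normP.
have k0 : 0 < cnorm (y - x) + 1 by rewrite ltr_wpDl// cnorm_ge0.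
exists (d / (cnorm (y - x) + 1)); first exact: divr_gt0.
move=> t; rewrite /ball_/= distrC ltr_pdivlMr// => st; apply: dA; rewrite seg_dist.
by apply: le_lt_trans st; rewrite ler_wpM2l// lerDl.
Qed.

Lemma seg_convex x y s t u : seg (seg x y s) (seg x y t) u = seg x y (s + u * (t - s)).
Proof.
rewrite {1}/seg; have -> : seg x y t - seg x y s = (t - s)%:C *: (y - x).
  by rewrite /seg opprD addrACA subrr add0r -scalerBl -rmorphB.
by rewrite scalerA -rmorphM /= /seg -addrA -scalerDl -rmorphD.
Qed.

Lemma seg_sub x y x' y' u : seg x y u - seg x' y' u = seg (x - x') (y - y') u.
Proof.
rewrite /seg opprD addrACA -scalerBr; congr (_ + _ *: _).
by rewrite !opprB [x' - y']addrC addrACA [- x + x']addrC.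
Qed.

Lemma cnorm_seg_lt x y d u : 0 <= u <= 1 -> cnorm x < d -> cnorm y < d -> cnorm (seg x y u) < d.
Proof.
move=> /andP[u0 u1] xd yd.
have -> : seg x y u = (1 - u)%:C *: x + u%:C *: y.
  by rewrite /seg scalerBr rmorphB scalerBl scale1r -addrA [- _ + _]addrC.
apply: le_lt_trans (cnormD _ _) _; rewrite !cnormZ !ger0_norm ?subr_ge0//.
have [->|u_neq0] := eqVneq u 0; first by rewrite subr0 mul1r mul0r addr0.
have u_gt0 : 0 < u by rewrite lt0r u_neq0.
have -> : d = (1 - u) * d + u * d by ring.
by apply: ler_ltD; [rewrite ler_wpM2l ?subr_ge0// ltW|rewrite ltr_pM2l].
Qed.
Definition cball x (d : R) : set V := [set y | cnorm (y - x) < d].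

(** The d-neighbourhood of the segment up to parameter t. It is open and convex, so a lift on it is
    determined by one value. *)
Definition tube x y (t d : R) : set V :=
  [set z | exists s, 0 <= s <= t /\ cnorm (z - seg x y s) < d].

Lemma tube_open x y t d z : tube x y t d z -> \forall z' \near z, tube x y t d z'.
Proof.
move=> [s [st zs]]; apply/near_cnormP; exists (d - cnorm (z - seg x y s)).
  by rewrite subr_gt0.
move=> z' zz'; exists s; split => //.
have -> : z' - seg x y s = (z' - z) + (z - seg x y s) by rewrite addrA subrK.
by apply: le_lt_trans (cnormD _ _) _; rewrite -ltrBrDr.
Qed.

Lemma tube_convex x y t d z z' u : 0 <= u <= 1 -> tube x y t d z -> tube x y t d z' ->
  tube x y t d (seg z z' u).
Proof.
move=> u01 [s [st zs]] [s' [st' zs']]; exists (s + u * (s' - s)); split.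
  have [u0 u1] := andP u01; have [s0 s1] := andP st; have [s0' s1'] := andP st'.
  have -> : s + u * (s' - s) = (1 - u) * s + u * s' by ring.
  apply/andP; split; first by rewrite addr_ge0 ?mulr_ge0 ?subr_ge0.
  have -> : t = (1 - u) * t + u * t by ring.
  by apply: lerD; rewrite ler_wpM2l ?subr_ge0.
by rewrite -seg_convex seg_sub; exact: cnorm_seg_lt.
Qed.

Lemma cball_convex x d z z' u : 0 <= u <= 1 -> cball x d z -> cball x d z' ->
  cball x d (seg z z' u).
Proof.
move=> u01 zd zd'; rewrite /cball /=.
have -> : seg z z' u - x = seg (z - x) (z' - x) u.
  by rewrite -seg_sub /seg subrr scaler0 addr0.
exact: cnorm_seg_lt.
Qed.

Lemma cball_open x d z : cball x d z -> \forall z' \near z, cball x d z'.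
Proof.
move=> zx; apply/near_cnormP; exists (d - cnorm (z - x)); first by rewrite subr_gt0.
move=> z' zz'; rewrite /cball /=.
have -> : z' - x = (z' - z) + (z - x) by rewrite addrA subrK.
by apply: le_lt_trans (cnormD _ _) _; rewrite -ltrBrDr.
Qed.

Lemma cball_center x d : 0 < d -> cball x d x.
Proof. by rewrite /cball /= subrr cnorm0. Qed.

Lemma tube_start x y t d : 0 <= t -> 0 < d -> tube x y t d x.
Proof. by move=> t0 d0; exists 0; rewrite lexx t0 seg0 subrr cnorm0. Qed.

Lemma tube_end x y t d : 0 <= t -> 0 < d -> tube x y t d (seg x y t).
Proof. by move=> t0 d0; exists t; rewrite lexx t0 subrr cnorm0. Qed.

Lemma tube_sub_start x y d : tube x y 0 d `<=` cball x d.
Proof.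
by move=> z [s [/le_anti <-]]; rewrite seg0.
Qed.

Lemma tube_seg x y d u : 0 < d -> 0 <= u <= 1 -> tube x y 1 d (seg x y u).
Proof. by move=> d0 u01; exists u; rewrite u01 subrr cnorm0. Qed.

(** Parameters this close give points less than b / 2 apart; the other half of b is reserved for the
    radius of a tube. The 1 in the denominator allows x = y. *)
Definition seg_modulus x y (b : R) := b / 2 / (cnorm (y - x) + 1).

Lemma seg_modulus_gt0 x y b : 0 < b -> 0 < seg_modulus x y b.
Proof. by move=> b0; rewrite !divr_gt0// ltr_wpDl// cnorm_ge0. Qed.

Lemma seg_close x y b s t : `|s - t| < seg_modulus x y b -> cnorm (seg x y s - seg x y t) < b / 2.
Proof.
rewrite ltr_pdivlMr ?ltr_wpDl ?cnorm_ge0// seg_dist; apply: le_lt_trans.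
by rewrite ler_wpM2l// lerDl.
Qed.

Lemma seg_in_cball x y b s t : 0 < b -> `|s - t| < seg_modulus x y b ->
  cball (seg x y t) b (seg x y s).
Proof.
move=> b0 /seg_close st; apply: lt_le_trans st _.
by rewrite ler_pdivrMr// ler_pMr// ler1n.
Qed.

(** A point of the longer tube beyond parameter t is within b / 2 of a segment point whose parameter
    lies between t and t', and that point is within b / 2 of the centre of the ball. *)
Lemma tube_extend x y b d t t' tau : 0 <= t -> t <= t' ->
  `|t - tau| < seg_modulus x y b -> `|t' - tau| < seg_modulus x y b ->
  tube x y t' (Num.min d (b / 2)) `<=` tube x y t d `|` cball (seg x y tau) b.
Proof.
move=> t0 tt' ttau ttau' z [s [/andP[s0 st'] zs]].
move: zs; rewrite lt_min => /andP[zd zb].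
have [st|ts] := leP s t; first by left; exists s; rewrite s0.
right; rewrite /cball /=.
have -> : z - seg x y tau = (z - seg x y s) + (seg x y s - seg x y tau) by rewrite addrA subrK.
apply: le_lt_trans (cnormD _ _) _; rewrite [b]splitr; apply: ltrD => //.
apply: seg_close; apply: (@le_lt_trans _ _ (Num.max `|t - tau| `|t' - tau|)); last first.
  by rewrite gt_max ttau.
rewrite le_max; have [stau|taus] := leP 0 (s - tau).
  by apply/orP; right; rewrite ger0_norm//; apply: le_trans (ler_norm _); rewrite lerD2r.
apply/orP; left; rewrite ltr0_norm// -normrN; apply: le_trans (ler_norm _).
by rewrite lerN2 lerD2r ltW.
Qed.

Lemma near_seg_tube x y d : 0 < d ->
  \forall y' \near y, forall u, 0 <= u <= 1 -> tube x y 1 d (seg x y' u).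
Proof.
move=> d0; apply/near_cnormP; exists d => // y' yy' u u01; exists u; split => //.
rewrite seg_sub subrr; apply: cnorm_seg_lt => //.
by rewrite cnorm0.
Qed.

End CNorm.

Local Opaque tube cball seg cnorm seg_modulus.

Section Clamp.
Variable R : realType.

(** The retraction of the line onto [0, 1], by a formula whose continuity is immediate. It turns
    paths on [0, 1] into paths on the whole line, where connectedness is applied. *)
Definition clamp (s : R) : R := (`|s| - `|s - 1| + 1) / 2.

Lemma clamp_id s : 0 <= s <= 1 -> clamp s = s.
Proof.
move=> /andP[s0 s1]; rewrite /clamp ger0_norm// ler0_norm ?subr_le0//; lra.
Qed.

Lemma clamp_itv s : 0 <= clamp s <= 1.
Proof.
rewrite /clamp; have [s0|s0] := leP 0 s; have [s1|s1] := leP 0 (s - 1).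
- by rewrite !ger0_norm//; apply/andP; split; lra.
- by rewrite ger0_norm// ltr0_norm//; apply/andP; split; lra.
- by rewrite ltr0_norm// ger0_norm//; apply/andP; split; lra.
- by rewrite !ltr0_norm//; apply/andP; split; lra.
Qed.

Lemma clamp_continuous : continuous clamp.
Proof.
move=> s.
apply: (@continuousM R R (fun s => `|s| - `|s - 1| + 1) (cst 2^-1)); last exact: cst_continuous.
apply: (@continuousD R R R (fun s => `|s| - `|s - 1|) (cst 1)); last exact: cst_continuous.
apply: (@continuousB R R R (fun s => `|s|) (fun s => `|s - 1|)); first exact: norm_continuous.
apply: (@continuous_comp R R R (fun s => s - 1)); last exact: norm_continuous.
by apply: (@continuousB R R R id (cst 1)); [move=> ?|exact: cst_continuous].
Qed.

End Clamp.

(** * Deck transformations, lifts and the automorphisms of the quotient *)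

Section Covering.
Variable R : realType.
Local Notation C := R[i].
Local Notation W := (W R).
Local Notation C2 := (C2 R).
Variables (f finv : W -> W) (rhoW : W -> R) (lam : R).
Hypotheses (fK : cancel f finv) (Kf : cancel finv f).
Hypotheses (cf : continuous f) (cfinv : continuous finv).
Hypotheses (rho_cont : continuous rhoW) (rho0 : forall p, 0 < rhoW p).
Hypotheses (lam01 : 0 < lam < 1) (flam : forall p, rhoW (f p) <= lam * rhoW p).
Implicit Types (p q : W) (g h : W -> W).

Local Notation orb := (orbit_rel f).
Local Notation pi := (hopf_pi f).
Local Notation deck := (cyclic_group f).

Lemma f_bij : bijective f. Proof. by exists finv. Qed.

Lemma hopf_piP p q : pi p = pi q <-> orb p q.
Proof. by split=> [/(@eqmodP _ (orbit_equiv f))//|h]; apply/(@eqmodP _ (orbit_equiv f)). Qed.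

Lemma hopf_pi_surj (x : hopf_space f) : exists p, pi p = x.
Proof. by exists (repr (x : {eq_quot orbit_equiv f})%qT); rewrite /hopf_pi reprK. Qed.

Lemma orb_sym p q : orb p q -> orb q p.
Proof. by move=> /hopf_piP e; apply/hopf_piP. Qed.

Lemma orb_trans p q t : orb p q -> orb q t -> orb p t.
Proof. by move=> /hopf_piP e /hopf_piP e'; apply/hopf_piP; rewrite e. Qed.

Lemma orb_deck p q : orb p q -> exists2 g, deck g & g p = q.
Proof. by move/(orbit_relP _ _ f_bij). Qed.

Lemma deck_orb g p : deck g -> orb p (g p).
Proof. by move=> dg; apply/(orbit_relP _ _ f_bij); exists g. Qed.

Lemma deckP g : deck g <-> exists n, g = iter n f \/ g = iter n finv.
Proof.
split=> [[n [->|[gK Kg]]]|[n [->|->]]]; exists n; [by left| |by left|].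
  right; apply/funext => p; apply: (can_inj (iterK n fK)).
  by rewrite gK (iterK _ Kf).
by right; split; [exact: iterK Kf|exact: iterK fK].
Qed.

Lemma deck_comm g h : deck g -> h \o f = f \o h -> h \o g = g \o h.
Proof.
by move=> /deckP[n [->|->]] hf; apply: semiconj_iter => //; exact: semiconj_inv Kf fK hf.
Qed.

Lemma deck_f : deck f. Proof. by apply/deckP; exists 1%N; left. Qed.

Lemma iter_continuous (h : W -> W) n : continuous h -> continuous (iter n h).
Proof.
move=> ch; elim: n => [|n IH] p; first by move=> ?.
by apply: (@continuous_comp _ _ _ (iter n h) h); [exact: IH|exact: ch].
Qed.

Lemma deck_continuous g : deck g -> continuous g.
Proof. by move=> /deckP[n [->|->]]; exact: iter_continuous. Qed.

Lemma rho_iter_lt n p : (0 < n)%N -> rhoW (iter n f p) <= lam * rhoW p.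
Proof.
have [l0 l1] := andP lam01.
elim: n => // -[|n] IH _; first exact: flam.
rewrite iterS; apply: le_trans (flam _) _; rewrite ler_wpM2l ?ltW//.
by apply: le_lt_trans (IH isT) _; rewrite gtr_pMl.
Qed.

Lemma iter_fixfree n p : (0 < n)%N -> iter n f p <> p.
Proof.
move=> n0 e; have := rho_iter_lt p n0; rewrite e leNgt => /negP; apply.
by rewrite gtr_pMl//; case/andP: lam01.
Qed.

Lemma proper_discontinuity q0 : exists2 V : set W, nbhs q0 V &
  forall p q, V p -> V q -> orb p q -> p = q.
Proof.
have [l0 l1] := andP lam01.
(* The solution of lam (rho q0 + d) = rho q0 - d: a nontrivial iterate of f pushes any point of the
   shell below it. *)
pose d := (1 - lam) / (1 + lam) * rhoW q0.
have l2 : 0 < 1 + lam by rewrite addr_gt0.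
have d0 : 0 < d by rewrite mulr_gt0// divr_gt0// subr_gt0.
have cr : {for q0, continuous rhoW} by exact: rho_cont.
exists [set p | `|rhoW p - rhoW q0| < d]; first by have := (continuous_normrP rhoW q0).1 cr d d0.
have key n p q : (0 < n)%N -> `|rhoW p - rhoW q0| < d -> `|rhoW q - rhoW q0| < d ->
    iter n f p <> q.
  move=> n0 hp hq e; have := rho_iter_lt p n0; rewrite e leNgt => /negP; apply.
  have hp' : rhoW p < rhoW q0 + d by move: hp; rewrite ltr_distl => /andP[].
  have hq' : rhoW q0 - d < rhoW q by move: hq; rewrite ltr_distl => /andP[].
  apply: le_lt_trans hq'.
  apply: (@le_trans _ _ (lam * (rhoW q0 + d))); first by rewrite ler_wpM2l ?ltW.
  rewrite le_eqVlt; apply/orP; left; apply/eqP; rewrite /d; field.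
  by rewrite gt_eqF.
move=> p q hp hq /orb_deck[g /deckP[[|n] [->|->]] e] //.
  by have := key n.+1 p q isT hp hq.
by have := key n.+1 q p isT hq hp; rewrite -e (iterK _ Kf).
Qed.

Lemma deck_free g p : deck g -> g p = p -> g = id.
Proof.
move=> /deckP[[|n] [->|->]] // e; first by have := @iter_fixfree n.+1 p isT e.
by have := @iter_fixfree n.+1 p isT; rewrite -{1}e (iterK _ Kf).
Qed.

Lemma deck_square g : deck g -> g \o g = id -> g = id.
Proof.
have pos m : iter m.+1 f \o iter m.+1 f <> id.
  move=> /(congr1 (@^~ (W1 R))); rewrite /= -!iterS -iterD.
  exact: iter_fixfree.
move=> /deckP[[|m] [->|->]] // gg; first by case: (pos m).
case: (pos m); apply/funext => p.
have := congr1 (@^~ (iter m.+1 f (iter m.+1 f p))) gg.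
by rewrite /comp !(iterK _ fK) => /esym.
Qed.

Lemma hopf_pi_continuous : continuous pi.
Proof. exact: pi_continuous. Qed.

Lemma hopf_pi_open (V : set W) : open V -> open (pi @` V).
Proof.
move=> oV; rewrite -[open _]/(open (pi @^-1` (pi @` V))).
have -> : pi @^-1` (pi @` V) = \bigcup_(g in deck) (g @^-1` V).
  apply/seteqP; split => [p [q Vq /hopf_piP/orb_sym/orb_deck[g dg gp]]|p [g dg Vgp]].
    by exists g => //=; rewrite gp.
  by exists (g p) => //; apply/hopf_piP/orb_sym; exact: deck_orb.
apply: bigcup_open => g dg; apply: open_comp => // p _.
exact: deck_continuous.
Qed.

Lemma near_eq_continuous (T T' : topologicalType) (a b : T -> T') (t : T) :
  {for t, continuous a} -> (\forall s \near t, b s = a s) -> {for t, continuous b}.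
Proof.
move=> ca ba A; rewrite /= (nbhs_singleton ba) => /ca aA.
by apply: filterS2 ba aA => s /= ->.
Qed.

Section LocalUniqueness.
Variables (T : topologicalType) (a b : T -> W) (t : T).
Hypotheses (ca : {for t, continuous a}) (cb : {for t, continuous b}).
Hypothesis ab : \forall s \near t, orb (a s) (b s).

(** Near [t] both values stay in a neighbourhood that meets each orbit at most once. *)
Lemma lift_near_eq : a t = b t -> \forall s \near t, a s = b s.
Proof.
move=> e; have [V Va VP] := proper_discontinuity (a t).
have na : \forall s \near t, V (a s) := ca Va.
have nb : \forall s \near t, V (b s) by apply: cb; rewrite -e.
by apply: filterS3 na nb ab => s; exact: VP.
Qed.

End LocalUniqueness.

(** Near [t] the second map is g times the first for one deck transformation g, and an equality
    nearby would give g a fixed point, hence g = id. *)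
Lemma lift_near_neq (T : topologicalType) (a b : T -> W) (t : T) :
  {for t, continuous a} -> {for t, continuous b} ->
  (\forall s \near t, orb (a s) (b s)) -> a t <> b t -> \forall s \near t, a s <> b s.
Proof.
move=> ca cb ab ne.
have [g dg gab] := orb_deck (nbhs_singleton ab).
have cga : {for t, continuous (g \o a)}.
  by apply: continuous_comp => //; exact: deck_continuous.
have gab' : \forall s \near t, orb ((g \o a) s) (b s).
  by apply: filterS ab => s; apply: orb_trans; apply: orb_sym; exact: deck_orb.
apply: filterS (lift_near_eq cga cb gab' gab) => s /= <- e.
by apply: ne; rewrite -gab (deck_free dg (esym e)).
Qed.

Lemma path_lift_unique (a b : R -> W) : continuous a -> continuous b ->
  (forall s, orb (a s) (b s)) -> forall s t, a s = b s -> a t = b t.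
Proof.
move=> ca cb ab s t e.
pose E := [set u | a u = b u].
have oE : open E.
  rewrite openE => u /= eu.
  apply: (@lift_near_eq _ a b u); [exact: ca|exact: cb|exact: filterE|exact: eu].
have cE : closed E.
  rewrite -openC openE => u /= eu.
  apply: (@lift_near_neq _ a b u); [exact: ca|exact: cb|exact: filterE|exact: eu].
have cT : connected [set: R] by apply/connected_intervalP.
have : E = [set: R].
  apply: cT; first by exists s.
  - by exists E => //; rewrite setTI.
  - by exists E => //; rewrite setTI.
by move=> ET; have : [set: R] t by []; rewrite -ET.
Qed.

(** * Lifting continuous maps through the covering *)

Section Lifting.
Variable psi : C2 -> hopf_space f.
Hypothesis cpsi : forall x : C2, x != 0 -> {for x, continuous psi}.

Definition lift (U : set C2) (G : C2 -> W) :=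
  forall x, U x -> {for x, continuous G} /\ pi (G x) = psi x.

Lemma lift_orb U G G' x : lift U G -> lift U G' -> U x -> orb (G x) (G' x).
Proof. by move=> lG lG' Ux; apply/hopf_piP; rewrite (lG x Ux).2 (lG' x Ux).2. Qed.

Lemma lift_deck U G g : deck g -> lift U G -> lift U (g \o G).
Proof.
move=> dg lG x Ux; have [cG pG] := lG x Ux; split.
  by apply: continuous_comp => //; exact: deck_continuous.
by rewrite -pG; apply/hopf_piP/orb_sym; exact: deck_orb.
Qed.

Lemma lift_sub U U' G : U' `<=` U -> lift U G -> lift U' G.
Proof. by move=> UU lG x /UU; exact: lG. Qed.

Lemma lift_unique_seg U G G' x y s t : lift U G -> lift U G' ->
  (forall u, 0 <= u <= 1 -> U (seg x y u)) -> 0 <= s <= 1 -> 0 <= t <= 1 ->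
  G (seg x y s) = G' (seg x y s) -> G (seg x y t) = G' (seg x y t).
Proof.
move=> lG lG' Us s01 t01; rewrite -{1 2}(clamp_id s01) -{1 2}(clamp_id t01).
have cl (H : C2 -> W) : lift U H -> continuous (fun u => H (seg x y (clamp u))).
  move=> lH u; apply: (@continuous_comp _ _ _ (fun u => seg x y (clamp u)) H).
    by apply: continuous_comp; [exact: clamp_continuous|exact: seg_continuous].
  by have [] := lH _ (Us _ (clamp_itv u)).
apply: (@path_lift_unique (fun u => G (seg x y (clamp u))) (fun u => G' (seg x y (clamp u)))).
- exact: cl.
- exact: cl.
- by move=> u; apply: lift_orb lG lG' _; apply: Us; exact: clamp_itv.
Qed.

(** In a neighbourhood V meeting each orbit at most once, the value is the unique point of the
    interior of V above psi x. Continuity holds because the projection is open. *)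
Lemma local_lift (x0 : C2) : x0 != 0 ->
  exists d G, [/\ 0 < d, lift (cball x0 d) G & ~ cball x0 d 0].
Proof.
move=> x00; have [q0 q0E] := hopf_pi_surj (psi x0).
have [V Vq0 VP] := proper_discontinuity q0.
have oV : open V° by exact: open_interior.
have V0 : V° q0 by [].
pose G x := xget q0 [set v | V° v /\ pi v = psi x].
have GP x : (pi @` V°) (psi x) -> V° (G x) /\ pi (G x) = psi x.
  move=> [v Vv ve]; have [] := @xgetPex _ q0 [set v | V° v /\ pi v = psi x] => //.
  by exists v.
have near_psi (A : set W) x : x != 0 -> open A -> (pi @` A) (psi x) ->
    \forall y \near x, (pi @` A) (psi y).
  move=> xn0 oA Ax; apply: cpsi => //; apply: open_nbhs_nbhs; split => //.
  exact: hopf_pi_open.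
have : \forall y \near x0, (pi @` V°) (psi y) /\ y != 0.
  apply: filterI; last exact: near_neq0.
  by apply: near_psi => //; exists q0.
move=> /near_cnormP[d d0 dP]; exists d, G; split => //; last by move=> /dP[_]; rewrite eqxx.
move=> x xd; have [Vx xn0] := dP _ xd; have [VG pG] := GP _ Vx; split => //.
move=> A GA; have GA' : nbhs (G x) (V° `&` A°).
  by apply: open_nbhs_nbhs; split; [apply: openI => //; exact: open_interior|split].
have : \forall y \near x, (pi @` (V° `&` A°)) (psi y).
  apply: near_psi => //; first by apply: openI => //; exact: open_interior.
  by exists (G x) => //; exact: nbhs_singleton GA'.
apply: filterS => y [v [Vv Av] vy].
have [VGy pGy] : V° (G y) /\ pi (G y) = psi y by apply: GP; exists v.
suff e : G y = v by rewrite /preimage /= e; exact: interior_subset Av.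
apply: VP; [exact: interior_subset VGy|exact: interior_subset Vv|].
by apply/hopf_piP; rewrite pGy vy.
Qed.

Lemma lift_glue (T B : set C2) G G' :
  (forall z, T z -> \forall z' \near z, T z') -> (forall z, B z -> \forall z' \near z, B z') ->
  lift T G -> lift B G' -> (forall z, T z -> B z -> G z = G' z) ->
  lift (T `|` B) (fun z => if `[< T z >] then G z else G' z).
Proof.
move=> oT oB lG lG' agree; set K := fun z => _.
have KT z : T z -> K z = G z by move=> Tz; rewrite /K asboolT.
have KB z : B z -> K z = G' z.
  move=> Bz; rewrite /K; case: (asboolP (T z)) => [Tz|_]; last by reflexivity.
  exact: (agree z Tz Bz).
move=> z [Tz|Bz].
  have [cG pG] := lG _ Tz; split; last by rewrite KT.
  by apply: near_eq_continuous cG _; apply: filterS (oT z Tz) => z' /KT.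
have [cG pG] := lG' _ Bz; split; last by rewrite KB.
by apply: near_eq_continuous cG _; apply: filterS (oB z Bz) => z' /KB.
Qed.

(* The two steps of a supremum argument along the segment: lifts extend from t to any t'
   when both are close to tau. *)
Lemma tube_lift_extend x y q0 : (forall t, 0 <= t <= 1 -> seg x y t != 0) ->
  forall tau, 0 <= tau <= 1 -> exists2 eta, 0 < eta & forall t t',
  0 <= t <= 1 -> t <= t' <= 1 -> `|t - tau| < eta -> `|t' - tau| < eta ->
  (exists d G, [/\ 0 < d, lift (tube x y t d) G, G x = q0 & ~ tube x y t d 0]) ->
  exists d G, [/\ 0 < d, lift (tube x y t' d) G, G x = q0 & ~ tube x y t' d 0].
Proof.
move=> seg_neq0 tau tau01; have [b [H [b0 lH H0]]] := local_lift (seg_neq0 _ tau01).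
exists (seg_modulus x y b); first exact: seg_modulus_gt0.
move=> t t' /andP[t0 t1] /andP[tt' t1'] ttau ttau' [d [G [d0 lG Gx G0]]].
have Tt := tube_end x y t0 d0.
have Bt := seg_in_cball b0 ttau.
(* The local lift at tau is moved by a deck transformation so as to agree with the lift already
   built at the end of its tube. *)
have [g dg gH] : exists2 g, deck g & g (H (seg x y t)) = G (seg x y t).
  apply: orb_deck; apply/hopf_piP.
  by rewrite (lG _ Tt).2 (lH _ Bt).2.
have lgH := lift_deck dg lH.
pose T := tube x y t d; pose B := cball (seg x y tau) b.
(* The tube and the ball are both convex, so any common point is joined to the matching point inside
   their intersection. *)
have agree z : T z -> B z -> G z = g (H z).
  move=> Tz Bz; rewrite -(seg1 (seg x y t) z).
  apply: (@lift_unique_seg (T `&` B) G (g \o H) (seg x y t) z 0 1).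
  - exact: (lift_sub (@subIsetl _ T B) lG).
  - exact: (lift_sub (@subIsetr _ T B) lgH).
  - by move=> u u01; split; [exact: (tube_convex u01 Tt Tz)|exact: (cball_convex u01 Bt Bz)].
  - by rewrite lexx ler01.
  - by rewrite ler01 lexx.
  - by rewrite seg0 /= gH.
pose K z := if `[< T z >] then G z else (g \o H) z.
have lK : lift (T `|` B) K.
  exact: (lift_glue (fun z Tz => tube_open Tz) (fun z Bz => cball_open Bz) lG lgH agree).
have KT z : T z -> K z = G z by move=> Tz; rewrite /K asboolT.
have sub := @tube_extend _ _ x y b d t t' tau t0 tt' ttau ttau'.
exists (Num.min d (b / 2)), K; split.
- by rewrite lt_min d0 divr_gt0.
- exact: (lift_sub sub lK).
- by rewrite KT; [exact: Gx|exact: tube_start].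
- by move=> /sub[].
Qed.

Lemma tube_lift x y q0 : (forall t, 0 <= t <= 1 -> seg x y t != 0) -> pi q0 = psi x ->
  exists d G, [/\ 0 < d, lift (tube x y 1 d) G, G x = q0 & ~ tube x y 1 d 0].
Proof.
move=> seg_neq0 q0E.
pose S t := exists d G, [/\ 0 < d, lift (tube x y t d) G, G x = q0 & ~ tube x y t d 0].
have S0 : S 0.
  have x0 : x != 0 by rewrite -(seg0 x y); apply: seg_neq0; rewrite lexx ler01.
  have [d [G [d0 lG G0]]] := local_lift x0.
  have Bx := cball_center x d0.
  have [g dg gE] : exists2 g, deck g & g (G x) = q0.
    by apply: orb_deck; apply/hopf_piP; rewrite q0E (lG _ Bx).2.
  exists d, (g \o G); split; [exact: d0| |exact: gE|].
    exact: (lift_sub (@tube_sub_start _ _ x y d) (lift_deck dg lG)).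
  by move=> h; exact: (G0 (tube_sub_start h)).
pose A := [set t | 0 <= t <= 1 /\ S t].
have A0 : A 0 by split; [rewrite lexx ler01|exact: S0].
have hsA : has_sup A.
  by split; [exists 0|exists 1 => t [/andP[]]].
pose tau := sup A.
have tau01 : 0 <= tau <= 1.
  apply/andP; split; first exact: sup_upper_bound.
  by apply: ge_sup; [exists 0|move=> t [/andP[]]].
have [eta eta0 ext] := tube_lift_extend q0 seg_neq0 tau01.
have [t [t01 St] taut] := sup_adherent eta0 hsA.
have t_tau : t <= tau by exact: sup_upper_bound.
have ttau : `|t - tau| < eta by rewrite distrC ger0_norm ?subr_ge0// ltrBlDr -ltrBlDl.
(* A lift up to t' forces t' <= tau, since tau is the supremum; this excludes the second argument of
   the minimum, so t' = 1. *)
pose t' := Num.min 1 (tau + eta / 2).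
have [t0 t1] := andP t01; have [tau0 tau1] := andP tau01.
have tau_t' : tau <= t' by rewrite le_min tau1 lerDl divr_ge0 ?ltW.
have tt' : t <= t' <= 1 by rewrite (le_trans t_tau)// ge_min lexx.
have t'tau : `|t' - tau| < eta.
  rewrite ger0_norm ?subr_ge0// ltrBlDl gt_min; apply/orP; right.
  by rewrite ltrD2l ltr_pdivrMr// ltr_pMr// ltr1n.
have St' : S t' := ext t t' t01 tt' ttau t'tau St.
have t'_tau : t' <= tau.
  apply: (sup_upper_bound hsA); split; last exact: St'.
  by case/andP: tt' => tt' ->; rewrite (le_trans t0).
suff -> : 1 = t' by [].
apply/eqP; rewrite eq_sym; move: t'_tau; rewrite /t' /Num.min; case: ltP => // _.
by rewrite gerDl leNgt divr_gt0.
Qed.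

(** The value at x is the endpoint of the lift along the segment from x0. For y near x, the segment
    to y runs inside the tube used for x, so uniqueness identifies the two constructions and gives
    continuity. *)
Lemma star_lift (D : set C2) (x0 : C2) q0 : (forall x, D x -> \forall y \near x, D y) ->
  (forall x u, D x -> 0 <= u <= 1 -> D (seg x0 x u)) ->
  D x0 -> ~ D 0 -> pi q0 = psi x0 -> exists2 G, lift D G & G x0 = q0.
Proof.
move=> oD starD Dx0 D0 q0E.
have local x : D x -> exists d G,
    [/\ 0 < d, lift (tube x0 x 1 d) G, G x0 = q0 & ~ tube x0 x 1 d 0].
  move=> Dx; apply: tube_lift q0E => t t01; apply/eqP => e.
  by apply: D0; rewrite -e; exact: starD.
pose P x v := exists d G, [/\ 0 < d, lift (tube x0 x 1 d) G, G x0 = q0 & G x = v].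
pose H x := xget q0 [set v | P x v].
have HP x : D x -> P x (H x).
  move=> Dx; have [d [G [d0 lG Gx0 _]]] := local x Dx.
  apply: (@xgetPex _ q0 [set v | P x v]); exists (G x); exists d, G.
  by split.
exists H; last first.
  by have [d [G [d0 lG Gx0 <-]]] := HP x0 Dx0.
move=> x Dx; have [d [G [d0 lG Gx0 Gx]]] := HP x Dx.
have Tx : tube x0 x 1 d x by rewrite -{2}(seg1 x0 x); exact: tube_end ler01 d0.
have [cG pG] := lG x Tx; split; last by rewrite -Gx.
apply: near_eq_continuous cG _.
apply: filterS2 (oD x Dx) (near_seg_tube x0 x d0) => y Dy Ty.
have [d' [G' [d'0 lG' Gx0' Gy']]] := HP y Dy.
rewrite -Gy' -(seg1 x0 y).
apply: (@lift_unique_seg (tube x0 y 1 d' `&` tube x0 x 1 d) G' G x0 y 0 1).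
- exact: (lift_sub (@subIsetl _ _ _) lG').
- exact: (lift_sub (@subIsetr _ _ _) lG).
- by move=> u u01; split; [exact: (tube_seg x0 y d'0 u01)|exact: (Ty u u01)].
- by rewrite lexx ler01.
- by rewrite ler01 lexx.
- by rewrite seg0 Gx0 Gx0'.
Qed.

(* For e = 1 or e = -1, the complement of a closed ray in the line z2 = 0, which is
   star-shaped about (e, 0). *)
Definition slit (e : R) : set C2 :=
  [set x | x.2 != 0 \/ complex.Im x.1 != 0 \/ 0 < e * complex.Re x.1].

Lemma slit_open e (x : C2) : slit e x -> \forall y \near x, slit e y.
Proof.
have cont1 (h : C -> R) : continuous (h : R[i]^o -> R) -> {for x, continuous (fun y : C2 => h y.1)}.
  by move=> ch; apply: (@continuous_comp _ _ _ (fst : C2 -> R[i]^o)); [exact: cvg_fst|exact: ch].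
move=> [x2|[x1|x1]].
- have : \forall y \near x, y.2 != 0.
    by apply: (@cvgr_neq0 _ _ _ (nbhs x) _ (snd : C2 -> R[i]^o) x.2) => //; exact: cvg_snd.
  by apply: filterS => y; left.
- have : \forall y \near x, complex.Im y.1 != 0.
    by apply: (@cvgr_neq0 _ _ _ (nbhs x) _ _ _ (cont1 _ (@Im_continuous R))).
  by apply: filterS => y; right; left.
- have ce : {for x, continuous (fun y : C2 => e * complex.Re y.1)}.
    by apply: (@continuousM _ C2 (cst e)); [exact: cst_continuous|exact: cont1 (@Re_continuous R)].
  have : \forall y \near x, 0 < e * complex.Re y.1 by apply: (@cvgr_gt _ _ (nbhs x) _ _ _ ce).
  by apply: filterS => y; right; right.
Qed.

Lemma slit0 e : ~ slit e 0.
Proof. by case=> [|[]]; rewrite /= ?eqxx ?mulr0 ?ltxx. Qed.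

Lemma seg_fst (x y : C2) u : (seg x y u).1 = x.1 + u%:C * (y.1 - x.1).
Proof. by []. Qed.

Lemma seg_snd (x y : C2) u : (seg x y u).2 = x.2 + u%:C * (y.2 - x.2).
Proof. by []. Qed.

Lemma slit_star e (x : C2) u : e * e = 1 -> slit e x -> 0 <= u <= 1 ->
  slit e (seg ((e%:C, 0) : C2) x u).
Proof.
move=> ee sx /andP[u0 u1].
have : (seg ((e%:C, 0) : C2) x u).2 = u%:C * x.2 by rewrite seg_snd /= add0r subr0.
have : (seg ((e%:C, 0) : C2) x u).1 = e%:C + u%:C * (x.1 - e%:C) by rewrite seg_fst.
rewrite /slit /=; move: (seg _ _ _) => y -> ->.
have [->|u_neq0] := eqVneq u 0.
  by right; right; rewrite mul0r addr0 /= ee.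
have u_gt0 : 0 < u by rewrite lt0r u_neq0.
case: sx => [x2|[x1|x1]]; [left|right; left|right; right].
- by rewrite mulf_neq0// fmorph_eq0.
- have -> : complex.Im (e%:C + u%:C * (x.1 - e%:C)) = u * complex.Im x.1.
    by case: (x.1) => a b /=; ring.
  exact: mulf_neq0.
- have -> : e * complex.Re (e%:C + u%:C * (x.1 - e%:C)) =
      (1 - u) * (e * e) + u * (e * complex.Re x.1) by case: (x.1) => a b /=; ring.
  by rewrite ee mulr1; apply: ltr_wpDl; [rewrite subr_ge0|exact: mulr_gt0].
Qed.

(** The intersection of the two slit sets consists of the points with Im z or w nonzero. It is
    reached from two centres: (0, 1) sees the points with Im z nonzero, among them (i, 0), which
    sees those with w nonzero. *)
Lemma slitI_seg1 (x : C2) u : complex.Im x.1 != 0 -> 0 <= u <= 1 ->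
  (slit 1 `&` slit (-1)) (seg ((0, 1) : C2) x u).
Proof.
move=> x1 u01; suff h : (seg ((0, 1) : C2) x u).2 != 0 \/ complex.Im (seg ((0, 1) : C2) x u).1 != 0.
  by case: h => h; split; rewrite /slit /=; [left|left|right; left|right; left].
have -> : (seg ((0, 1) : C2) x u).1 = u%:C * x.1 by rewrite seg_fst /= add0r subr0.
rewrite seg_snd /=; have [->|u_neq0] := eqVneq u 0.
  by left; rewrite mul0r addr0 oner_eq0.
right; have -> : complex.Im (u%:C * x.1) = u * complex.Im x.1.
  by case: (x.1) => a b /=; ring.
exact: mulf_neq0.
Qed.

Lemma slitI_seg2 (x : C2) u : x.2 != 0 -> 0 <= u <= 1 ->
  (slit 1 `&` slit (-1)) (seg (('i, 0) : C2) x u).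
Proof.
move=> x2 u01; suff h : (seg (('i, 0) : C2) x u).2 != 0 \/ complex.Im (seg (('i, 0) : C2) x u).1 != 0.
  by case: h => h; split; rewrite /slit /=; [left|left|right; left|right; left].
have -> : (seg (('i, 0) : C2) x u).2 = u%:C * x.2 by rewrite seg_snd /= add0r subr0.
rewrite seg_fst /=; have [->|u_neq0] := eqVneq u 0.
  by right; rewrite mul0r addr0 /= oner_eq0.
by left; rewrite mulf_neq0// fmorph_eq0.
Qed.

Lemma slit_cover (x : C2) : x != 0 -> slit 1 x \/ slit (-1) x.
Proof.
rewrite pair_neq0 => /orP[|x2]; last by left; left.
move=> x1; have [i0|i0] := eqVneq (complex.Im x.1) 0; last by left; right; left.
have r0 : complex.Re x.1 != 0.
  by apply: contra x1 => /eqP r0; rewrite eq_complex /= r0 i0 !eqxx.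
move: r0; rewrite neq_lt => /orP[r0|r0]; [right|left]; right; right.
  by rewrite mulN1r oppr_gt0.
by rewrite mul1r.
Qed.

Lemma slit_unique e G G' (a b : C2) : e * e = 1 -> lift (slit e) G -> lift (slit e) G' ->
  slit e a -> slit e b -> G a = G' a -> G b = G' b.
Proof.
move=> ee lG lG' sa sb ab.
have base x y : slit e x -> G x = G' x -> y = (e%:C, 0) -> G y = G' y.
  move=> sx xx ->; rewrite -(seg0 ((e%:C, 0) : C2) x).
  apply: (@lift_unique_seg _ _ _ _ x 1 0 lG lG') => [u||| ].
  - exact: slit_star.
  - by rewrite ler01 lexx.
  - by rewrite lexx ler01.
  - by rewrite seg1.
have ce := base a _ sa ab erefl.
rewrite -(seg1 ((e%:C, 0) : C2) b).
apply: (@lift_unique_seg _ _ _ _ b 0 1 lG lG') => [u||| ].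
- exact: slit_star.
- by rewrite lexx ler01.
- by rewrite ler01 lexx.
- by rewrite seg0.
Qed.

Lemma slitI_unique G G' (x : C2) : lift (slit 1) G -> lift (slit (-1)) G' ->
  G ((0, 1) : C2) = G' ((0, 1) : C2) -> slit 1 x -> slit (-1) x -> G x = G' x.
Proof.
move=> lG lG' GG sx sx'.
have lG1 := lift_sub (@subIsetl _ (slit 1) (slit (-1))) lG.
have lG1' := lift_sub (@subIsetr _ (slit 1) (slit (-1))) lG'.
have i01 y : complex.Im y.1 != 0 -> G y = G' y.
  move=> y1; rewrite -(seg1 ((0, 1) : C2) y).
  apply: (@lift_unique_seg _ _ _ _ y 0 1 lG1 lG1') => [u||| ].
  - exact: slitI_seg1.
  - by rewrite lexx ler01.
  - by rewrite ler01 lexx.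
  - by rewrite seg0.
have [x1|x1] := eqVneq (complex.Im x.1) 0; last exact: i01.
have x2 : x.2 != 0.
  move: sx sx' => [//|[|sx]]; first by rewrite x1 eqxx.
  case=> [//|[|]]; first by rewrite x1 eqxx.
  by move: sx; rewrite mul1r mulN1r oppr_gt0 => sx /(lt_trans sx); rewrite ltxx.
rewrite -(seg1 (('i, 0) : C2) x).
apply: (@lift_unique_seg _ _ _ _ x 0 1 lG1 lG1') => [u||| ].
- exact: slitI_seg2.
- by rewrite lexx ler01.
- by rewrite ler01 lexx.
- by rewrite seg0; apply: i01; rewrite /= oner_eq0.
Qed.

Lemma slit_base e : e * e = 1 -> slit e ((e%:C, 0) : C2).
Proof. by move=> ee; right; right; rewrite /= ee ltr01. Qed.

Lemma slit_01 e : slit e ((0, 1) : C2).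
Proof. by left; rewrite /= oner_eq0. Qed.

Lemma N1N1 : (-1 : R) * -1 = 1. Proof. by rewrite mulrNN mulr1. Qed.

(** Both slit sets are connected and contain (0, 1), through which the agreement is passed from [a]
    to [b]. *)
Lemma lift_unique G G' (a b : C2) : lift [set x | x != 0] G -> lift [set x | x != 0] G' ->
  a != 0 -> b != 0 -> G a = G' a -> G b = G' b.
Proof.
move=> lG lG' a0 b0 ab.
have sub e : slit e `<=` [set x | x != 0].
  by move=> x sx; apply/eqP => x0; apply: (@slit0 e); rewrite -x0.
have uniq e x y (ee : e * e = 1) := @slit_unique e _ _ x y ee (lift_sub (sub e) lG) (lift_sub (sub e) lG').
have h01 : G ((0, 1) : C2) = G' ((0, 1) : C2).
  case: (slit_cover a0) => sa.
    exact: uniq (mulr1 1) sa (slit_01 1) ab.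
  exact: uniq N1N1 sa (slit_01 (-1)) ab.
case: (slit_cover b0) => sb.
  exact: uniq (mulr1 1) (slit_01 1) sb h01.
exact: uniq N1N1 (slit_01 (-1)) sb h01.
Qed.

Lemma lift_exists : exists G, lift [set x | x != 0] G.
Proof.
have side e : e * e = 1 -> exists G, lift (slit e) G.
  move=> ee; have [q0 q0E] := hopf_pi_surj (psi ((e%:C, 0) : C2)).
  have [G lG _] := star_lift (@slit_open e) (fun x u sx => slit_star ee sx)
    (slit_base ee) (@slit0 e) q0E.
  by exists G.
have [G lG] := side 1 (mulr1 1); have [G' lG'] := side (-1) N1N1.
have [g dg gE] : exists2 g, deck g & g (G' ((0, 1) : C2)) = G ((0, 1) : C2).
  apply: orb_deck; apply/hopf_piP.
  by rewrite (lG _ (slit_01 1)).2 (lG' _ (slit_01 (-1))).2.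
have lgG' := lift_deck dg lG'.
have lK := lift_glue (@slit_open 1) (@slit_open (-1)) lG lgG'
  (fun z => slitI_unique lG lgG' (esym gE)).
exists (fun z => if `[< slit 1 z >] then G z else (g \o G') z).
exact: (lift_sub slit_cover lK).
Qed.

End Lifting.

Local Notation toW := (@toW R).

Lemma comp_toW_continuous (T : topologicalType) (u : W -> T) (x : C2) : continuous u -> x != 0 ->
  {for x, continuous (u \o toW)}.
Proof.
move=> cu x0; apply: (@continuous_comp _ _ _ toW u x); first exact: toW_continuous.
exact: cu.
Qed.

Lemma continuous_lift (phi : hopf_space f -> hopf_space f) : continuous phi ->
  exists2 g : W -> W, continuous g & forall p, pi (g p) = phi (pi p).
Proof.
move=> cphi; have cpsi (x : C2) : x != 0 -> {for x, continuous ((phi \o pi) \o toW)}.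
  apply: comp_toW_continuous => p.
  by apply: (@continuous_comp _ _ _ pi phi p); [exact: hopf_pi_continuous|exact: cphi].
have [G lG] := lift_exists cpsi.
exists (G \o val) => p; last by rewrite (lG _ (val_neq0 p)).2 /= valWK.
by apply: (@continuous_comp _ _ _ _ G p); [exact: val_continuous|exact: (lG _ (val_neq0 p)).1].
Qed.

(** A deck transformation matching the maps at the base point [W1] turns them into two lifts of the
    same map agreeing at a point. *)
Lemma continuous_deck_eq g h : continuous g -> continuous h -> (forall p, orb (g p) (h p)) ->
  exists2 n, deck n & h = n \o g.
Proof.
move=> cg ch gh; have [n dn nE] := orb_deck (gh (W1 R)).
exists n => //; apply/funext => p.
have cng : continuous (n \o g).
  by move=> q; apply: (@continuous_comp _ _ _ g n q); [exact: cg|exact: deck_continuous].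
have lh : lift ((pi \o h) \o toW) [set x | x != 0] (h \o toW).
  by move=> x x0; split => //; exact: comp_toW_continuous.
have lg : lift ((pi \o h) \o toW) [set x | x != 0] ((n \o g) \o toW).
  move=> x x0; split; first exact: comp_toW_continuous.
  by apply/hopf_piP; apply: orb_trans (gh _); apply: orb_sym; exact: deck_orb.
have := lift_unique lh lg (val_neq0 (W1 R)) (val_neq0 p).
by rewrite /comp !valWK => -> //; rewrite nE.
Qed.

Lemma continuous_deck g : continuous g -> (forall p, pi (g p) = pi p) -> deck g.
Proof.
move=> cg gpi; have cid : continuous (id : W -> W) by move=> p A.
have [|n dn ->] := continuous_deck_eq cid cg; last by [].
by move=> p; apply/hopf_piP; rewrite gpi.
Qed.

Lemma pi_deck g p : deck g -> pi (g p) = pi p.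
Proof. by move=> dg; apply/hopf_piP/orb_sym; exact: deck_orb. Qed.

Lemma comp_continuous g h : continuous g -> continuous h -> continuous (g \o h).
Proof. by move=> cg ch p; apply: (@continuous_comp _ _ _ h g p); [exact: ch|exact: cg]. Qed.

(** Deck transformations are the continuous maps preserving the fibres, which spares a discussion of
    the signs of exponents. *)
Lemma deck_comp g h : deck g -> deck h -> deck (g \o h).
Proof.
move=> dg dh; apply: continuous_deck => [|p]; last by rewrite /= !pi_deck.
by apply: comp_continuous; exact: deck_continuous.
Qed.

Lemma deck_inv g : deck g -> exists h, [/\ deck h, cancel g h & cancel h g].
Proof.
move=> /deckP[n [->|->]]; [exists (iter n finv)|exists (iter n f)]; split;
  try exact: iterK fK; try exact: iterK Kf; apply/deckP; exists n; [by right|by left].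
Qed.

Lemma deck_id : deck id. Proof. by exists 0%N; left. Qed.

Lemma deck_is_group : is_group deck.
Proof. by split; [exact: deck_id|exact: deck_comp|exact: deck_inv]. Qed.

Lemma section_continuous (U : set (hopf_space f)) (s : hopf_space f -> W) : open (s @` U) ->
  (forall x, U x -> pi (s x) = x) -> forall x, U x -> {for x, continuous s}.
Proof.
move=> oU sU x Ux A sxA.
have oA : open (A° `&` s @` U) by apply: openI => //; exact: open_interior.
have : nbhs x (pi @` (A° `&` s @` U)).
  apply: open_nbhs_nbhs; split; first exact: hopf_pi_open.
  exists (s x); last exact: sU.
  by split => //; exists x.
apply: filterS => y [v [vA [u Uu uv]] <-]; rewrite /preimage /= -uv sU// uv.
exact: interior_subset vA.
Qed.

(** The inverse of the projection on a neighbourhood of [p] meeting each orbit at most once,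
    normalized to take the value [p]. *)
Lemma chart_at p : exists k, [/\ @charts R (hopf f) k, k.1 (pi p) & k.2 (pi p) = val p].
Proof.
have [V Vp VP] := proper_discontinuity p.
have oV : open V° by exact: open_interior.
pose s x := xget p [set v | V° v /\ pi v = x].
have sP x : (pi @` V°) x -> V° (s x) /\ pi (s x) = x.
  move=> [v Vv vx]; apply: (@xgetPex _ p [set v | V° v /\ pi v = x]).
  by exists v.
have sV v : V° v -> s (pi v) = v.
  move=> Vv; have [Vs ps] : V° (s (pi v)) /\ pi (s (pi v)) = pi v by apply: sP; exists v.
  apply: VP; [exact: interior_subset Vs|exact: interior_subset Vv|exact/hopf_piP].
exists (pi @` V°, val \o s); split => /=; last by rewrite sV.
- exists s; split => //=; first exact: hopf_pi_open.
    suff -> : s @` (pi @` V°) = V° by [].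
    apply/seteqP; split => [_ [x Vx <-]|v Vv]; first by case: (sP x Vx).
    by exists (pi v); [exists v|exact: sV].
  by move=> x /sP[].
- by exists p.
Qed.

(* In charts, a continuous map of the quotient is its lift up to a deck transformation. *)
Lemma transition_lift (phi : hopf_space f -> hopf_space f) g k l x : continuous phi -> continuous g ->
  (forall p, pi (g p) = phi (pi p)) -> @charts R (hopf f) k -> @charts R (hopf f) l ->
  k.1 x -> l.1 (phi x) -> exists p n, [/\ k.2 x = val p, pi p = x, deck n,
    val (n (g p)) = l.2 (phi x) &
    \forall y \near k.2 x, ext (n \o g) y = (l.2 \o phi \o 'pinv_(fun=> x) k.1 k.2) y].
Proof.
move=> cphi cg gphi [s [ok os sP k2]] [t [ol ot tP l2]] kx lx.
exists (s x).
have s_inj u v : k.1 u -> k.1 v -> (val \o s) u = (val \o s) v -> u = v.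
  by move=> ku kv /W_inj e; rewrite -(sP u ku) -(sP v kv) e.
have sx0 : val (s x) != 0 :> C2 by exact: val_neq0.
have near_s : \forall y \near (val (s x) : C2), (s @` k.1) (toW y).
  apply: (@toW_continuous R _ sx0); rewrite valWK; apply: open_nbhs_nbhs.
  by split => //; exists x.
have near_pinv : \forall y \near (val (s x) : C2), 'pinv_(fun=> x) k.1 k.2 y = pi (toW y).
  apply: filterS2 (near_neq0 sx0) near_s => y y0 [u ku su].
  rewrite -su sP// -{1}(toWK y0) -su k2.
  by rewrite -[val (s u)]/((val \o s) u) pinvKV ?inE// => a b /set_mem ka /set_mem kb; exact: s_inj.
have tw : {for (val (s x) : C2), continuous (phi \o (pi \o toW))}.
  apply: continuous_comp; first by apply: comp_toW_continuous => //; exact: hopf_pi_continuous.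
  exact: cphi.
have pE : phi (pi (toW (val (s x) : C2))) = phi x by rewrite valWK sP.
have ct : {for (val (s x) : C2), continuous (t \o (phi \o (pi \o toW)))}.
  apply: continuous_comp; first exact: tw.
  by rewrite /= pE; apply: section_continuous ot tP _ lx.
have near_l : \forall y \near (val (s x) : C2), l.1 (phi (pi (toW y))).
  have nl : nbhs ((phi \o (pi \o toW)) (val (s x) : C2)) l.1.
    by apply: open_nbhs_nbhs; split => //; rewrite /comp pE.
  exact: tw nl.
have near_orb : \forall y \near (val (s x) : C2), orb (g (toW y)) (t (phi (pi (toW y)))).
  apply: filterS near_l => y ly; apply/hopf_piP.
  by rewrite gphi tP.
(* The correction is fixed at the centre of the chart; local uniqueness of lifts propagates it to a
   neighbourhood. *)
have [n dn nE] := orb_deck (nbhs_singleton near_orb).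
exists n; split => //; first by rewrite k2.
- exact: sP.
- by move: nE; rewrite valWK sP// => ->; rewrite l2.
have cng : {for (val (s x) : C2), continuous ((n \o g) \o toW)}.
  apply: comp_toW_continuous => // q.
  by apply: (@continuous_comp _ _ _ g n q); [exact: cg|exact: deck_continuous].
have near_orb' : \forall y \near (val (s x) : C2),
    orb (((n \o g) \o toW) y) ((t \o (phi \o (pi \o toW))) y).
  by apply: filterS near_orb => y; apply: orb_trans; apply: orb_sym; exact: deck_orb.
rewrite k2; apply: filterS2 near_pinv (lift_near_eq cng ct near_orb' nE) => y /= pv e.
by rewrite -k2 pv l2 /= -e.
Qed.

Hypotheses (holf : @holomorphic R W W f) (holfinv : @holomorphic R W W finv).

Lemma iter_holomorphic h n : @holomorphic R W W h -> @holomorphic R W W (iter n h).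
Proof.
move=> hh; elim: n => [|n IH]; first exact: holomorphic_W_id.
exact: (holomorphic_W_comp hh IH).
Qed.

Lemma deck_holomorphic g : deck g -> @holomorphic R W W g.
Proof. by move=> /deckP[n [->|->]]; exact: iter_holomorphic. Qed.

Lemma quotient_map_continuous (phi : hopf_space f -> hopf_space f) g : continuous g ->
  (forall p, pi (g p) = phi (pi p)) -> continuous phi.
Proof.
move=> cg gphi; apply/continuousP => A oA.
rewrite -[open _]/(open (pi @^-1` (phi @^-1` A))).
have -> : pi @^-1` (phi @^-1` A) = (pi \o g) @^-1` A.
  by apply/seteqP; split => p /=; rewrite gphi.
apply: open_comp => // p _.
by apply: (@continuous_comp _ _ _ g pi p); [exact: cg|exact: hopf_pi_continuous].
Qed.

(** From phi to g, the charts through [p] and [g p] make the correcting deck transformation fix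
    [g p], so it is the identity. Conversely, transitions are g followed by a deck transformation,
    which is holomorphic. *)
Lemma lift_holomorphic (phi : hopf f -> hopf f) g : continuous g -> (forall p, pi (g p) = phi (pi p)) ->
  @holomorphic R (hopf f) (hopf f) phi <-> @holomorphic R W W g.
Proof.
move=> cg gphi; split=> [[cphi dphi]|hg].
  apply/holomorphicP => p.
  have [k [ck kp k2]] := chart_at p; have [l [cl lp l2]] := chart_at (g p).
  have lp' : l.1 (phi (pi p)) by rewrite -gphi.
  have [q [n [kq _ dn nE near_ext]]] := transition_lift cphi cg gphi ck cl kp lp'.
  have qp : q = p by apply: W_inj; rewrite -kq.
  move: nE; rewrite qp -gphi l2 => /W_inj/(deck_free dn) n1.
  move: near_ext; rewrite n1 k2 => near_ext.
  have : differentiable (l.2 \o phi \o 'pinv_(fun=> pi p) k.1 k.2) (val p).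
    by rewrite -k2; exact: dphi.
  by apply: near_eq_differentiable; apply: filterS near_ext => y /esym.
split; first exact: quotient_map_continuous cg gphi.
move=> k l ck cl x kx lx.
have cphi := quotient_map_continuous cg gphi.
have [q [n [kq _ dn _ near_ext]]] := transition_lift cphi cg gphi ck cl kx lx.
apply: near_eq_differentiable near_ext _; rewrite kq.
by have /holomorphicP := holomorphic_W_comp (deck_holomorphic dn) hg; apply.
Qed.

Lemma iter_inj (a : nat) : iter a f = f -> a = 1%N.
Proof.
move=> e; have h p : iter a f p = f p by rewrite e.
case: a h {e} => [|[//|a]] h.
  by case: (@iter_fixfree 1 (W1 R)) => //; rewrite /= -h.
by case: (@iter_fixfree a.+1 (W1 R)) => //; apply: (can_inj fK); exact: h.
Qed.

Lemma iter_finv_neq (a : nat) : iter a finv <> f.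
Proof.
move=> e; have e' p : f p = iter a finv p by rewrite e.
by case: (@iter_fixfree a.+1 (W1 R)) => //; rewrite iterSr e' (iterK _ Kf).
Qed.

(** If g conjugates f to a power of exponent m up to sign, and its inverse h does so with exponent
    k, applying both gives f as a power of exponent m k up to sign. As f has infinite order, m =
    1. *)
Lemma normalizer_exponent g h : cancel g h -> cancel h g ->
  (exists2 n, deck n & g \o f = n \o g) -> (exists2 n, deck n & h \o f = n \o h) ->
  g \o f = f \o g \/ g \o f = finv \o g.
Proof.
move=> gh hg [n /deckP[m nE] gf] [v /deckP[k vE] hf].
have hK : h \o n \o g = f by rewrite -compA -gf; apply/funext => p /=; rewrite gh.
have [v' [vK v'E]] : exists v', cancel v v' /\
    ((v = iter k f /\ v' = iter k finv) \/ (v = iter k finv /\ v' = iter k f)).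
  case: vE => ->; [exists (iter k finv)|exists (iter k f)]; split.
  - exact: iterK fK.
  - by left.
  - exact: iterK Kf.
  - by right.
have hfinv := semiconj_inv Kf vK hf.
have key F : h \o n = F \o h -> F = f.
  by move=> hn; rewrite -hK hn; apply/funext => p /=; rewrite gh.
have m1 : m = 1%N.
  have prod1 : iter m (iter k f) = f -> m = 1%N.
    by rewrite iter_iter => /iter_inj /eqP; rewrite muln_eq1 => /andP[_ /eqP].
  have absurd : iter m (iter k finv) <> f by rewrite iter_iter; exact: iter_finv_neq.
  case: nE => nE.
    have := key (iter m v); rewrite nE => /(_ (semiconj_iter _ hf)).
    by case: v'E => -[-> _].
  have := key (iter m v'); rewrite nE => /(_ (semiconj_iter _ hfinv)).
  by case: v'E => -[_ ->].
by case: nE gf => ->; rewrite m1; [left|right].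
Qed.

Hypothesis noninv : forall g, @holomorphic R W W g -> g \o f <> finv \o g.

Lemma automorphism_lift (phi : hopf f -> hopf f) : Aut_h (hopf f) phi ->
  exists g, [/\ Aut_h W g, g \o f = f \o g & forall p, pi (g p) = phi (pi p)].
Proof.
move=> [hphi [phi' [hphi' phiK Kphi]]].
have [g cg gphi] := continuous_lift hphi.1.
have [h0 ch0 h0phi] := continuous_lift hphi'.1.
(* The composite of lifts of phi and of its inverse covers the identity, hence is a deck
   transformation; composing [h0] with the inverse of the latter gives a left inverse of [g]. *)
have [n' [dn' nK Kn]] : exists n, [/\ deck n, cancel (h0 \o g) n & cancel n (h0 \o g)].
  apply: deck_inv; apply: continuous_deck => [|p]; first exact: comp_continuous.
  by rewrite /= h0phi gphi phiK.
pose h := n' \o h0.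
have ch : continuous h by apply: comp_continuous => //; exact: deck_continuous.
have hphi2 p : pi (h p) = phi' (pi p) by rewrite /h /= pi_deck.
have gh : cancel g h by exact: nK.
have hg : cancel h g.
  (* The other composite also covers the identity, so it is a bijection; this upgrades the left
     inverse to a two-sided one. *)
  have [d' [_ _ Kd]] : exists d, [/\ deck d, cancel (g \o h) d & cancel d (g \o h)].
    apply: deck_inv; apply: continuous_deck => [|p]; first exact: comp_continuous.
    by rewrite /= gphi -/(h p) hphi2 Kphi.
  by move=> p; rewrite -(Kd p) /= -/(h _) gh.
have twist (u : W -> W) chi : continuous u -> (forall p, pi (u p) = chi (pi p)) ->
    exists2 m, deck m & u \o f = m \o u.
  move=> cu uchi; apply: continuous_deck_eq => //; first exact: comp_continuous.
  by move=> p; apply/hopf_piP; rewrite /= !uchi pi_deck//; exact: deck_f.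
have hg' := (lift_holomorphic cg gphi).1 hphi.
have hh := (lift_holomorphic ch hphi2).1 hphi'.
exists g; split => //; first by split => //; exists h.
case: (normalizer_exponent gh hg (twist g phi cg gphi) (twist h phi' ch hphi2)) => // gf.
by case: (noninv hg' gf).
Qed.

(** * Automorphisms compatible with a Real structure *)

Section RealStructure.
Variable s : W -> W.
Hypotheses (cs : continuous s) (sf : s \o f = f \o s) (ss : involutive s).

Local Notation G := (Aut_h_W f s).

Lemma Aut_h_comp g h : Aut_h W g -> Aut_h W h -> Aut_h W (g \o h).
Proof.
move=> [hg [g' [hg' gK Kg]]] [hh [h' [hh' hK Kh]]].
split; first exact: holomorphic_W_comp.
exists (h' \o g'); split; first exact: holomorphic_W_comp.
- by move=> p /=; rewrite gK hK.
- by move=> p /=; rewrite Kh Kg.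
Qed.

Lemma commute_comp (g h u : W -> W) : g \o u = u \o g -> h \o u = u \o h ->
  (g \o h) \o u = u \o (g \o h).
Proof. by move=> gu hu; rewrite -compA hu compA gu. Qed.

Lemma commute_inv (g g' u : W -> W) : cancel g g' -> cancel g' g -> g \o u = u \o g ->
  g' \o u = u \o g'.
Proof.
move=> gK Kg gu; apply/funext => p /=; apply: (can_inj gK).
by rewrite Kg (commutingE _ gu) Kg.
Qed.

Lemma Aut_h_W_group : is_group G.
Proof.
split.
- split=> //; split; first exact: holomorphic_W_id.
  by exists id; split => //; exact: holomorphic_W_id.
- move=> g h [ag gf gs] [ah hf hs]; split; [exact: Aut_h_comp| |]; exact: commute_comp.
move=> g [[hg [g' [hg' gK Kg]]] gf gs]; exists g'; split => //; split.
- by split => //; exists g.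
- exact: commute_inv gf.
- exact: commute_inv gs.
Qed.

Lemma deck_sub_Aut : deck `<=` G.
Proof.
move=> g dg; split.
- split; first exact: deck_holomorphic.
  by have [h [dh gK Kg]] := deck_inv dg; exists h; split => //; exact: deck_holomorphic.
- by rewrite (deck_comm dg erefl).
- by rewrite (deck_comm dg sf).
Qed.

Lemma deck_central : central_subgroup deck G.
Proof.
split; [exact: Aut_h_W_group|exact: deck_is_group|exact: deck_sub_Aut|].
by move=> n g dn [_ gf _]; rewrite (deck_comm dn gf).
Qed.

Lemma lift_commutes_real (phi : hopf f -> hopf f) g : continuous g -> g \o f = f \o g ->
  (forall p, pi (g p) = phi (pi p)) -> phi \o Defs.induced s = Defs.induced s \o phi -> g \o s = s \o g.
Proof.
move=> cg gf gphi phis.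
have [|n dn gsE] := continuous_deck_eq (comp_continuous cs cg) (comp_continuous cg cs).
  move=> p; apply/hopf_piP; rewrite /= -(induced_pi _ sf) !gphi -(induced_pi _ sf).
  exact: (congr1 (@^~ (pi p)) (esym phis)).
have nn : n \o n = id.
  (* By freeness one fixed point is enough: using the relation twice in g (s (s p)) = g p shows that
     n o n fixes g p. *)
  apply: (@deck_free _ (g (W1 R)) (deck_comp dn dn)) => /=.
  have e p : g (s p) = n (s (g p)) by exact: (congr1 (@^~ p) gsE).
  rewrite -{2}(ss (W1 R)) e e -[s (n _)]/((s \o n) _) (deck_comm dn sf) /= ss.
  by [].
by rewrite gsE (deck_square dn nn).
Qed.

Lemma left_coset_id g : left_coset deck g g.
Proof. by exists id => //; exact: deck_id. Qed.

Lemma left_coset_deck g n : deck n -> left_coset deck (g \o n) = left_coset deck g.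
Proof.
move=> dn; have [n' [dn' nK Kn]] := deck_inv dn.
apply/seteqP; split => _ [m dm <-].
  by exists (n \o m) => //; exact: deck_comp.
exists (n' \o m); first exact: deck_comp.
by apply/funext => p /=; rewrite Kn.
Qed.

(** All elements of a coset induce the same map of the surface, so the representative chosen by
    [xget] does not matter; the default [id] concerns only the empty set. *)
Definition coset_map (X : set (W -> W)) : hopf f -> hopf f := @Defs.induced R f (@xget {classic (W -> W)} id X).

Lemma coset_mapE g p : G g -> coset_map (left_coset deck g) (pi p) = pi (g p).
Proof.
move=> [_ gf _]; rewrite /coset_map.
have [n dn <-] : left_coset deck g (@xget {classic (W -> W)} id (left_coset deck g)).
  by apply: xgetPex; exists g; exact: left_coset_id.
have nf : n \o f = f \o n by rewrite (deck_comm dn erefl).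
rewrite induced_pi; last exact: commute_comp.
apply/hopf_piP/orb_sym; rewrite /= -[g (n p)]/((g \o n) p) (deck_comm dn gf).
exact: deck_orb.
Qed.

Lemma hopf_map_ext (phi chi : hopf f -> hopf f) : (forall p, phi (pi p) = chi (pi p)) -> phi = chi.
Proof. by move=> e; apply/funext => x; have [p <-] := hopf_pi_surj x. Qed.

Lemma hopf_identified : Aut_hopf_identified f s.
Proof.
exists coset_map; split; last by move=> g Gg p; exact: coset_mapE.
- split.
  + move=> _ [g Gg <-]; have [[hg [g' [hg' gK Kg]]] gf gs] := Gg.
    have Gg' : G g'.
      split; [by split => //; exists g|exact: commute_inv gf|exact: commute_inv gs].
    have cg := hg.1; have cg' := hg'.1.
    have gE p := esym (coset_mapE p Gg); have gE' p := esym (coset_mapE p Gg').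
    split; first split.
    * exact: (lift_holomorphic cg gE).2.
    * exists (coset_map (left_coset deck g')); split.
      - exact: (lift_holomorphic cg' gE').2.
      - by move=> x; have [p <-] := hopf_pi_surj x; rewrite -gE -gE' gK.
      - by move=> x; have [p <-] := hopf_pi_surj x; rewrite -gE' -gE Kg.
    * apply: hopf_map_ext => p; rewrite /= (induced_pi _ sf) -!gE (induced_pi _ sf).
      by rewrite (commutingE _ gs).
  (* Injectivity: equal induced maps have lifts that differ by a deck transformation on the left,
     and centrality moves it to the right, into the coset. *)
  + move=> X Y /set_mem[g Gg <-] /set_mem[h Gh <-] e.
    have [[hg _] gf _] := Gg; have [[hh _] _ _] := Gh.
    have [|n dn ->] := continuous_deck_eq hg.1 hh.1.
      by move=> p; apply/hopf_piP; rewrite -!coset_mapE// e.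
    by rewrite -(deck_comm dn gf) left_coset_deck.
  + move=> phi [aphi phis]; have [g [ag gf gphi]] := automorphism_lift aphi.
    have Gg : G g by split => //; apply: (lift_commutes_real _ gf gphi phis); case: ag => -[].
    exists (left_coset deck g); first by exists g.
    by apply: hopf_map_ext => p; rewrite coset_mapE.
- move=> _ _ [g Gg <-] [h Gh <-].
  have [_ Gc _] := Aut_h_W_group.
  (* The product of the cosets is again one coset because the deck factor of [g] can be moved past
     [h]. *)
  have -> : compset (left_coset deck g) (left_coset deck h) = left_coset deck (g \o h).
    have [_ hf _] := Gh; apply/seteqP; split.
      move=> _ [_ [n dn <-] [_ [m dm <-] <-]]; exists (n \o m); first exact: deck_comp.
      by apply/funext => p /=; rewrite -[h (n _)]/((h \o n) _) (deck_comm dn hf).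
    move=> _ [n dn <-]; exists g; first exact: left_coset_id.
    by exists (h \o n) => //; exists n.
  apply: hopf_map_ext => p.
by rewrite (coset_mapE _ (Gc _ _ Gg Gh)) /= (coset_mapE _ Gh) (coset_mapE _ Gg).
Qed.

End RealStructure.

End Covering.

(** * The contractions with the conjugations [c] and [c'] *)

Section Identification.
Variable R : realType.
Local Notation C := R[i].
Local Notation W := (W R).

Lemma contraction_identification (f s : W -> W) (mu kap de : C) (r : nat) :
  0 < normc mu < 1 -> 0 < normc de < 1 -> (0 < r)%N -> given_by f (lowerF mu kap r de) ->
  continuous s -> f \o s = s \o f -> involutive s ->
  central_subgroup (cyclic_group f) (Aut_h_W f s) /\ Aut_hopf_identified f s.
Proof.
move=> mu01 de01 r0 fE cs fs ss.
have mu0 := contraction_neq0 mu01; have de0 := contraction_neq0 de01.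
have [e [lam [L [e0 lam01 L1 flam fL]]]] := lower_rho_contracts mu01 de01 r0 fE.
have [fK Kf] := lowerK mu0 de0 r0 fE.
have holf := lower_holomorphic fE.
have holfinv : @holomorphic R W W (lower_inv mu kap r de).
  by apply: lower_holomorphic; apply: lowerE; rewrite ?invr_eq0.
have crho : continuous (fun p : W => rho e r (val p)).
  by move=> p; apply: (@continuous_comp _ _ _ _ (rho e r) p); [exact: val_continuous|exact: rho_continuous].
have rho0 (p : W) : 0 < rho e r (val p) by apply: rho_gt0 => //; exact: val_neq0.
have noninv (g : W -> W) : @holomorphic R W W g -> g \o f <> lower_inv mu kap r de \o g.
  exact: (not_inverse_conjugate e0 r0 lam01 L1 fK Kf flam fL).
split.
  exact: (deck_central fK Kf holf.1 holfinv.1 crho rho0 lam01 flam holf holfinv (esym fs)).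
exact: (hopf_identified fK Kf holf.1 holfinv.1 crho rho0 lam01 flam holf holfinv noninv cs (esym fs) ss).
Qed.

Lemma cK : involutive (@c R).
Proof. by move=> p; apply: W_inj; rewrite !c_given_by /= !conjcK [RHS]surjective_pairing. Qed.

Lemma c'K : involutive (@c' R).
Proof. by move=> p; apply: W_inj; rewrite !c'_given_by /= !conjcK [RHS]surjective_pairing. Qed.

Lemma conjc_continuous : continuous (@conjc R : R[i]^o -> R[i]^o).
Proof.
move=> z; apply/continuous_normcP => e e0; apply/near_normcP; exists e => // t tz.
have -> : conjc t - conjc z = conjc (t - z) by case: t z {tz} => [? ?] [? ?]; rewrite /= opprD.
by rewrite normc_conj.
Qed.

Lemma conj_coordinate_continuous (h : C2 R -> R[i]^o) : continuous h ->
  continuous (fun p : W => conjc (h (val p)) : R[i]^o).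
Proof.
move=> ch p; apply: (@continuous_comp _ _ _ (fun q : W => h (val q))); last exact: conjc_continuous.
by apply: (@continuous_comp _ _ _ (fun q : W => val q : C2 R) h p); [exact: val_continuous|exact: ch].
Qed.

Lemma c_continuous : continuous (@c R).
Proof.
move=> p; apply: continuous_toW.
have h1 : {for p, continuous (fun q : W => conjc (val q : C2 R).1 : R[i]^o)}.
  by apply: (@conj_coordinate_continuous fst) => x; exact: cvg_fst.
have h2 : {for p, continuous (fun q : W => conjc (val q : C2 R).2 : R[i]^o)}.
  by apply: (@conj_coordinate_continuous snd) => x; exact: cvg_snd.
by move=> A; exact: (cvg_pair h1 h2).
Qed.

Lemma c'_continuous : continuous (@c' R).
Proof.
move=> p; apply: continuous_toW.
have h1 : {for p, continuous (fun q : W => conjc (val q : C2 R).2 : R[i]^o)}.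
  by apply: (@conj_coordinate_continuous snd) => x; exact: cvg_snd.
have h2 : {for p, continuous (fun q : W => conjc (val q : C2 R).1 : R[i]^o)}.
  by apply: (@conj_coordinate_continuous fst) => x; exact: cvg_fst.
by move=> A; exact: (cvg_pair h1 h2).
Qed.

End Identification.

Theorem theorem4p1 (R : realType) (f : W R -> W R)
    (hf : [\/ IV f, exists r, III r f, exists r, IIa r f
            | IIb f \/ exists alpha delta, IIc alpha delta f]) :
  [/\ real_coefficients f ->
      [/\ IV f -> Aut_h_W f (@c R) =
            [set g | exists2 A : 'M[R]_2, A \in unitmx &
               given_by g (fun z w => ((A 0 0)%:C * z + (A 0 1)%:C * w,
                                       (A 1 0)%:C * z + (A 1 1)%:C * w))],
          forall r, III r f -> Aut_h_W f (@c R) =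
            [set g | exists a b d : R, [/\ a != 0, d != 0 &
               given_by g (fun z w => (a%:C * z + b%:C * w ^+ r, d%:C * w))]],
          forall r, IIa r f -> Aut_h_W f (@c R) =
            [set g | exists a b : R, a != 0 /\
               given_by g (fun z w => ((a ^+ r)%:C * z + b%:C * w ^+ r, a%:C * w))],
          IIb f -> Aut_h_W f (@c R) =
            [set g | exists a b : R, a != 0 /\
               given_by g (fun z w => (a%:C * z + b%:C * w, a%:C * w))]
        & forall alpha delta, IIc alpha delta f ->
            (forall r, delta != alpha ^+ r) ->
            Aut_h_W f (@c R) =
            [set g | exists a d : R, [/\ a != 0, d != 0 &
               given_by g (fun z w => (a%:C * z, d%:C * w))]]],
      IIc' f -> Aut_h_W f (@c' R) =
        [set g | exists a : R[i], a != 0 /\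
           given_by g (fun z w => (a * z, a^* * w))],
      real_coefficients f ->
        central_subgroup (cyclic_group f) (Aut_h_W f (@c R)) /\
        Aut_hopf_identified f (@c R)
    & IIc' f ->
        central_subgroup (cyclic_group f) (Aut_h_W f (@c' R)) /\
        Aut_hopf_identified f (@c' R)].
Proof.
have [mu [kap [r [de [mu01 de01 r0 fE]]]]] := contraction_normal_form hf.
split.
- move=> _; split.
  + exact: centralizer_IV.
  + exact: centralizer_III.
  + exact: centralizer_IIa.
  + exact: centralizer_IIb.
  + exact: centralizer_IIc.
- exact: centralizer_IIc'.
- move=> fR; apply: contraction_identification mu01 de01 r0 fE _ _ _.
  + exact: c_continuous.
  + exact: real_coefficients_commute_c.
  + exact: cK.
- move=> fIIc'; apply: contraction_identification mu01 de01 r0 fE _ _ _.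
  + exact: c'_continuous.
  + exact: IIc'_commute.
  + exact: c'K.
Qed.
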